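(* Let $k\ge2$, $\mathcal X\subset\mathbb R^n$ open, $m>n$, and let the vector field $f\in C^{0,k}(\Omega,\mathbb R^m)$ and the time $T>0$ be fixed. Any augmented scalar neural ODE $\Phi\in\mathrm{NODE}^k_{\mathrm A}(\mathcal X,\mathbb R)$ with weights and biases $(W,\widetilde W,b,\tilde b)\in\mathbb V^*$ is, for all $\operatorname{vecm}(W,\widetilde W,b,\tilde b)\in\mathbb R^{N_V}$ (for which it is well-defined), except possibly for a set of Lebesgue measure zero in $\mathbb R^{N_V}$, of class $(\mathcal C1)^k(\mathcal X,\mathbb R)$ or $(\mathcal C2)^k(\mathcal X,\mathbb R)$, and hence a Morse function.
   Context: Neural ODE setting. Consider the initial value problem $\frac{\mathrm dh}{\mathrm dt}=f(t,h(t))$, $h(0)=a$, with $f:\Omega\to\mathbb R^m$, $\Omega=\Omega_t\times\Omega_h\subset\mathbb R\times\mathbb R^m$ open, with solution $h_a:\mathcal I_a\to\mathbb R^m$ on its maximal (open) interval of existence $\mathcal I_a\subset\Omega_t$. For $k\ge1$, $\mathrm{NODE}^k(\mathcal X,\mathbb R)$ is the set of all maps $\Phi:\mathcal X\to\mathbb R$, $\Phi(x)=\widetilde W\,h_{Wx+b}(T)+\tilde b$, with $W\in\mathbb R^{m\times n}$, $b\in\mathbb R^m$, $\widetilde W\in\mathbb R^{1\times m}$, $\tilde b\in\mathbb R$, with $f\in C^{0,k}(\Omega,\mathbb R^m)$ (continuous in $t$, $k$ times continuously differentiable in $h$), such that $\mathcal A=\{Wx+b:x\in\mathcal X\}\subset\Omega_h$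 and $[0,T]\subset\mathcal I_a$ for all $a\in\mathcal A$ (well-definedness). The neural ODE is augmented if $n<m$, $\operatorname{rank}(W)=n$ and $\operatorname{rank}(\widetilde W)=1$; $\mathrm{NODE}^k_{\mathrm A}(\mathcal X,\mathbb R)$ is the set of these. Parameter space: $\mathbb V=\mathbb R^{m\times n}\times\mathbb R^{1\times m}\times\mathbb R^m\times\mathbb R$, and $\mathbb V^*$ is the subset of $(W,\widetilde W,b,\tilde b)$ with $\operatorname{rank}(W)=\min\{m,n\}$ and $\operatorname{rank}(\widetilde W)=1$. $\operatorname{vecm}:\mathbb V\to\mathbb R^{N_V}$, $N_V=mn+2m+1$, is the bijection stacking all entries into one vector. $(\mathcal C1)^k(\mathcal X,\mathbb R)$: $C^k$ functions with no critical point. $(\mathcal C2)^k(\mathcal X,\mathbb R)$: $C^k$ functions with at least one critical point, the Hessian being non-singular at every critical point. A Morse function is a $C^2$ function all of whose critical points have non-singular Hessian. *)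

(* Defs.v *)
From HB Require Import structures.
From mathcomp Require Import all_boot all_order all_algebra.
From mathcomp Require Import all_classical all_reals all_analysis.
Set Implicit Arguments.
Unset Strict Implicit.
Unset Printing Implicit Defensive.
Import Order.TTheory GRing.Theory Num.Theory.
Import numFieldNormedType.Exports.
Local Open Scope classical_set_scope.
Local Open Scope ring_scope.

Section Smoothness.
Context {R : realType}.

(* All iterated directional derivatives of [f] of order at most [k] along the
   directions [e i] exist and are continuous on [U]; [U] is meant to be open,
   so only the values of [f] on [U] matter. *)
Fixpoint Cdir {V W : normedModType R} {I : Type} (e : I -> V) (k : nat)
    (U : set V) (f : V -> W) : Prop :=
  (forall x, U x -> {for x, continuous f}) /\
  (if k is k'.+1 then
     forall i, (forall x, U x -> derivable f x (e i)) /\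
               Cdir e k' U (fun x => 'D_(e i) f x)
   else True).

Definition unitvec (n : nat) (i : 'I_n) : 'cV[R]_n := delta_mx i 0.

Definition Ck (n k : nat) (U : set 'cV[R]_n) (f : 'cV[R]_n -> R) : Prop :=
  Cdir (@unitvec n) k U f.

(* C^{0,k}(Omega): [f] and its partial derivatives in [h] up to order [k] are
   jointly continuous in (t, h); no derivative in [t] is required. *)
Definition C0k (m k : nat) (Omega : set (R * 'cV[R]_m))
    (f : R * 'cV[R]_m -> 'cV[R]_m) : Prop :=
  Cdir (fun i : 'I_m => (0, unitvec i) : R * 'cV[R]_m) k Omega f.

Definition gradient (n : nat) (f : 'cV[R]_n -> R) (x : 'cV[R]_n) : 'cV[R]_n :=
  \col_i 'D_(unitvec i) f x.

Definition hessian (n : nat) (f : 'cV[R]_n -> R) (x : 'cV[R]_n) : 'M[R]_n :=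
  \matrix_(i, j) 'D_(unitvec i) (fun y => 'D_(unitvec j) f y) x.

Definition critical_point (n : nat) (f : 'cV[R]_n -> R) (x : 'cV[R]_n) : Prop :=
  gradient f x = 0.

Definition classC1 (n k : nat) (X : set 'cV[R]_n) (f : 'cV[R]_n -> R) : Prop :=
  Ck k X f /\ ~ (exists2 x, X x & critical_point f x).

Definition classC2 (n k : nat) (X : set 'cV[R]_n) (f : 'cV[R]_n -> R) : Prop :=
  [/\ Ck k X f,
      exists2 x, X x & critical_point f x
    & forall x, X x -> critical_point f x -> hessian f x \in unitmx].

Definition morse (n : nat) (X : set 'cV[R]_n) (f : 'cV[R]_n -> R) : Prop :=
  Ck 2 X f /\
  forall x, X x -> critical_point f x -> hessian f x \in unitmx.

End Smoothness.

(* The parameter space V, with components (W, W~, b, b~). *)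
Definition params (R : realType) (n m : nat) : Type :=
  ('M[R]_(m, n) * 'M[R]_(1, m) * 'cV[R]_m * R)%type.

Section NeuralODE.
Context {R : realType}.

Definition is_solution (m : nat) (Omega : set (R * 'cV[R]_m))
    (f : R * 'cV[R]_m -> 'cV[R]_m) (a : 'cV[R]_m) (I : set R)
    (h : R -> 'cV[R]_m) : Prop :=
  [/\ open I, is_interval I, I 0, h 0 = a &
      forall t, I t -> Omega (t, h t) /\ is_derive t (1 : R) h (f (t, h t))].

(* [I] is the maximal interval of existence: [h] has no proper extension. *)
Definition is_maximal_solution (m : nat) (Omega : set (R * 'cV[R]_m))
    (f : R * 'cV[R]_m -> 'cV[R]_m) (a : 'cV[R]_m) (I : set R)
    (h : R -> 'cV[R]_m) : Prop :=
  is_solution Omega f a I h /\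
  forall (J : set R) (g : R -> 'cV[R]_m), is_solution Omega f a J g ->
    I `<=` J -> (forall t, I t -> g t = h t) -> J = I.

Definition Vstar (n m : nat) : set (params R n m) :=
  [set th | let: (W, Wt, b, bt) := th in
            \rank W = minn m n /\ \rank Wt = 1%N].

Definition vecm (n m : nat) (th : params R n m) :
    'cV[R]_(m * n + m + m + 1) :=
  let: (W, Wt, b, bt) := th in
  col_mx (col_mx (col_mx (mxvec W)^T Wt^T) b) (const_mx bt).

(* [Phi] is, on [X], the neural ODE map x |-> W~ h_{Wx+b}(T) + b~, and this map
   is well-defined: Wx+b lies in Omega_h and [0,T] in the maximal interval of
   existence.  Values of [Phi] outside [X] are irrelevant. *)
Definition NODE (n m : nat) (Omegat : set R) (Omegah : set 'cV[R]_m)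
    (f : R * 'cV[R]_m -> 'cV[R]_m) (T : R) (X : set 'cV[R]_n)
    (th : params R n m) (Phi : 'cV[R]_n -> R) : Prop :=
  let: (W, Wt, b, bt) := th in
  forall x, X x ->
    Omegah (W *m x + b) /\
    exists (I : set R) (h : R -> 'cV[R]_m),
      [/\ is_maximal_solution (Omegat `*` Omegah) f (W *m x + b) I h,
          `[0, T] `<=` I
        & Phi x = (Wt *m h T) 0 0 + bt].

Definition augmented (n m : nat) (th : params R n m) : Prop :=
  let: (W, Wt, b, bt) := th in
  [/\ (n < m)%N, \rank W = n & \rank Wt = 1%N].

Definition NODE_A (n m : nat) (Omegat : set R) (Omegah : set 'cV[R]_m)
    (f : R * 'cV[R]_m -> 'cV[R]_m) (T : R) (X : set 'cV[R]_n)
    (th : params R n m) (Phi : 'cV[R]_n -> R) : Prop :=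
  NODE Omegat Omegah f T X th Phi /\ augmented th.

End NeuralODE.

Section LebesgueNull.
Context {R : realType}.

Definition box (N : nat) (a b : 'cV[R]_N) : set 'cV[R]_N :=
  [set x | forall i, a i 0 <= x i 0 <= b i 0].

(* N-dimensional Lebesgue outer measure: infimum of the total volumes of the
   countable covers by closed boxes. *)
Definition lebesgue_outer (N : nat) (A : set 'cV[R]_N) : \bar R :=
  ereal_inf [set v | exists a b : nat -> 'cV[R]_N,
    [/\ forall k i, a k i 0 <= b k i 0,
        A `<=` \bigcup_k box (a k) (b k)
      & v = (\sum_(0 <= k <oo) (\prod_i (b k i 0 - a k i 0))%:E)%E]].

Definition lebesgue_null (N : nat) (A : set 'cV[R]_N) : Prop :=
  lebesgue_outer A = 0%E.

End LebesgueNull.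

(* Main.v *)
(* Let Psi be the time-T map of the ODE, on its open domain.  Stability estimates
   make Psi differentiable, its directional derivatives being the endpoints of
   the first variation; hence Psi is C^k, and its Jacobian J is invertible
   because the linear variational equation can be run backwards.

   A point x is critical for x |-> w^T Psi(W x + b) + b~ iff P^T w = 0, where
   P = J(W x + b) W has rank n.  If n rows S of P are independent, this equation
   can be solved for the entries w_S, so that near such a point the pairs
   (x, parameter) with x critical form a graph over the vectors in which x takes
   the place of w_S.  This gives a differentiable map [chart] from an
   open subset of the parameter space into it.  When the Hessian at x has a kernel vector v,
   the function q |-> (grad q) v vanishes on the graph and its differential at q
   kills the x-directions, so it restricts to a nonzero linear form annihilating
   the derivative of [chart].  The parameters with a degenerate critical point
   are thus critical values of finitely many charts, and Sard's theorem in equal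
   dimensions makes this set null: the image of a small cube of side s is
   contained in a slab of thickness o(s). *)
Require Import Defs.
From HB Require Import structures.
From mathcomp Require Import all_boot all_order all_algebra.
From mathcomp Require Import all_classical all_reals all_analysis.
From mathcomp Require Import perm ring lra.
Import Order.TTheory GRing.Theory Num.Theory.
Import numFieldNormedType.Exports.
Local Open Scope classical_set_scope.
Local Open Scope ring_scope.
Set Implicit Arguments.
Unset Strict Implicit.
Unset Printing Implicit Defensive.

(** * Sard's theorem in equal dimensions *)

(** No transversality or implicit function theorem is used. The gradient is linear in the output
    weights w, and the base point W x + b does not involve them, so the critical equation is solved
    by Cramer's rule: the charts are explicit formulas on explicit open sets. Regularity is the
    tight point. Sard's theorem is therefore stated pointwise: at a critical point x it asks for a
    bound |F y - F x| <= K |y - x| near x and one non-zero linear form l with l(F y - F x) = o(|y -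
    x|), and the critical set has to be relatively closed, which the continuity of the Hessian
    determinant provides. The second obstacle is that f is only continuous in t, so it need not be
    differentiable on R x R^m. All expansions of f are therefore taken in h alone, uniformly along
    the compact graph of one trajectory, and higher derivatives of the time-T map come from applying
    the first-order result to tangent equations. *)

Section MatrixNorm.
Context {R : realType}.

Lemma mx_norm_le m n (x : 'M[R]_(m, n)) (e : R) :
  0 <= e -> (forall i j, `|x i j| <= e) -> `|x| <= e.
Proof.
by move=> e0 xe; rewrite /Num.Def.normr/= mx_normrE (bigmax_le _ e0).
Qed.

Lemma mx_coord_le m n (x : 'M[R]_(m, n)) i j : `|x i j| <= `|x|.
Proof.
rewrite [leRHS]/Num.Def.normr/= mx_normrE.
exact: (le_bigmax _ (fun ij : 'I_m * 'I_n => `|x ij.1 ij.2|) (i, j)).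
Qed.

Lemma cV_norm_le n (x : 'cV[R]_n) (e : R) :
  0 <= e -> (forall i, `|x i 0| <= e) -> `|x| <= e.
Proof. by move=> e0 xe; apply: mx_norm_le => // i j; rewrite ord1. Qed.

End MatrixNorm.

Lemma near_norm (R : numFieldType) (V : normedModType R) (x : V) (P : V -> Prop) :
  (\forall y \near x, P y) -> exists2 d, 0 < d & forall y, `|y - x| < d -> P y.
Proof.
by move=> /nbhs_normP[d /= d0 dP]; exists d => // y yx; apply: dP; rewrite /= distrC.
Qed.

Section Covers.
Context {R : realType}.

Definition vol N (p : 'cV[R]_N * 'cV[R]_N) : R := \prod_i (p.2 i 0 - p.1 i 0).

(** Finite covers pass from the subcubes to the cube, so a single cube is treated without infinite
    sums; countable families enter with [sigma_null]. *)
Definition covered N (B : set 'cV[R]_N) (v : R) :=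
  exists s : seq ('cV[R]_N * 'cV[R]_N),
    [/\ forall p, p \in s -> forall i, p.1 i 0 <= p.2 i 0,
        forall x, B x -> exists2 p, p \in s & box p.1 p.2 x &
        \sum_(p <- s) vol p <= v].

Definition cube N (c : 'cV[R]_N) (s : R) : set 'cV[R]_N :=
  [set x | forall i, c i 0 <= x i 0 <= c i 0 + s].

Lemma vol_ge0 N (p : 'cV[R]_N * 'cV[R]_N) :
  (forall i, p.1 i 0 <= p.2 i 0) -> 0 <= vol p.
Proof. by move=> p12; apply: prodr_ge0 => i _; rewrite subr_ge0. Qed.

Lemma covered_sub N (A B : set 'cV[R]_N) v w :
  A `<=` B -> v <= w -> covered B v -> covered A w.
Proof.
move=> AB vw [s [s1 s2 s3]]; exists s; split => //; last exact: le_trans vw.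
by move=> x /AB/s2.
Qed.

Lemma covered0 N v : 0 <= v -> covered (@set0 'cV[R]_N) v.
Proof. by move=> v0; exists [::]; split => //; rewrite big_nil. Qed.

Lemma covered_bigcup N (I : finType) (B : I -> set 'cV[R]_N) (v : I -> R) :
  (forall i, covered (B i) (v i)) -> covered (\bigcup_i B i) (\sum_i v i).
Proof.
move=> /choice[s sP]; exists (flatten [seq s i | i <- enum I]); split.
- by move=> p /flatten_mapP[i _ ps]; have [+ _ _] := sP i; exact.
- move=> x [i _ Bix]; have [_ /(_ _ Bix)[p ps px] _] := sP i.
  by exists p => //; apply/flatten_mapP; exists i => //; rewrite mem_enum.
- rewrite big_flatten big_map big_enum /=.
  by apply: ler_sum => i _; have [] := sP i.
Qed.

Lemma cube_dist N (c : 'cV[R]_N) s y : 0 <= s -> cube c s y ->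
  forall x, cube c s x -> `|y - x| <= s.
Proof.
move=> s0 cy x cx; apply: cV_norm_le => // i; rewrite !mxE ler_norml.
by have /andP[? ?] := cy i; have /andP[? ?] := cx i; apply/andP; split; lra.
Qed.

Lemma half_pow_lt (s d : R) : 0 < d -> exists k : nat, s / 2 ^+ k < d.
Proof.
move=> d0; exists (Num.truncn (s / d)).+1.
rewrite ltr_pdivrMr ?exprn_gt0// mulrC -ltr_pdivrMr//.
apply: (lt_trans (truncnS_gt _)).
by rewrite -natrX ltr_nat ltn_expl.
Qed.

(* Bisection, as in Cousin's lemma: a failure on [cube c s] would propagate to
   a nested sequence of subcubes shrinking to a point, where [P] holds. *)
Lemma cube_induction N (P : 'cV[R]_N -> R -> Prop) (c : 'cV[R]_N) (s : R) :
  0 < s ->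
  (forall c s, 0 < s ->
    (forall t : {ffun 'I_N -> bool},
        P (c + (s / 2) *: \col_i (t i)%:R) (s / 2)) -> P c s) ->
  (forall x, cube c s x -> exists2 d, 0 < d &
    forall c' s', 0 < s' -> s' < d -> cube c' s' x -> P c' s') ->
  P c s.
Proof.
move=> s0 Psplit Ploc; apply: contrapT => nP.
have /choice[g gP] : forall cs : 'cV[R]_N * R, exists c' : 'cV[R]_N,
    0 < cs.2 -> ~ P cs.1 cs.2 -> ~ P c' (cs.2 / 2) /\
    forall i, cs.1 i 0 <= c' i 0 <= cs.1 i 0 + cs.2 / 2.
  move=> [c' s']/=; have [s'0|] := boolP (0 < s'); last by exists c'.
  have [Pc|nPc] := pselect (P c' s'); first by exists c'.
  have /existsNP[t nPt] := contra_not (Psplit _ _ s'0) nPc.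
  exists (c' + (s' / 2) *: \col_i (t i)%:R) => _ _; split => // i.
  by rewrite !mxE; case: (t i) => /=; rewrite ?mulr1n ?mulr0n; apply/andP; split; lra.
(* Successive subcubes on which [P] fails, each half as wide as the one before. *)
pose C k := iter k (fun cs => (g cs, cs.2 / 2)) (c, s).
have C2 k : (C k).2 = s / 2 ^+ k.
  elim: k => [|k IH]; first by rewrite expr0 divr1.
  by rewrite /= -/(C k) IH exprS invfM mulrA mulrAC.
have C2_gt0 k : 0 < (C k).2 by rewrite C2 divr_gt0// exprn_gt0.
have nPC k : ~ P (C k).1 (C k).2.
  by elim: k => [//|k IH]; have [] := gP (C k) (C2_gt0 k) IH.
have Cstep k i : (C k).1 i 0 <= (C k.+1).1 i 0 <= (C k).1 i 0 + (C k.+1).2.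
  by have [_] := gP (C k) (C2_gt0 k) (nPC k); exact.
have Chalf k : (C k.+1).2 = (C k).2 / 2 by [].
have Clo i (k j : nat) : (C k).1 i 0 <= (C (k + j)%N).1 i 0.
  elim: j => [|j IH]; first by rewrite addn0.
  by rewrite addnS (le_trans IH)//; case/andP: (Cstep (k + j)%N i).
have Chi i (k j : nat) : (C (k + j)%N).1 i 0 + (C (k + j)%N).2 <= (C k).1 i 0 + (C k).2.
  elim: j => [|j IH]; first by rewrite addn0.
  rewrite addnS (le_trans _ IH)//; have /andP[_] := Cstep (k + j)%N i.
  by rewrite Chalf; set u := (C _).2; lra.
pose S i := [set (C k).1 i 0 | k in [set: nat]].
(* Every lower corner lies below every upper corner, whichever index is larger, so the suprema of
   the lower corners form a point common to all the cubes. *)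
have CUB i (k j : nat) : (C j).1 i 0 <= (C k).1 i 0 + (C k).2.
  have [kj|/ltnW jk] := leqP k j.
    rewrite -(subnKC kj); apply: le_trans (Chi i k (j - k)%N).
    by rewrite lerDl ltW.
  have := Clo i j (k - j)%N; rewrite subnKC// => /le_trans; apply.
  by rewrite lerDl ltW.
pose x : 'cV[R]_N := \col_i sup (S i).
have xC k : cube (C k).1 (C k).2 x.
  move=> i; rewrite mxE; apply/andP; split.
    apply: ub_le_sup; last by exists k.
    by exists ((C 0).1 i 0 + (C 0).2) => _ [j _ <-].
  apply: ge_sup; first by exists ((C 0).1 i 0); exists 0%N.
  by move=> _ [j _ <-].
have [d d0 dP] := Ploc x (xC 0%N).
have [k kd] := half_pow_lt s d0.
by apply: (nPC k); apply: dP => //; rewrite C2.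
Qed.

Lemma subdivision_cell (L t : R) (M : nat) : 0 < L -> 0 <= t <= L ->
  exists c : 'I_M.+1, L / M.+1%:R * c%:R <= t <= L / M.+1%:R * c%:R + L / M.+1%:R.
Proof.
move=> L0 /andP[t0 tL]; set h := L / M.+1%:R.
have h0 : 0 < h by rewrite divr_gt0.
have th0 : 0 <= t / h by rewrite divr_ge0// ltW.
have [kM|Mk] := ltnP (Num.truncn (t / h)) M.+1.
  exists (Ordinal kM) => /=; have /andP[k1 k2] := truncn_itv th0.
  apply/andP; split; first by rewrite mulrC -ler_pdivlMr.
  move/ltW: k2; rewrite ler_pdivrMr// mulrC -natr1 mulrDr mulr1//.
(* The truncation overflows only at the right end t = L, which the last closed cell contains. *)
exists ord_max => /=.
have ML : h * M.+1%:R = L by rewrite /h divfK.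
have -> : t = L.
  apply/eqP; rewrite eq_le tL /=.
  have : M.+1%:R <= t / h by rewrite -Num.Theory.truncn_ge_nat.
  by rewrite ler_pdivlMr// mulrC ML.
rewrite -ML -[in M.+1%:R]natr1 mulrDr mulr1 lexx andbT lerDl ltW//.
Qed.

(** Since [l 0 i = 1], the i-th coordinate of a point of [B] is determined by the others up to D s.
    The other coordinates range over cells of side h = 2 K s / (M + 1); over such a cell the i-th
    one stays within E = D s + h * (sum of the [|l 0 j|]) of a fixed value. The total volume is 2 E
    (2 K s)^(N-1). *)
Lemma slab_covered N (y0 : 'cV[R]_N) (l : 'rV[R]_N) (i : 'I_N) (K D s : R)
    (M : nat) (B : set 'cV[R]_N) :
  0 < K -> 0 < s -> 0 < D -> l 0 i = 1 ->
  (forall y, B y -> `|y - y0| <= K * s /\ `|(l *m (y - y0)) 0 0| <= D * s) ->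
  covered B (s ^+ N * ((2 * K) ^+ N.-1 * (2 * (D + (\sum_j `|l 0 j|) * (2 * K / M.+1%:R))))).
Proof.
move=> K0 s0 D0 li By.
set La := \sum_j _; set M' := M.+1%:R.
have M'0 : 0 < M' :> R by rewrite ltr0n.
have La0 : 0 <= La by apply: sumr_ge0.
pose h := 2 * K * s / M'.
have h0 : 0 < h by rewrite /h !mulr_gt0// invr_gt0.
pose left (c : {ffun 'I_N -> 'I_M.+1}) j : R := - (K * s) + h * (c j)%:R.
pose E := D * s + La * h.
have E0 : 0 < E by rewrite ltr_wpDr// ?mulr_gt0// mulr_ge0// ltW.
(* The i-th coordinate, relative to [y0], of the point of the hyperplane l = 0 above the left corner
   of the cell. *)
pose mid c := - \sum_(j | j != i) l 0 j * left c j.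
(* The interval of length 2 E in direction i is also cut into M + 1 pieces, only so that functions
   from ['I_N] to ['I_M.+1] index all the boxes. *)
pose lo c : 'cV[R]_N := \col_j (y0 j 0 +
  if j == i then mid c - E + 2 * E / M' * (c i)%:R else left c j).
pose wd j := if j == i then 2 * E / M' else h.
pose hi c : 'cV[R]_N := \col_j (lo c j 0 + wd j).
have wd0 j : 0 < wd j.
  by rewrite /wd; case: ifP => _ //; rewrite divr_gt0// mulr_gt0.
exists [seq (lo c, hi c) | c <- enum {ffun 'I_N -> 'I_M.+1}]; split.
- by move=> _ /mapP[c _ ->] j /=; rewrite [leRHS]mxE lerDl ltW.
- move=> y /By[yK yD].
  have cell j : exists c : 'I_M.+1,
      h * c%:R <= (y - y0) j 0 + K * s <= h * c%:R + h.
    have -> : h = (2 * (K * s)) / M' by rewrite /h mulrA.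
    apply: subdivision_cell; first by rewrite !mulr_gt0.
    have := le_trans (mx_coord_le _ j 0) yK; rewrite ler_norml => /andP[? ?].
    by apply/andP; split; lra.
  have [c0 c0P] := choice cell.
  have sumE (f : 'I_N -> R) : \sum_j l 0 j * f j = f i + \sum_(j | j != i) l 0 j * f j.
    by rewrite (bigD1 i)//= li mul1r.
  pose mid0 := - \sum_(j | j != i) l 0 j * (- (K * s) + h * (c0 j)%:R).
  have yi : `|(y - y0) i 0 - mid0| <= E.
    have -> : (y - y0) i 0 - mid0 = (l *m (y - y0)) 0 0 -
       \sum_(j | j != i) l 0 j * ((y - y0) j 0 - (- (K * s) + h * (c0 j)%:R)).
      rewrite [(l *m _) 0 0]mxE (sumE (fun j => (y - y0) j 0)) /mid0.
      rewrite opprK -addrA -sumrB; congr (_ + _).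
      by apply: eq_bigr => j _; ring.
    rewrite (le_trans (ler_normB _ _))// lerD//.
    apply: (le_trans (ler_norm_sum _ _ _)).
    rewrite /La mulr_suml [leRHS](bigD1 i)//= ler_wpDl//.
      by rewrite mulr_ge0// ltW.
    apply: ler_sum => j _; rewrite normrM ler_wpM2l//.
    have /andP[? ?] := c0P j; rewrite ler_norml; apply/andP; split; lra.
  have [ci ciP] : exists c : 'I_M.+1,
     2 * E / M' * c%:R <= (y - y0) i 0 - mid0 + E <= 2 * E / M' * c%:R + 2 * E / M'.
    apply: subdivision_cell; first by rewrite mulr_gt0.
    by move: yi; rewrite ler_norml => /andP[? ?]; apply/andP; split; lra.
  pose c := [ffun j => if j == i then ci else c0 j].
  have midE : mid c = mid0.
    congr (- _); apply: eq_bigr => j /negbTE ji; rewrite /left ffunE ji//.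
  exists (lo c, hi c); first by apply/mapP; exists c => //; rewrite mem_enum.
  move=> j /=; rewrite /hi !mxE midE /wd /left !ffunE.
  have [->|ji] := eqVneq j i.
    rewrite !eqxx; move: ciP; rewrite !mxE.
    move: (2 * E / M' * ci%:R) (2 * E / M') => u w /andP[? ?].
    by apply/andP; split; lra.
  have := c0P j; rewrite !mxE => /andP[? ?]; apply/andP; split; lra.
- rewrite big_map big_enum /=.
  have volE c : vol (lo c, hi c) = \prod_j wd j.
    by apply: eq_bigr => j _; rewrite /hi /= [X in X - _]mxE addrAC subrr add0r.
  under eq_bigr do rewrite volE.
  rewrite sumr_const card_ffun !card_ord (bigD1 i)//= {1}/wd eqxx.
  have -> : \prod_(j | j != i) wd j = h ^+ N.-1.
    transitivity (\prod_(j | j != i) h).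
      by apply: eq_bigr => j /negbTE ji; rewrite /wd ji.
    by rewrite prodr_const cardC1 card_ord.
  have hM : h * M' = 2 * K * s by rewrite /h divfK// gt_eqF.
  have powN (a : R) : a ^+ N = a * a ^+ N.-1.
    by rewrite -exprS prednK// (leq_trans _ (ltn_ord i)).
  rewrite -[leLHS]mulr_natr natrX -/M'.
  have -> : 2 * E / M' * h ^+ N.-1 * M' ^+ N = 2 * E * (h * M') ^+ N.-1.
    rewrite (exprMn _ h M') (powN M'); move: (h ^+ _) (M' ^+ _) => u v.
    by field; rewrite gt_eqF.
  rewrite hM /E /h [in leRHS]powN exprMn.
  set a := s ^+ N.-1; set b := (2 * K) ^+ N.-1.
  have -> // : 2 * (D * s + La * (2 * K * s / M')) * (b * a) =
    s * a * (b * (2 * (D + La * (2 * K / M')))).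
  by field; rewrite gt_eqF.
Qed.

(** This makes the factor of s^N in [slab_covered] small: half of [e] fixes the thickness D, and the
    other half fixes the mesh M. *)
Lemma slab_bound (N : nat) (K La e : R) : 0 < K -> 0 <= La -> 0 < e ->
  exists2 D, 0 < D & exists M : nat,
    (2 * K) ^+ N.-1 * (2 * (D + La * (2 * K / M.+1%:R))) <= e.
Proof.
move=> K0 La0 e0; pose q := (2 * K) ^+ N.-1 * 2.
have q0 : 0 < q by rewrite mulr_gt0// exprn_gt0// mulr_gt0.
exists (e / (2 * q)); first by rewrite divr_gt0// mulr_gt0.
pose a := La * (2 * K) / (e / (2 * q)).
have a0 : 0 <= a.
  apply: divr_ge0; first by rewrite !mulr_ge0// ltW.
  by apply/ltW/divr_gt0 => //; rewrite mulr_gt0.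
exists (Num.truncn a); set M := (Num.truncn a).+1%:R.
have aM : a < M by rewrite /M truncnS_gt.
have M0 : 0 < M by exact: le_lt_trans aM.
have D0 : 0 < e / (2 * q) by rewrite divr_gt0// mulr_gt0.
have : La * (2 * K / M) <= e / (2 * q).
  by rewrite mulrA ler_pdivrMr// [leRHS]mulrC -ler_pdivrMr// ltW.
move=> h; rewrite [leLHS]mulrA -/q.
rewrite (@le_trans _ _ (q * (e / (2 * q) + e / (2 * q))))//.
  by rewrite ler_wpM2l ?(ltW q0)// lerD2l.
have -> // : q * (e / (2 * q) + e / (2 * q)) = e by field; rewrite gt_eqF.
Qed.

(** A small cube around a point of [A] has its image in a thin slab, and a small cube around any
    other point misses [A]; [cube_induction] glues these local covers together. Relative closedness
    of [A] gives the second case. *)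
Lemma sard_cube N (F : 'cV[R]_N -> 'cV[R]_N) (A : set 'cV[R]_N) c s :
  0 < s ->
  (forall x, cube c s x -> ~ A x -> \forall y \near x, ~ A y) ->
  (forall x, cube c s x -> A x -> exists K (l : 'rV[R]_N),
    [/\ l != 0, \forall y \near x, `|F y - F x| <= K * `|y - x| &
      forall e, 0 < e ->
        \forall y \near x, `|(l *m (F y - F x)) 0 0| <= e * `|y - x|]) ->
  forall e, 0 < e -> covered (F @` (A `&` cube c s)) e.
Proof.
move=> s0 Acl AP e e0; pose q := e / s ^+ N.
have q0 : 0 < q by rewrite divr_gt0// exprn_gt0.
(* A bound proportional to the volume of the cube is what bisection preserves: the 2^N halves add up
   exactly. *)
pose P c s := covered (F @` (A `&` cube c s)) (q * s ^+ N).
suff : P c s by rewrite /P /q divfK// gt_eqF// exprn_gt0.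
apply: cube_induction => // [c' s' s'0 Pt|x cx].
  apply: covered_sub (covered_bigcup Pt).
    move=> _ [y [Ay cy] <-].
    (* The subcube of y: in each direction, whether y lies in the upper half. *)
    exists [ffun i => c' i 0 + s' / 2 <= y i 0] => //; exists y => //; split=> // i.
    rewrite !mxE ffunE; have /andP[? ?] := cy i.
    by case: (leP (c' i 0 + s' / 2) (y i 0)) => h /=; rewrite ?mulr1n ?mulr0n; apply/andP; split; lra.
  rewrite sumr_const card_ffun card_bool card_ord -[leLHS]mulr_natr natrX expr_div_n.
  have -> // : q * (s' ^+ N / 2 ^+ N) * 2 ^+ N = q * s' ^+ N.
  by field; rewrite expf_neq0.
have [Ax|nAx] := pselect (A x); last first.
  have [d d0 dA] := near_norm (Acl x cx nAx).
  exists d => // c' s' s'0 s'd c'x.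
  have qs0 : 0 <= q * s' ^+ N by rewrite mulr_ge0 ?exprn_ge0// ltW.
  apply: (covered_sub _ (lexx _) (covered0 _ qs0)).
  move=> z [y [Ay /(cube_dist (ltW s'0))/(_ _ c'x) yx] _]; apply: (dA y) => //.
  exact: le_lt_trans s'd.
have [K [l [l0 Fx lx]]] := AP x cx Ax.
have [i li] : exists i, l 0 i != 0.
  apply/existsP; apply: contraT; rewrite negb_exists => /forallP li.
  by move/eqP: l0; case; apply/rowP => i; rewrite mxE; apply/eqP/negPn.
(* [slab_covered] asks for the i-th coefficient 1 and a positive K; the precision demanded of [l] is
   rescaled by [|l 0 i|] to match. *)
pose l' := (l 0 i)^-1 *: l; pose K' := Num.max K 1.
have K'0 : 0 < K' by rewrite lt_max ltr01 orbT.
have La0 : 0 <= \sum_j `|l' 0 j| by apply: sumr_ge0.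
have [D D0 [M DM]] := slab_bound N K'0 La0 q0.
have Dl0 : 0 < D * `|l 0 i| by rewrite mulr_gt0// normr_gt0.
have [d1 d10 d1P] := near_norm Fx.
have [d2 d20 d2P] := near_norm (lx _ Dl0).
exists (Num.min d1 d2); first by rewrite lt_min d10.
move=> c' s' s'0; rewrite lt_min => /andP[s'd1 s'd2] c'x.
apply: (@covered_sub _ _ (F @` (A `&` cube c' s')) _ _ _ _
  (@slab_covered N (F x) l' i K' D s' M _ K'0 s'0 D0 _ _)) => //.
- by rewrite mulrC ler_wpM2r// exprn_ge0// ltW.
- by rewrite mxE mulVf.
- move=> _ [y [Ay /(cube_dist (ltW s'0))/(_ _ c'x) yx] <-]; split.
    rewrite (le_trans (d1P _ (le_lt_trans yx s'd1)))//.
    rewrite (@le_trans _ _ (K' * `|y - x|))//; first by rewrite ler_wpM2r// le_max lexx.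
    by rewrite ler_wpM2l// ltW.
  rewrite -scalemxAl mxE normrM normfV mulrC ler_pdivrMr ?normr_gt0//.
  rewrite (le_trans (d2P _ (le_lt_trans yx s'd2)))// mulrAC.
  by rewrite ler_wpM2r// ler_wpM2l// ltW.
Qed.

(** An intermediate notion of null set, closed under countable unions by mere re-indexing; covers
    are merged into one sequence of boxes only in [sigma_null_lebesgue]. *)
Definition sigma_null N (A : set 'cV[R]_N) : Prop :=
  exists2 B : nat -> set 'cV[R]_N,
    A `<=` \bigcup_k B k & forall k e, 0 < e -> covered (B k) e.

Lemma sigma_null_bigcup N (I : countType) (A : I -> set 'cV[R]_N) :
  (forall i, sigma_null (A i)) -> sigma_null (\bigcup_i A i).
Proof.
move=> A0; have /choice[B BP] : forall i, exists B : nat -> set 'cV[R]_N,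
    A i `<=` \bigcup_k B k /\ forall k e, 0 < e -> covered (B k) e.
  by move=> i; have [B ? ?] := A0 i; exists B.
(* Pairs (i, j) are enumerated by [pickle]; a number coding no pair contributes the empty set. *)
exists (fun k => if unpickle k is Some (i, j) then B i j else set0).
  move=> x [i _ /(BP i).1[j _ Bx]]; exists (pickle (i, j)) => //.
  by rewrite pickleK.
move=> k e e0; case: unpickle => [[i j]|]; first exact: (BP i).2.
exact/covered0/ltW.
Qed.

Lemma sigma_null_sub N (A B : set 'cV[R]_N) :
  A `<=` B -> sigma_null B -> sigma_null A.
Proof. by move=> AB [C BC ?]; exists C => //; exact: subset_trans BC. Qed.

(** The open set [U] is the union of the countably many grid cubes of side 1/(p+1) that it contains,
    and [sard_cube] treats each of them. *)
Lemma sard N (F : 'cV[R]_N -> 'cV[R]_N) (U A : set 'cV[R]_N) :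
  open U -> A `<=` U ->
  (forall x, U x -> ~ A x -> \forall y \near x, ~ A y) ->
  (forall x, A x -> exists K (l : 'rV[R]_N),
    [/\ l != 0, \forall y \near x, `|F y - F x| <= K * `|y - x| &
      forall e, 0 < e ->
        \forall y \near x, `|(l *m (F y - F x)) 0 0| <= e * `|y - x|]) ->
  sigma_null (F @` A).
Proof.
move=> oU AU Acl AP.
pose s (p : nat) : R := p.+1%:R^-1.
have s0 p : 0 < s p by rewrite invr_gt0.
pose c (z : 'cV[int]_N) p : 'cV[R]_N := \col_i ((z i 0)%:~R * s p).
(* The inclusion in [U] is part of the membership condition, so that a grid cube leaving [U]
   contributes the empty set. *)
pose B (zp : 'cV[int]_N * nat) : set 'cV[R]_N :=
  [set y | cube (c zp.1 zp.2) (s zp.2) `<=` U /\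
    (F @` (A `&` cube (c zp.1 zp.2) (s zp.2))) y].
apply: (@sigma_null_sub _ _ (\bigcup_zp B zp)); last first.
  apply: sigma_null_bigcup => -[z p]; exists (fun=> B (z, p)).
    by move=> x Bx; exists 0%N.
  move=> _ e e0; have [cU|ncU] := pselect (cube (c z p) (s p) `<=` U); last first.
    by apply: (@covered_sub _ _ set0 e e) (covered0 _ (ltW e0)) => // x [].
  apply: (@covered_sub _ _ (F @` (A `&` cube (c z p) (s p))) _ e) => //.
    by move=> x [].
  by apply: sard_cube => // x cx; [apply: Acl; exact: cU|exact: AP].
move=> _ [x Ax <-].
have [d d0 dU] := near_norm (open_nbhs_nbhs (conj oU (AU _ Ax))).
have [p pd] : exists p, s p < d.
  exists (Num.truncn d^-1); rewrite invf_plt ?posrE//; exact: truncnS_gt.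
have cx : cube (c (\col_i Num.floor (x i 0 / s p)) p) (s p) x.
  move=> i; rewrite !mxE -ler_pdivlMr// ge_floor/= -[X in _ + X]mul1r -mulrDl.
  by rewrite -ler_pdivrMr// ltW// -[1]/(1%:~R) -intrD floorD1_gt.
exists (\col_i Num.floor (x i 0 / s p), p) => //; split; last by exists x.
by move=> y /(cube_dist (ltW (s0 p)))/(_ _ cx) yx; apply: dU; exact: le_lt_trans pd.
Qed.

End Covers.

(** * From finite covers to Lebesgue outer measure *)

Section LebesgueNullSets.
Context {R : realType}.

Lemma sum_half_pow (e : R) n : \sum_(k < n) e / 2 ^+ k.+1 = e - e / 2 ^+ n.
Proof.
elim: n => [|n IH]; first by rewrite big_ord0 expr0 divr1 subrr.
rewrite big_ord_recr /= IH exprS; field.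
by rewrite expf_neq0.
Qed.

(** The k-th piece gets a finite cover of volume at most e / 2^(k+1), and these finite lists are
    concatenated into a single sequence of boxes. *)
Lemma sigma_null_lebesgue N (A : set 'cV[R]_N) :
  (0 < N)%N -> sigma_null A -> lebesgue_null A.
Proof.
move=> N0 [B AB B0]; apply/eqP; rewrite eq_le; apply/andP; split; last first.
  apply: le_ereal_inf_tmp => _ [a [b [ab _ ->]]].
  apply: nneseries_ge0 => k _ _; rewrite lee_fin prodr_ge0// => i _.
  by rewrite subr_ge0.
apply/lee_addgt0Pr => e e0; rewrite add0e.
have /choice[s sP] : forall k, exists s : seq ('cV[R]_N * 'cV[R]_N),
    [/\ forall p, p \in s -> forall i, p.1 i 0 <= p.2 i 0,
        forall x, B k x -> exists2 p, p \in s & box p.1 p.2 x &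
        \sum_(p <- s) vol p <= e / 2 ^+ k.+1].
  by move=> k; apply: B0; rewrite divr_gt0// exprn_gt0.
(* A degenerate box, of volume zero because 0 < N. Prepended to each list, it ensures that the first
   n lists together have at least n entries, even if some covers are empty. *)
pose d : 'cV[R]_N * 'cV[R]_N := (0, 0).
have vold : vol d = 0.
  by rewrite /vol (bigD1 (Ordinal N0))//= mxE subrr mul0r.
pose t k := d :: s k.
pose L n := flatten [seq t k | k <- iota 0 n].
have LS n : L n.+1 = L n ++ t n.
  by rewrite /L -(addn1 n) iotaD map_cat flatten_cat /= add0n cats0.
have LD n m : exists r, L (n + m)%N = L n ++ r.
  elim: m => [|m [r Lr]]; first by exists [::]; rewrite addn0 cats0.
  by exists (r ++ t (n + m)%N); rewrite addnS LS Lr catA.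
have szL n : (n <= size (L n))%N.
  elim: n => // n IH; rewrite LS size_cat /= addnS ltnS.
  exact: leq_trans (leq_addr _ _).
(* The k-th box of the infinite concatenation; by [pL], any prefix long enough gives the same
   value. *)
pose p k := nth d (L k.+1) k.
have pL n k : (k < size (L n))%N -> nth d (L n) k = p k.
  move=> kn; rewrite /p; have [nk|/ltnW kn'] := leqP n k.+1.
    by have [r] := LD n (k.+1 - n)%N; rewrite subnKC// => ->; rewrite nth_cat kn.
  have [r] := LD k.+1 (n - k.+1)%N; rewrite subnKC// => ->; rewrite nth_cat.
  by rewrite szL.
have Lge n q : q \in L n -> forall i, q.1 i 0 <= q.2 i 0.
  move=> /flatten_mapP[k _]; rewrite inE => /predU1P[-> i|].
    by rewrite lexx.
  by have [+ _ _] := sP k; exact.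
have pge k i : (p k).1 i 0 <= (p k).2 i 0.
  by apply: (Lge k.+1); rewrite mem_nth// szL.
apply: ge_ereal_inf; exists (\sum_(0 <= k <oo) (vol (p k))%:E)%E.
  exists (fun k => (p k).1), (fun k => (p k).2); split => //.
  move=> x /AB[j _ Bx]; have [_ /(_ x Bx)[q qs qx] _] := sP j.
  have qL : q \in L j.+1.
    by rewrite LS mem_cat inE qs !orbT.
  exists (index q (L j.+1)) => //.
  by rewrite -(pL j.+1) ?index_mem// nth_index.
apply: lime_le.
  by apply: is_cvg_nneseries => k _ _; rewrite lee_fin vol_ge0.
apply: nearW => n; rewrite sumEFin lee_fin.
have -> : \sum_(0 <= k < n) vol (p k) = \sum_(0 <= k < n) vol (nth d (L n) k).
  by apply: eq_big_nat => k /andP[_ kn]; rewrite pL// (leq_trans kn).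
apply: (@le_trans _ _ (\sum_(q <- L n) vol q)).
  rewrite [leRHS](big_nth d) [leRHS](big_cat_nat _ (szL n))//= lerDl.
  rewrite big_nat; apply: sumr_ge0 => k /andP[_ kn]; apply: vol_ge0.
  by apply: (Lge n); rewrite mem_nth.
apply: (@le_trans _ _ (\sum_(k < n) e / 2 ^+ k.+1)).
  have -> : \sum_(q <- L n) vol q = \sum_(k < n) \sum_(q <- t k) vol q.
    by rewrite /L big_flatten big_map -{1}(subn0 n) big_mkord.
  apply: ler_sum => k _; change (\sum_(q <- t k) vol q <= e / 2 ^+ k.+1).
  rewrite /t big_cons vold add0r.
  by have [] := sP k.
by rewrite sum_half_pow gerBl divr_ge0// ?exprn_ge0// ltW.
Qed.

End LebesgueNullSets.

(** * Calculus in one variable *)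

Section OneVariable.
Context {R : realType}.

Lemma is_derive_coord (V : normedModType R) m n (w : V -> 'M[R]_(m, n)) t v dw i j :
  is_derive t v w dw -> is_derive t v (fun s => w s i j) (dw i j).
Proof.
move=> [dwt <-]; apply: DeriveDef; first exact: (derivable_mxP _ _ _).1.
by rewrite derive_mx// mxE.
Qed.

Lemma is_derive_mx (V : normedModType R) m n (w : V -> 'M[R]_(m, n)) t v
    (dw : 'M[R]_(m, n)) :
  (forall i j, is_derive t v (fun s => w s i j) (dw i j)) -> is_derive t v w dw.
Proof.
move=> wt; have dwt : derivable w t v by apply/derivable_mxP => i j; exact: ex_derive.
apply: DeriveDef => //; rewrite derive_mx//; apply/matrixP => i j; rewrite mxE.
exact: derive_val.
Qed.

Lemma continuous_coord (T : topologicalType) m n (w : T -> 'M[R]_(m, n)) i j t :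
  {for t, continuous w} -> {for t, continuous (fun s => w s i j)}.
Proof.
by move=> wt; apply: (@continuous_comp _ _ _ w (fun M : 'M[R]_(m, n) => M i j)) => //; exact: coord_continuous.
Qed.

Lemma continuous_mx (T : topologicalType) m n (w : T -> 'M[R]_(m, n)) t :
  (forall i j, w s i j @[s --> t] --> w t i j) -> {for t, continuous w}.
Proof.
move=> wt; apply/cvgrPdist_le => e e0; near=> s.
apply: mx_norm_le => [|i j]; first exact: ltW.
rewrite !mxE; move: i j; near: s.
have : \forall s \near t, forall ij : 'I_m * 'I_n, `|w t ij.1 ij.2 - w s ij.1 ij.2| <= e.
  apply: filter_forall => -[i' j'] /=.
  by have /cvgrPdist_le := wt i' j'; exact.
by apply: filterS => s h i j; exact: (h (i, j)).
Unshelve. all: by end_near. Qed.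

Lemma continuous_sum_ord (T : topologicalType) (W : normedModType R) n
    (f : 'I_n -> T -> W) x : (forall i, {for x, continuous (f i)}) ->
  {for x, continuous (fun y => \sum_i f i y)}.
Proof.
move=> cf; have -> : (fun y => \sum_i f i y) = \sum_i f i.
  by apply/funext => y; rewrite fct_sumE.
apply: (@big_ind _ (fun g : T -> W => {for x, continuous g})) => //.
- exact: cst_continuous.
- by move=> g h cg ch; exact: continuousD.
Qed.

Lemma le_of_derive_le0 (p dp : R -> R) (t : R) : 0 <= t -> continuous p ->
  (forall s, 0 < s < t -> is_derive s 1 p (dp s)) ->
  (forall s, 0 < s < t -> dp s <= 0) -> p t <= p 0.
Proof.
move=> t0 cp pP dp0.
apply: (@ler0_derive1_le_cc _ p 0 t) => //.
- by move=> s; rewrite in_itv/= => st; have ps := pP _ st; exact: ex_derive.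
- move=> s; rewrite in_itv/= => st; have ps := pP _ st.
  by rewrite derive1E derive_val dp0.
- exact: continuous_subspaceT.
- by rewrite in_itv/= t0 lexx.
- by rewrite in_itv/= lexx t0.
Qed.

Lemma norm_le_of_derive_le m (w dw : R -> 'cV[R]_m) (b db : R -> R) (t : R) :
  0 <= t -> continuous w -> continuous b -> `|w 0| <= b 0 ->
  (forall s, 0 < s < t -> is_derive s 1 w (dw s)) ->
  (forall s, 0 < s < t -> is_derive s 1 b (db s)) ->
  (forall s, 0 < s < t -> `|dw s| <= db s) -> `|w t| <= b t.
Proof.
move=> t0 cw cb w0 wP bP dwb.
have key (sg : R) i : `|sg| = 1 -> sg * w t i 0 - b t <= 0.
  move=> sg1.
  have : sg * w t i 0 - b t <= sg * w 0 i 0 - b 0.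
    apply: (@le_of_derive_le0 (fun s => sg * w s i 0 - b s) (fun s => sg * dw s i 0 - db s)) => //.
    - move=> s; apply: cvgB; last exact: cb.
      by apply: cvgM; [exact: cvg_cst|exact/continuous_coord/cw].
    - move=> s st; apply: is_deriveB; last exact: bP.
      by apply: is_deriveZ; exact/is_derive_coord/wP.
    - move=> s st; rewrite subr_le0 (le_trans _ (dwb _ st))//.
      by rewrite (le_trans (ler_norm _))// normrM sg1 mul1r mx_coord_le.
  move/le_trans; apply; rewrite subr_le0 (le_trans _ w0)//.
  by rewrite (le_trans (ler_norm _))// normrM sg1 mul1r mx_coord_le.
apply: cV_norm_le => [|i].
  (* [cV_norm_le] asks for [0 <= b t], which no coordinate provides when m = 0; it holds because
     [db] bounds a norm, so [b] is nondecreasing. *)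
  rewrite (le_trans (normr_ge0 (w 0)))// (le_trans w0)// -lerN2.
  apply: (@le_of_derive_le0 (fun s => - b s) (fun s => - db s)) => //.
  - by move=> s; apply: cvgN; exact: cb.
  - by move=> s st; apply: is_deriveN; exact: bP.
  - by move=> s st; rewrite oppr_le0 (le_trans _ (dwb _ st)).
rewrite ler_norml; have := key (-1) i; have := key 1 i.
rewrite normrN normr1 mul1r mulN1r => /(_ erefl) ? /(_ erefl) ?.
by apply/andP; split; lra.
Qed.

(** The sup norm is replaced by the smooth phi = sum of the w_i^2, and (phi + e^2) exp(-K s) is
    shown to be nonincreasing. The constant C precedes w, e and t, so that one C serves all
    neighbouring solutions. *)
Lemma gronwall m (L T : R) : 0 <= L -> 0 <= T ->
  exists2 C, 0 < C & forall (w dw : R -> 'cV[R]_m) (e t : R),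
    0 <= e -> 0 <= t <= T -> continuous w ->
    (forall s, 0 < s < t -> is_derive s 1 w (dw s)) ->
    (forall s, 0 < s < t -> `|dw s| <= L * `|w s| + e) ->
    `|w t| <= C * (`|w 0| + e).
Proof.
(* With u = |w s|, K has to dominate 2 m u (L u + e) by K (u^2 + e^2); the cross term 2 m u e is
   absorbed through (m u - e)^2 >= 0. *)
move=> L0 T0; pose K := 2 * m%:R * L + m%:R ^+ 2 + 1.
have K0 : 0 <= K by rewrite !addr_ge0// ?mulr_ge0// exprn_ge0.
(* The factor m + 1 pays for comparing phi with the squared sup norm; the exponential, being at
   least 1, is below its square, so no square root is taken. *)
pose C := (m%:R + 1) * expR (K * T); exists C.
  by rewrite mulr_gt0 ?expR_gt0// ltr_wpDl.
move=> w dw e t e0 /andP[t0 tT] cw dwP dwb.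
pose phi s := \sum_(i < m) w s i 0 ^+ 2.
have sqn s : `|w s| ^+ 2 <= phi s.
  have phi0 : 0 <= phi s by apply: sumr_ge0 => i _; rewrite sqr_ge0.
  rewrite -(sqr_sqrtr phi0) lerXn2r ?nnegrE ?sqrtr_ge0//.
  apply: cV_norm_le; rewrite ?sqrtr_ge0// => i.
  rewrite -sqrtr_sqr ler_wsqrtr// /phi (bigD1 i)//= lerDl.
  by apply: sumr_ge0 => j _; rewrite sqr_ge0.
have dphi s : 0 < s < t ->
    is_derive s 1 phi (\sum_(i < m) 2 * w s i 0 * dw s i 0).
  move=> /dwP ds.
  have -> : phi = \sum_(i < m) (fun s => w s i 0 ^+ 2).
    by apply/funext => u; rewrite fct_sumE.
  apply: is_derive_sum => i; have dsi := is_derive_coord i 0 ds.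
  have := is_deriveX 1 dsi; rewrite expr1 /= => h.
  by apply: is_derive_eq; rewrite /GRing.scale/= -mulr_natl; ring.
pose psi s := (phi s + e ^+ 2) * expR (- K * s).
have cphi : continuous phi.
  move=> s; apply: continuous_sum_ord => i.
  apply: (@continuous_comp _ _ _ (fun y => w y i 0) (fun x => x ^+ 2)).
    exact/continuous_coord/cw.
  exact: exprn_continuous.
have psi0 : psi t <= psi 0.
  apply: (@le_of_derive_le0 psi (fun s => expR (- K * s) *
    ((\sum_(i < m) 2 * w s i 0 * dw s i 0) - K * (phi s + e ^+ 2)))) => //.
  - move=> s; apply: cvgM.
      by apply: cvgD; [exact: cphi|exact: cvg_cst].
    apply: (@continuous_comp _ _ _ (fun s => - K * s) expR); last exact: continuous_expR.
    by apply: cvgM; [exact: cvg_cst|exact: cvg_id].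
  - move=> s st.
    have d1 : is_derive s 1 (fun s => phi s + e ^+ 2)
        (\sum_(i < m) 2 * w s i 0 * dw s i 0).
      by have := dphi _ st => ?; apply: is_derive_eq; rewrite addr0.
    have d2 : is_derive s 1 (fun s => expR (- K * s)) (expR (- K * s) * - K).
      apply: (@is_derive1_comp _ expR (fun s => - K * s)).
      by apply: is_derive_eq; rewrite /GRing.scale/= mulr1.
    by apply: is_derive_eq; rewrite /GRing.scale/=; ring.
  - move=> s st; rewrite pmulr_rle0 ?expR_gt0// subr_le0.
    apply: (@le_trans _ _ (\sum_(i < m) 2 * `|w s| * (L * `|w s| + e))).
      apply: ler_sum => i _; rewrite (le_trans (ler_norm _))// 2!normrM ger0_norm//.
      rewrite ler_pM// ?mulr_ge0//; first by rewrite ler_wpM2l// mx_coord_le.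
      by rewrite (le_trans (mx_coord_le _ _ _))// dwb.
    rewrite sumr_const card_ord -[leLHS]mulr_natr.
    apply: (@le_trans _ _ (K * (`|w s| ^+ 2 + e ^+ 2))); last first.
      by rewrite ler_wpM2l// lerD2r.
    rewrite /K; move: (m%:R : R) (ler0n R m) (`|w s|) (normr_ge0 (w s)) => q q0 u u0.
    rewrite -subr_ge0.
    have -> : (2 * q * L + q ^+ 2 + 1) * (u ^+ 2 + e ^+ 2) - 2 * u * (L * u + e) * q =
      (q * u - e) ^+ 2 + u ^+ 2 + (2 * q * L + q ^+ 2) * e ^+ 2 by ring.
    by rewrite !addr_ge0// ?sqr_ge0// mulr_ge0 ?sqr_ge0// addr_ge0 ?sqr_ge0// !mulr_ge0.
have E1 : 1 <= expR (K * T) by rewrite -expR0 ler_expR mulr_ge0.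
have : `|w t| ^+ 2 <= (C * (`|w 0| + e)) ^+ 2.
  have h1 : phi t + e ^+ 2 <= (phi 0 + e ^+ 2) * expR (K * t).
    move: psi0; rewrite /psi mulr0 expR0 mulr1 mulNr expRN ler_pdivrMr ?expR_gt0//.
  have h2 : phi 0 <= m%:R * `|w 0| ^+ 2.
    apply: (@le_trans _ _ (\sum_(i < m) `|w 0| ^+ 2)).
      apply: ler_sum => i _; rewrite -[leLHS]real_normK ?num_real//.
      by rewrite lerXn2r ?nnegrE// mx_coord_le.
    by rewrite sumr_const card_ord mulr_natl.
  apply: (@le_trans _ _ ((phi 0 + e ^+ 2) * expR (K * t))).
    by rewrite (le_trans _ h1)// (le_trans (sqn t))// lerDl sqr_ge0.
  apply: (@le_trans _ _ ((m%:R * `|w 0| ^+ 2 + e ^+ 2) * expR (K * T))).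
    apply: ler_pM; rewrite ?expR_ge0//.
    - by rewrite addr_ge0 ?sqr_ge0// sumr_ge0// => i _; rewrite sqr_ge0.
    - by rewrite lerD2r.
    - by rewrite ler_expR ler_wpM2l.
  rewrite /C; move: (expR _) E1 (m%:R : R) (ler0n R m) (`|w 0|) (normr_ge0 (w 0)) => E E1 q q0 u u0.
  apply: (@le_trans _ _ (((q + 1) * (u + e)) ^+ 2 * E)).
    rewrite ler_wpM2r ?(le_trans _ E1)// -subr_ge0.
    have -> : ((q + 1) * (u + e)) ^+ 2 - (q * u ^+ 2 + e ^+ 2) =
      (q ^+ 2 + q + 1) * u ^+ 2 + (q ^+ 2 + 2 * q) * e ^+ 2 + 2 * (q + 1) ^+ 2 * u * e by ring.
    by rewrite !addr_ge0// !mulr_ge0// ?addr_ge0 ?mulr_ge0 ?sqr_ge0.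
  have -> : ((q + 1) * E * (u + e)) ^+ 2 = ((q + 1) * (u + e)) ^+ 2 * (E ^+ 2) by ring.
  by rewrite ler_wpM2l ?sqr_ge0// expr2 ler_pMl// (lt_le_trans ltr01).
have C0 : 0 <= C by rewrite mulr_ge0 ?expR_ge0 ?addr_ge0.
by rewrite ler_pXn2r ?nnegrE//; exact/mulr_ge0/addr_ge0.
Qed.

(** A continuity argument for bounds that are available only as long as they hold. At the infimum u
    of the times where p >= r, [step] gives p u < r, and continuity carries this beyond u. *)
Lemma first_exit (p : R -> R) (r T : R) : continuous p -> 0 <= T -> p 0 < r ->
  (forall t, 0 <= t <= T -> (forall s, 0 <= s < t -> p s < r) -> p t < r) ->
  forall t, 0 <= t <= T -> p t < r.
Proof.
move=> cp T0 p0 step t tT; apply: contrapT => /negP; rewrite -leNgt => rt.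
pose S := [set s | 0 <= s <= T /\ r <= p s].
have St : S t by [].
have lS : has_lbound S by exists 0 => s [/andP[]].
have iS : has_inf S by split; [exists t|].
pose u := inf S.
have u0 : 0 <= u by apply: lb_le_inf; [exists t|move=> s [/andP[]]].
have ut : u <= t by exact: ge_inf.
have pu : p u < r.
  apply: step => [|s /andP[s0 su]].
    by rewrite u0 (le_trans ut)//; case/andP: tT.
  rewrite ltNge; apply/negP => rs; have := su; rewrite ltNge => /negP; apply.
  apply: ge_inf => //; split => //; rewrite s0 (le_trans (ltW su))// (le_trans ut)//.
  by case/andP: tT.
have [d d0 dP] := near_norm (cvgr_lt (p u) (cp u) r pu).
have [s Ss su] := inf_adherent d0 iS.
have us : u <= s by exact: ge_inf.
case: Ss => _; rewrite leNgt => /negP; apply; apply: dP.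
by rewrite ger0_norm ?subr_ge0// ltrBlDl.
Qed.

(** Precomposition with this retraction onto [0, T] makes curves known on [0, T] continuous on the
    whole line, so continuity can be stated globally and differential equations only on the open
    interval. *)
Definition clip (T t : R) : R := Num.max 0 (Num.min t T).

Lemma clip_itv T t : 0 <= T -> 0 <= clip T t <= T.
Proof. by move=> T0; rewrite /clip le_max lexx ge_max T0 ge_min lexx orbT. Qed.

Lemma clip_id T t : 0 <= t <= T -> clip T t = t.
Proof. by move=> /andP[t0 tT]; rewrite /clip min_l// max_r. Qed.

Lemma clip_continuous T : continuous (clip T).
Proof.
move=> t; apply: (@continuous_max _ _ (cst 0) (fun t => Num.min t T)).
  exact: cst_continuous.
by apply: (@continuous_min _ _ id (cst T)); [exact: cvg_id|exact: cst_continuous].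
Qed.

Lemma near_itv (T t : R) : 0 < t < T -> \forall s \near t, 0 < s < T.
Proof.
move=> tT; have : t \in `]0, T[ by rewrite in_itv.
by move=> /near_in_itvoo; apply: filterS => s; rewrite in_itv.
Qed.

Lemma primitive_cV m (c : R -> 'cV[R]_m) (T : R) : 0 <= T -> continuous c ->
  exists C : R -> 'cV[R]_m, [/\ continuous C, C 0 = 0 &
    forall t : R, 0 < t < T -> is_derive t 1 C (c t)].
Proof.
move=> T0 cc.
have /choice[F FP] : forall i, exists F : R -> R,
    forall t, -1 < t < T + 1 -> is_derive t 1 F (c t i 0).
  move=> i; pose g t : R := c t i 0.
  have cg : continuous g by move=> t; exact/continuous_coord/cc.
  (* Integrating from -1, inside [-1, T + 1], makes 0 and T interior points for the fundamental
     theorem. *)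
  exists (fun x => (\int[lebesgue_measure]_(t in `[-1, x]) (g t))%R) => t /andP[t1 tT].
  have [] := @continuous_FTC1_closed R g (-1) t (T + 1) tT _ t1 (cg t).
    apply: continuous_compact_integrable; first exact: segment_compact.
    exact: continuous_subspaceT.
  by rewrite derive1E => dF gE; apply: DeriveDef.
exists (fun t => \col_i (F i (clip T t) - F i 0)); split.
- move=> t; apply: continuous_mx => i j; under eq_cvg do rewrite mxE.
  rewrite mxE.
  apply: cvgB; last exact: cvg_cst.
  apply: (@continuous_comp _ _ _ (clip T) (F i)); first exact: clip_continuous.
  apply: differentiable_continuous; apply/derivable1_diffP.
  have /andP[? ?] := clip_itv t T0.
  have cT : -1 < clip T t < T + 1 by apply/andP; split; lra.
  by have dF := FP i _ cT; exact: ex_derive.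
- by apply/colP => i; rewrite !mxE clip_id ?lexx// subrr.
- move=> t tT; apply: is_derive_mx => i j; under eq_fun do rewrite mxE.
  rewrite ord1.
  apply: (@near_eq_is_derive _ _ _ (fun s => F i s - F i 0)).
    apply: filterS (near_itv tT) => s /andP[s0 sT].
    by rewrite clip_id// !ltW.
  have Ft : is_derive t 1 (F i) (c t i 0).
    by apply: FP; move: tT => /andP[? ?]; apply/andP; split; lra.
  by apply: is_derive_eq; rewrite subr0.
Qed.

End OneVariable.

(** * Picard iteration for globally Lipschitz fields *)

Section Picard.
Context {R : realType}.

Lemma continuous_pair (T U V : topologicalType) (f : T -> U) (g : T -> V) t :
  {for t, continuous f} -> {for t, continuous g} ->
  {for t, continuous (fun s => (f s, g s))}.
Proof.
move=> ft gt A [[B C] [/= Bf Cg] BC].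
have [fB gC] : nbhs t (f @^-1` B) /\ nbhs t (g @^-1` C) by split; [exact: ft|exact: gt].
by apply: filterS2 fB gC => s fs gs; exact: BC.
Qed.

(** The intervals of centre x k and radius 2 E / 2^k are nested; the supremum of their left ends is
    the limit, with an explicit rate. *)
Lemma geometric_limit (x : nat -> R) (E : R) :
  (forall k, `|x k.+1 - x k| <= E / 2 ^+ k) ->
  exists l, forall k, `|l - x k| <= 2 * E / 2 ^+ k.
Proof.
move=> xE; pose r k : R := 2 * E / 2 ^+ k.
have rS k : r k.+1 = E / 2 ^+ k.
  by rewrite /r exprS; field; rewrite expf_neq0.
have rE k : r k = 2 * r k.+1 by rewrite rS /r mulrA.
have lo k j : x k - r k <= x (k + j)%N - r (k + j)%N.
  elim: j => [|j IH]; first by rewrite addn0.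
  rewrite (le_trans IH)// addnS.
  by have := xE (k + j)%N; rewrite -rS (rE (k + j)%N) ler_norml => /andP[? ?]; lra.
have hi k j : x (k + j)%N + r (k + j)%N <= x k + r k.
  elim: j => [|j IH]; first by rewrite addn0.
  rewrite (le_trans _ IH)// addnS.
  by have := xE (k + j)%N; rewrite -rS (rE (k + j)%N) ler_norml => /andP[? ?]; lra.
have r0 k : 0 <= r k.
  by rewrite rE rS mulr_ge0// (le_trans _ (xE k)).
have lohi k j : x j - r j <= x k + r k.
  have [kj|/ltnW jk] := leqP k j.
    have := hi k (j - k)%N; rewrite subnKC//; have := r0 j; lra.
  have := lo j (k - j)%N; rewrite subnKC//; have := r0 k; lra.
pose S := [set x k - r k | k in [set: nat]].
exists (sup S) => k; rewrite -/(r k) ler_distl; apply/andP; split.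
  apply: ub_le_sup; last by exists k.
  by exists (x 0%N + r 0%N) => _ [j _ <-].
apply: ge_sup; first by exists (x 0%N - r 0%N); exists 0%N.
by move=> _ [j _ <-].
Qed.

Lemma continuous_bounded (V : normedModType R) (w : R -> V) T :
  0 <= T -> continuous w -> exists2 M, 0 < M & forall t, 0 <= t <= T -> `|w t| <= M.
Proof.
move=> T0 cw.
have cn : {within `[0, T], continuous (fun t => `|w t|)}.
  apply: continuous_subspaceT => t.
  by apply: (@continuous_comp _ _ _ w (fun x => `|x|)); [exact: cw|exact: norm_continuous].
have [c _ cP] := EVT_max T0 cn.
exists (`|w c| + 1); first by rewrite ltr_wpDl.
by move=> t tT; rewrite ler_wpDr// cP// in_itv.
Qed.

(** The iterates are compared with a weight exp(2 L t), under which each integration halves the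
    distance, so that convergence holds on all of [0, T] without cutting it into short intervals. *)
Lemma picard m (g : R * 'cV[R]_m -> 'cV[R]_m) (L T : R) :
  0 < L -> 0 <= T -> continuous g ->
  (forall t y z, `|g (t, y) - g (t, z)| <= L * `|y - z|) ->
  forall a, exists h : R -> 'cV[R]_m, [/\ continuous h, h 0 = a &
    forall t, 0 < t < T -> is_derive t 1 h (g (t, h t))].
Proof.
move=> L0 T0 cg gL a.
have cgu (u : R -> 'cV[R]_m) : continuous u -> continuous (fun t => g (t, u t)).
  move=> cu t; apply: (@continuous_comp _ _ _ (fun t => (t, u t)) g); last exact: cg.
  by apply: continuous_pair; [exact: cvg_id|exact: cu].
have /choice[nxt nxtP] : forall u : R -> 'cV[R]_m, exists v : R -> 'cV[R]_m,
    continuous u -> [/\ continuous v, v 0 = a &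
      forall t, 0 < t < T -> is_derive t 1 v (g (t, u t))].
  (* The continuity premise makes the choice of [nxt] total; for a discontinuous curve any witness
     serves. *)
  move=> u; have [cu|ncu] := pselect (continuous u); last by exists u.
  have [C [cC C0 CP]] := primitive_cV T0 (cgu u cu).
  exists (fun t => C t + a) => _; split.
  - by move=> t; apply: cvgD; [exact: cC|exact: cvg_cst].
  - by rewrite C0 add0r.
  - by move=> t tT; have := CP t tT => ?; apply: is_derive_eq; rewrite addr0.
pose u k := iter k nxt (cst a).
have cu k : continuous (u k).
  elim: k => [|k IH]; first exact: cst_continuous.
  by have [] := nxtP (u k) IH.
have u0 k : u k 0 = a.
  by case: k => // k; have [] := nxtP (u k) (cu k).
have uP k t : 0 < t < T -> is_derive t 1 (u k.+1) (g (t, u k t)).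
  by have [_ _] := nxtP (u k) (cu k); exact.
have [M M0 uM] : exists2 M, 0 < M & forall t, 0 <= t <= T -> `|u 1%N t - u 0%N t| <= M.
  by apply: continuous_bounded => // t; apply: cvgB; exact: cu.
(* The rate 2 L is chosen so that the derivative of [b k.+1] is exactly [L * b k], which bounds the
   derivative of the next difference. *)
pose b k t : R := M / 2 ^+ k * expR (2 * L * t).
have b0 k t : 0 <= b k t by rewrite mulr_ge0 ?expR_ge0// divr_ge0// ?exprn_ge0// ltW.
have cb k : continuous (b k).
  move=> t; apply: cvgM; first exact: cvg_cst.
  apply: (@continuous_comp _ _ _ (fun s => 2 * L * s) expR); last exact: continuous_expR.
  by apply: cvgM; [exact: cvg_cst|exact: cvg_id].
have db k (t : R) : is_derive t 1 (b k.+1) (L * b k t).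
  have d2 : is_derive t 1 (fun s => expR (2 * L * s)) (expR (2 * L * t) * (2 * L)).
    apply: (@is_derive1_comp _ expR (fun s => 2 * L * s)).
    by apply: is_derive_eq; rewrite /GRing.scale/= mulr1.
  apply: is_derive_eq; rewrite /GRing.scale/= /b exprS; field.
  by rewrite expf_neq0.
have step k t : 0 <= t <= T -> `|u k.+1 t - u k t| <= b k t.
  elim: k t => [|k IH] t /andP[t0 tT].
    rewrite (le_trans (uM t _)) ?t0// /b expr0 divr1 ler_peMr ?(ltW M0)//.
    by rewrite -expR0 ler_expR !mulr_ge0// ltW.
  apply: (@norm_le_of_derive_le _ _ (fun s => u k.+2 s - u k.+1 s)
    (fun s => g (s, u k.+1 s) - g (s, u k s)) (b k.+1) (fun s => L * b k s)) => //.
  - by move=> s; apply: cvgB; exact: cu.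
  - by rewrite !u0 subrr normr0.
  - move=> s /andP[s0 st]; have sT : 0 < s < T by rewrite s0 (lt_le_trans st).
    by apply: is_deriveB; exact: uP.
  - move=> s /andP[s0 st]; rewrite (le_trans (gL _ _ _))// ler_wpM2l ?(ltW L0)//.
    by rewrite IH// (ltW s0) ltW// (lt_le_trans st).
pose E := M * expR (2 * L * T).
have E0 : 0 < E by rewrite mulr_gt0// expR_gt0.
have bE k t : 0 <= t <= T -> b k t <= E / 2 ^+ k.
  move=> /andP[t0 tT]; rewrite /b /E mulrAC ler_wpM2r ?invr_ge0 ?exprn_ge0//.
  by rewrite ler_wpM2l ?(ltW M0)// ler_expR ler_wpM2l// mulr_ge0// ltW.
have lim t : exists l : 'cV[R]_m, forall k, `|l - u k (clip T t)| <= 2 * E / 2 ^+ k.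
  have /choice[l lP] : forall i, exists l : R,
      forall k, `|l - u k (clip T t) i 0| <= 2 * E / 2 ^+ k.
    move=> i; apply: geometric_limit => k; have cT := clip_itv t T0.
    rewrite (le_trans _ (bE k _ cT))// (le_trans _ (step k _ cT))//.
    by rewrite (le_trans _ (mx_coord_le _ i 0))// !mxE.
  exists (\col_i l i) => k; apply: cV_norm_le => [|i]; last by rewrite !mxE.
  by rewrite divr_ge0 ?exprn_ge0// mulr_ge0// ltW.
have {lim} [h hP] := choice lim.
have small e : 0 < e -> exists k, 2 * E / 2 ^+ k < e by move=> e0; exact: half_pow_lt.
have ch : continuous h.
  move=> t; apply/cvgrPdist_le => e e0.
  have [k ke] := small (e / 3) ltac:(by rewrite divr_gt0).
  have : continuous (fun t => u k (clip T t)).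
    move=> s; apply: (@continuous_comp _ _ _ (clip T) (u k)); last exact: cu.
    exact: clip_continuous.
  move=> /(_ t)/cvgrPdist_le/(_ (e / 3) ltac:(by rewrite divr_gt0)).
  apply: filterS => s us.
  have -> : h t - h s = (h t - u k (clip T t)) + (u k (clip T t) - u k (clip T s))
    - (h s - u k (clip T s)).
    by rewrite opprB !subrKA.
  rewrite (le_trans (ler_normB _ _))// (le_trans (lerD (ler_normD _ _) (lexx _)))//.
  have := hP t k; have := hP s k; lra.
(* The limit is a fixed point on [0, T]: both [h] and [nxt h] are within a multiple of 2^-k of the
   iterate [u k.+1]. *)
have hh t : 0 <= t <= T -> h t = nxt h t.
  have [cv v0 vP] := nxtP h ch.
  move=> /[dup] tT /andP[t0 tT'].
  apply/eqP; rewrite -subr_eq0 -normr_le0; apply/ler_addgt0Pr => e e0; rewrite add0r.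
  have [k ke] := small (e / (L * T + 1)) ltac:(by rewrite divr_gt0// ltr_wpDl// mulr_ge0// ltW).
  have vu : `|nxt h t - u k.+1 t| <= L * (2 * E / 2 ^+ k) * t.
    apply: (@norm_le_of_derive_le _ _ (fun s => nxt h s - u k.+1 s)
      (fun s => g (s, h s) - g (s, u k s)) (fun s => L * (2 * E / 2 ^+ k) * s)
      (fun=> L * (2 * E / 2 ^+ k))) => //.
    - by move=> s; apply: cvgB; [exact: cv|exact: cu].
    - by move=> s; apply: cvgM; [exact: cvg_cst|exact: cvg_id].
    - by rewrite v0 u0 subrr normr0 mulr0.
    - move=> s /andP[s0 st]; have sT : 0 < s < T by rewrite s0 (lt_le_trans st).
      by apply: is_deriveB; [exact: vP|exact: uP].
    - by move=> s st; apply: is_derive_eq; rewrite /GRing.scale/= mulr1.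
    - move=> s /andP[s0 st]; rewrite (le_trans (gL _ _ _))// ler_wpM2l ?(ltW L0)//.
      by have := hP s k; rewrite clip_id// (ltW s0) ltW// (lt_le_trans st).
  have hu := hP t k.+1; rewrite clip_id// in hu.
  rewrite -(subrKA (u k.+1 t)) (le_trans (ler_normD _ _))// [X in _ + X]distrC.
  have LT : 0 < L * T + 1 by rewrite ltr_wpDl// mulr_ge0// ltW.
  have q0 : 0 <= 2 * E / 2 ^+ k by rewrite divr_ge0 ?exprn_ge0// mulr_ge0// ltW.
  have hu' : `|h t - u k.+1 t| <= 2 * E / 2 ^+ k.
    rewrite (le_trans hu)// exprS invfM mulrA ler_wpM2r ?invr_ge0 ?exprn_ge0//.
    by have := E0; lra.
  have vu' : L * (2 * E / 2 ^+ k) * t <= L * (2 * E / 2 ^+ k) * T.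
    by rewrite ler_wpM2l// mulr_ge0// ltW.
  move: ke; rewrite ltr_pdivlMr// => ke.
  move: (2 * E / 2 ^+ k) q0 hu' vu vu' ke => q q0 hu' vu vu' ke.
  nra.
exists h; split => //.
  by rewrite hh ?lexx//; have [] := nxtP h ch.
move=> t tT; have [cv v0 vP] := nxtP h ch.
apply: (@near_eq_is_derive _ _ _ (nxt h)); last exact: vP.
by apply: filterS (near_itv tT) => s /andP[s0 sT]; rewrite hh// !ltW.
Qed.

End Picard.

(** * Iterated directional derivatives *)

Section ContinuousPartials.
Context {R : realType}.

Lemma is_derive_line (V W : normedModType R) (g : V -> W) x v (u : R) :
  derivable g (x + u *: v) v ->
  is_derive u 1 (fun s => g (x + s *: v)) ('D_v g (x + u *: v)).
Proof.
have E : (fun h => h^-1 *: ((g \o shift (x + u *: v)) (h *: v) - g (x + u *: v))) =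
    (fun h => h^-1 *: (((fun s : R => g (x + s *: v)) \o shift u) (h *: 1) - g (x + u *: v))).
  apply/funext => h /=; congr (_ *: (g _ - _)).
  by rewrite -[(h *: 1 : R)]/(h * 1) mulr1 scalerDl addrCA.
move=> dg; apply: DeriveDef; first by rewrite /derivable -E.
by rewrite /derive -E.
Qed.

Lemma mean_value (p dp : R -> R) (c : R) :
  (forall s : R, `|s| <= `|c| -> is_derive s 1 p (dp s)) ->
  exists2 s, `|s| <= `|c| & p c - p 0 = dp s * c.
Proof.
move=> pP; have cp s : `|s| <= `|c| -> {for s, continuous p}.
  move=> sc; have ps := pP s sc.
  by apply: differentiable_continuous; apply/derivable1_diffP; exact: ex_derive.
have [c0|c0|->] := ltgtP c 0.
- have nc : `|c| = - c by rewrite ltr0_norm.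
  have [||s] := @MVT R p dp c 0 c0.
  + move=> s; rewrite in_itv/= => /andP[cs s0]; apply: pP.
    by rewrite nc ler_norml; apply/andP; split; lra.
  + apply: continuous_in_subspaceT => s; rewrite inE/= in_itv/= => /andP[cs s0].
    by apply: cp; rewrite nc ler_norml; apply/andP; split; lra.
  + rewrite in_itv/= => /andP[cs s0] E; exists s.
      by rewrite nc ler_norml; apply/andP; split; lra.
    by rewrite -[LHS]opprB E sub0r mulrN opprK.
- have nc : `|c| = c by rewrite gtr0_norm.
  have [||s] := @MVT R p dp 0 c c0.
  + move=> s; rewrite in_itv/= => /andP[cs s0]; apply: pP.
    by rewrite nc ler_norml; apply/andP; split; lra.
  + apply: continuous_in_subspaceT => s; rewrite inE/= in_itv/= => /andP[cs s0].
    by apply: cp; rewrite nc ler_norml; apply/andP; split; lra.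
  + rewrite in_itv/= => /andP[cs s0] E; exists s.
      by rewrite nc ler_norml; apply/andP; split; lra.
    by rewrite E subr0.
- by exists 0; rewrite ?normr0// subrr mulr0.
Qed.

Lemma partial_increment (V : normedModType R) (g : V -> R) x v (c : R) D e :
  (forall s : R, `|s| <= `|c| -> derivable g (x + s *: v) v /\
     `|'D_v g (x + s *: v) - D| <= e) ->
  `|g (x + c *: v) - g x - c * D| <= e * `|c|.
Proof.
move=> gP.
have [|s sc] := @mean_value (fun s => g (x + s *: v)) (fun s => 'D_v g (x + s *: v)) c.
  by move=> s /gP[dg _]; exact: is_derive_line.
rewrite scale0r addr0 => ->; rewrite mulrC -mulrBr normrM mulrC ler_wpM2r//.
by have [_] := gP s sc.
Qed.

Lemma ord_min_pos n (r : 'I_n -> R) : (forall i, 0 < r i) ->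
  exists2 d, 0 < d & forall i, d <= r i.
Proof.
elim: n r => [|n IH] r r0; first by exists 1 => // -[].
have [d d0 dr] := IH (fun i => r (lift ord0 i)) (fun i => r0 _).
exists (Num.min d (r ord0)) => [|i]; first by rewrite lt_min d0 r0.
by case: (fintype.unliftP ord0 i) => [j ->|->]; rewrite ge_min ?lexx ?orbT// dr.
Qed.

(* Moving one coordinate at a time. *)
Lemma partial_estimate_real (V : normedModType R) n (e : 'I_n -> V) (U : set V)
    (g : V -> R) p0 :
  open U -> U p0 ->
  (forall i x, U x -> derivable g x (e i)) ->
  (forall i, {for p0, continuous (fun x => 'D_(e i) g x)}) ->
  forall eps, 0 < eps -> exists2 r, 0 < r &
    forall p (v : 'cV[R]_n), `|p - p0| < r -> `|v| < r ->
    `|g (p + \sum_i v i 0 *: e i) - g p - \sum_i v i 0 * 'D_(e i) g p|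
      <= eps * `|v|.
Proof.
move=> oU Up0 dg cDg eps eps0.
(* Each of the n moves costs 2 eta: one eta compares the derivative on the segment with that at
   [p0], the other compares it with that at [p]. *)
pose eta := eps / (2 * (n%:R + 1)).
have eta0 : 0 < eta by rewrite divr_gt0// mulr_gt0// ltr_wpDl.
have : \forall y \near p0, U y /\ forall i, `|'D_(e i) g y - 'D_(e i) g p0| <= eta.
  apply: filterI; first exact: open_nbhs_nbhs.
  apply: filter_forall => i.
  by have /cvgrPdist_le/(_ _ eta0) := cDg i; apply: filterS => y; rewrite distrC.
move=> /near_norm[d d0 dP].
(* All the intermediate points stay within |v| M of p, hence in the ball of radius d around [p0]. *)
pose M := 1 + \sum_i `|e i|.
have M0 : 0 < M by rewrite ltr_wpDr// sumr_ge0.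
have r0 : 0 < d / (2 * M) by rewrite divr_gt0// mulr_gt0.
have d20 : 0 < d / 2 by rewrite divr_gt0.
exists (Num.min (d / 2) (d / (2 * M))); first by rewrite lt_min d20.
move=> p v; rewrite !lt_min => /andP[pp0 _] /andP[_ vd].
pose q (k : nat) := p + \sum_(i < n | (i < k)%N) v i 0 *: e i.
have near_q k (c : R) (j : 'I_n) : (k <= j)%N -> `|c| <= `|v| -> `|q k + c *: e j - p0| < d.
  move=> kj cv; rewrite /q.
  have -> : p + \sum_(i < n | (i < k)%N) v i 0 *: e i + c *: e j - p0 =
    (p - p0) + (\sum_(i < n | (i < k)%N) v i 0 *: e i + c *: e j).
    by rewrite -(addrA p) addrAC.
  rewrite (le_lt_trans (ler_normD _ _))// (splitr d) ltr_leD//.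
  apply: (@le_trans _ _ (`|v| * M)); last first.
    rewrite (le_trans (ler_wpM2r (ltW M0) (ltW vd)))//.
    have -> // : d / (2 * M) * M = d / 2 by field; rewrite gt_eqF.
  apply: (@le_trans _ _ (`|v| * \sum_i `|e i|)); last first.
    by rewrite ler_wpM2l// /M lerDr.
  rewrite mulr_sumr [leRHS](bigID (fun i : 'I_n => (i < k)%N))/=.
  rewrite (le_trans (ler_normD _ _))// lerD//.
    rewrite (le_trans (ler_norm_sum _ _ _))//; apply: ler_sum => i _.
    by rewrite normrZ ler_wpM2r// mx_coord_le.
  rewrite normrZ (bigD1 j) -?leqNgt//= ler_wpDr ?ler_wpM2r//.
  by apply: sumr_ge0 => i _; rewrite mulr_ge0.
have qS (j : 'I_n) : q j.+1 = q j + v j 0 *: e j.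
  rewrite /q -addrA; congr (_ + _); rewrite (bigD1 j)//= addrC; congr (_ + _).
  by apply: eq_bigl => i; rewrite ltnS ltn_neqAle andbC.
have incr (j : 'I_n) : `|g (q j.+1) - g (q j) - v j 0 * 'D_(e j) g p| <= 2 * eta * `|v|.
  have Dpp : `|'D_(e j) g p - 'D_(e j) g p0| <= eta.
    by have [] // := dP p; rewrite (lt_le_trans pp0)// ler_pdivrMr// ler_peMr ?(ltW d0)// ler1n.
  rewrite qS; apply: (@le_trans _ _ (2 * eta * `|v j 0|)); last first.
    by rewrite ler_wpM2l ?mx_coord_le// mulr_ge0// ltW.
  apply: partial_increment => s sv.
  have [Uq Dq] := dP _ (near_q j s j (leqnn _) (le_trans sv (mx_coord_le _ _ _))).
  split; first exact: dg.
  rewrite -(subrKA ('D_(e j) g p0)) (le_trans (ler_normD _ _))// mulrDl mul1r lerD//.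
  by rewrite distrC.
have q0 : q 0%N = p by rewrite /q big_pred0 ?addr0.
have qn : q n = p + \sum_i v i 0 *: e i.
  by congr (_ + _); apply: eq_bigl => i; rewrite ltn_ord.
have tele : g (q n) - g (q 0%N) = \sum_(j < n) (g (q j.+1) - g (q j)).
  by rewrite -(big_mkord xpredT (fun j => g (q j.+1) - g (q j))) telescope_sumr.
rewrite -qn -[in g p]q0 tele -sumrB.
rewrite (le_trans (ler_norm_sum _ _ _))//.
rewrite (@le_trans _ _ (\sum_(j < n) 2 * eta * `|v|))//; first exact: ler_sum.
rewrite sumr_const card_ord -[leLHS]mulr_natr mulrAC ler_wpM2r// /eta.
have -> : 2 * (eps / (2 * (n%:R + 1))) * n%:R = eps * (n%:R / (n%:R + 1)).
  by field; rewrite gt_eqF// ltr_wpDl.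
by rewrite ler_piMr ?(ltW eps0)// ler_pdivrMr ?ltr_wpDl// mul1r lerDl.
Qed.

Lemma Cdir_derivable (V W : normedModType R) (I : Type) (e : I -> V) k U (f : V -> W) i x :
  Cdir e k.+1 U f -> U x -> derivable f x (e i).
Proof. by move=> [_ /(_ i)[+ _]]; exact. Qed.

Lemma Cdir_continuous (V W : normedModType R) (I : Type) (e : I -> V) k U (f : V -> W) x :
  Cdir e k U f -> U x -> {for x, continuous f}.
Proof. by case: k => [|k] [+ _]; exact. Qed.

Lemma Cdir_derive (V W : normedModType R) (I : Type) (e : I -> V) k U (f : V -> W) i :
  Cdir e k.+1 U f -> Cdir e k U (fun x => 'D_(e i) f x).
Proof. by move=> [_ /(_ i)[]]. Qed.

Lemma near_eq_continuous (T W : topologicalType) (f g : T -> W) x :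
  {for x, continuous f} -> (\forall y \near x, f y = g y) -> {for x, continuous g}.
Proof.
move=> cf fg; rewrite /prop_for /continuous_at -(nbhs_singleton fg).
by apply: cvg_trans cf; exact: near_eq_cvg.
Qed.

(** The bound is uniform in the base point p near [p0], a strict differentiability along the span of
    the [e i]. The directions need not span V: for the field they are those of h, time being left
    out. *)
Lemma partial_estimate (V : normedModType R) n m (e : 'I_n -> V) (U : set V)
    (f : V -> 'cV[R]_m) p0 :
  open U -> U p0 -> Cdir e 1 U f ->
  forall eps, 0 < eps -> exists2 r, 0 < r &
    forall p (v : 'cV[R]_n), `|p - p0| < r -> `|v| < r ->
    `|f (p + \sum_i v i 0 *: e i) - f p - \sum_i v i 0 *: 'D_(e i) f p|
      <= eps * `|v|.
Proof.
move=> oU Up0 fU eps eps0.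
have dfU i x : U x -> derivable f x (e i) by move=> Ux; exact: Cdir_derivable fU Ux.
have /choice[r rP] : forall l, exists r : R, 0 < r /\
    forall p (v : 'cV[R]_n), `|p - p0| < r -> `|v| < r ->
    `|f (p + \sum_i v i 0 *: e i) l 0 - f p l 0 -
      \sum_i v i 0 * 'D_(e i) (fun x => f x l 0) p| <= eps * `|v|.
  move=> l.
  have [|i|r r0 rP] := @partial_estimate_real V n e U (fun x => f x l 0) p0 oU Up0 _ _ _ eps0.
  - by move=> i x Ux; exact: ((derivable_mxP _ _ _).1 (dfU i x Ux) l 0).
  - have cD := Cdir_continuous (Cdir_derive i fU) Up0.
    refine (near_eq_continuous (continuous_coord (i := l) (j := 0) cD) _).
    have : nbhs p0 U by exact: open_nbhs_nbhs.
    by apply: filterS => x Ux; rewrite (derive_mx (dfU i x Ux)) mxE.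
  - by exists r.
have [r1 r10 rr1] := ord_min_pos (fun l => (rP l).1).
have [r2 r20 rr2] := near_norm (open_nbhs_nbhs (conj oU Up0)).
exists (Num.min r1 r2); first by rewrite lt_min r10.
move=> p v; rewrite !lt_min => /andP[pr1 /rr2 Up] /andP[vr1 _].
apply: cV_norm_le => [|l]; first by rewrite mulr_ge0// ltW.
rewrite !mxE summxE.
have -> : \sum_i (v i 0 *: 'D_(e i) f p) l 0 =
  \sum_i v i 0 * 'D_(e i) (fun x => f x l 0) p.
  by apply: eq_bigr => i _; rewrite mxE (derive_mx (dfU i p Up)) mxE.
by apply: (rP l).2; exact: lt_le_trans (rr1 l).
Qed.

Lemma derive_partials (V : normedModType R) n m (e : 'I_n -> V) (U : set V)
    (f : V -> 'cV[R]_m) p (v : 'cV[R]_n) :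
  open U -> U p -> Cdir e 1 U f ->
  is_derive p (\sum_i v i 0 *: e i) f (\sum_i v i 0 *: 'D_(e i) f p).
Proof.
move=> oU Up fU; set w := \sum_i _; set d := \sum_i _.
have cvd : h^-1 *: ((f \o shift p) (h *: w) - f p) @[h --> (0:R)^'] --> d.
  apply/cvgrPdist_le => eps eps0.
  pose eta := eps / (`|v| + 1).
  have v1 : 0 < `|v| + 1 by rewrite ltr_wpDl.
  have eta0 : 0 < eta by rewrite divr_gt0.
  have [r r0 rP] := partial_estimate oU Up fU eta0.
  have : \forall h \near (0:R)^', h != 0 /\ `|h| < r / (`|v| + 1).
    apply: filterI; first exact: (nbhs_dnbhs_neq (0 : R)).
    by apply: (@dnbhs0_lt R R); rewrite divr_gt0.
  apply: filterS => h [h0 hr].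
  have hv : `|h *: v| < r.
    rewrite normrZ; apply: le_lt_trans (_ : `|h| * (`|v| + 1) < r).
      by rewrite ler_wpM2l// lerDl.
    by rewrite -ltr_pdivlMr.
  have pr : `|p - p| < r by rewrite subrr normr0.
  have := rP p _ pr hv.
  have -> : \sum_i (h *: v) i 0 *: e i = h *: w.
    by rewrite scaler_sumr; apply: eq_bigr => i _; rewrite mxE scalerA.
  have -> : \sum_i (h *: v) i 0 *: 'D_(e i) f p = h *: d.
    by rewrite scaler_sumr; apply: eq_bigr => i _; rewrite mxE scalerA.
  have hpos : 0 < `|h| by rewrite normr_gt0.
  rewrite distrC => est.
  have -> : d - h^-1 *: (f (h *: w + p) - f p) =
      h^-1 *: (h *: d - (f (p + h *: w) - f p)).
    by rewrite [RHS]scalerBr scalerA mulVf// scale1r (addrC p).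
  rewrite normrZ normfV ler_pdivrMl// (le_trans est)// normrZ mulrCA.
  rewrite ler_wpM2l// /eta -mulrA ler_piMr ?(ltW eps0)// mulrC.
  by rewrite ler_pdivrMr// mul1r lerDl.
apply: DeriveDef; first by apply/cvg_ex; exists d.
exact: cvg_lim.
Qed.

End ContinuousPartials.

Section CdirCalculus.
Context {R : realType}.
Implicit Types V W : normedModType R.

Lemma Cdir_eq V W (I : Type) (e : I -> V) k (U : set V) (f g : V -> W) :
  open U -> (forall x, U x -> f x = g x) -> Cdir e k U f -> Cdir e k U g.
Proof.
move=> oU; elim: k f g => [|k IH] f g fg [cf df]; (split => [x Ux|]).
- apply: near_eq_continuous (cf x Ux) _.
  by apply: filterS (open_nbhs_nbhs (conj oU Ux)) => y /fg.
- by [].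
- apply: near_eq_continuous (cf x Ux) _.
  by apply: filterS (open_nbhs_nbhs (conj oU Ux)) => y /fg.
- move=> i; have [dfi Dfi] := df i; split => [x Ux|].
    apply: near_eq_derivable (dfi x Ux).
    by apply: filterS (open_nbhs_nbhs (conj oU Ux)) => y /fg.
  apply: IH Dfi => x Ux; apply: near_eq_derive.
  by apply: filterS (open_nbhs_nbhs (conj oU Ux)) => y /fg.
Qed.

Lemma Cdir_le V W (I : Type) (e : I -> V) k l (U : set V) (f : V -> W) :
  (k <= l)%N -> Cdir e l U f -> Cdir e k U f.
Proof.
elim: k l f => [|k IH] [|l] f // kl [cf df]; split => // i.
by have [dfi Dfi] := df i; split => //; exact: IH Dfi.
Qed.

Lemma Cdir_cst V W (I : Type) (e : I -> V) k (U : set V) (c : W) :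
  Cdir e k U (cst c).
Proof.
elim: k c => [|k IH] c; (split => [x _|]); rewrite ?{1}/cst//; do ?exact: cst_continuous.
move=> i; split => [x _|]; first exact: derivable_cst.
have -> : (fun x => 'D_(e i) (cst c) x) = cst 0 by apply/funext => x; exact: derive_cst.
exact: IH.
Qed.

Lemma derive_affine V V' W (A : V' -> V) (f : V -> W) x u v :
  (forall h : R, A (h *: u + x) = h *: v + A x) ->
  (derivable f (A x) v -> derivable (f \o A) x u) /\ 'D_u (f \o A) x = 'D_v f (A x).
Proof.
move=> Axu.
have E : (fun h : R => h^-1 *: (((f \o A) \o shift x) (h *: u) - (f \o A) x)) =
    (fun h : R => h^-1 *: ((f \o shift (A x)) (h *: v) - f (A x))).
  by apply/funext => h /=; rewrite Axu.
by split; [rewrite /derivable E|rewrite /derive E].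
Qed.

(** [B] is the linear part of [A] on the directions [e']. The value 0 is allowed for it because the
    tangent field has directions on which the base point does not depend. *)
Lemma Cdir_affine V V' W (I I' : Type) (e : I -> V) (e' : I' -> V') k (U : set V)
    (A : V' -> V) (B : I' -> V) (f : V -> W) :
  (forall i h x, A (h *: e' i + x) = h *: B i + A x) -> continuous A ->
  (forall i', B i' = 0 \/ exists i, B i' = e i) ->
  Cdir e k U f -> Cdir e' k (A @^-1` U) (f \o A).
Proof.
move=> AB cA Be; elim: k f => [|k IH] f [cf df]; split => //.
- by move=> x Ux; apply: continuous_comp; [exact: cA|exact: cf].
- by move=> x Ux; apply: continuous_comp; [exact: cA|exact: cf].
- move=> i'; have DA x := derive_affine f (fun h => AB i' h x).
  have [B0|[i Bi]] := Be i'.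
    split => [x Ux|]; first by apply: (DA x).1; rewrite B0; exact: derivable0.
    have -> : (fun x => 'D_(e' i') (f \o A) x) = cst 0.
      by apply/funext => x; rewrite (DA x).2 B0 derive0.
    exact: Cdir_cst.
  have [dfi Dfi] := df i; split => [x Ux|].
    by apply: (DA x).1; rewrite Bi; exact: dfi.
  have -> : (fun x => 'D_(e' i') (f \o A) x) = (fun y => 'D_(e i) f y) \o A.
    by apply/funext => x; rewrite (DA x).2 Bi.
  exact: IH.
Qed.

Lemma is_derive_linear V W W' (l : {linear W -> W'}) (f : V -> W) x v df :
  continuous l -> is_derive x v f df -> is_derive x v (l \o f) (l df).
Proof.
move=> cl [dfx <-].
have cvd : h^-1 *: (((l \o f) \o shift x) (h *: v) - (l \o f) x) @[h --> (0:R)^']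
    --> l ('D_v f x).
  have -> : (fun h : R => h^-1 *: (((l \o f) \o shift x) (h *: v) - (l \o f) x)) =
      l \o (fun h : R => h^-1 *: ((f \o shift x) (h *: v) - f x)).
    by apply/funext => h /=; rewrite [RHS](linearZ_LR l) (linearB l).
  exact: (continuous_cvg _ (cl _) dfx).
apply: DeriveDef; first by apply/cvg_ex; exists (l ('D_v f x)).
exact: cvg_lim.
Qed.

Lemma Cdir_linear V W W' (I : Type) (e : I -> V) k (U : set V)
    (l : {linear W -> W'}) (f : V -> W) :
  open U -> continuous l -> Cdir e k U f -> Cdir e k U (l \o f).
Proof.
move=> oU cl; elim: k f => [|k IH] f [cf df]; split => //.
- by move=> x Ux; apply: continuous_comp; [exact: cf|exact: cl].
- by move=> x Ux; apply: continuous_comp; [exact: cf|exact: cl].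
- move=> i; have [dfi Dfi] := df i.
  have lf x : U x -> is_derive x (e i) (l \o f) (l ('D_(e i) f x)).
    by move=> Ux; apply: is_derive_linear => //; exact/derivableP/dfi.
  split => [x Ux|]; first by have lfx := lf x Ux; exact: ex_derive.
  apply: Cdir_eq (IH _ Dfi) => // x Ux /=.
  by have lfx := lf x Ux; rewrite derive_val.
Qed.

Lemma Cdir_add V W (I : Type) (e : I -> V) k (U : set V) (f g : V -> W) :
  open U -> Cdir e k U f -> Cdir e k U g -> Cdir e k U (fun x => f x + g x).
Proof.
move=> oU; elim: k f g => [|k IH] f g [cf df] [cg dg]; split => //.
- by move=> x Ux; apply: continuousD; [exact: cf|exact: cg].
- by move=> x Ux; apply: continuousD; [exact: cf|exact: cg].
- move=> i; have [dfi Dfi] := df i; have [dgi Dgi] := dg i.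
  split => [x Ux|]; first by apply: derivableD; [exact: dfi|exact: dgi].
  apply: Cdir_eq (IH _ _ Dfi Dgi) => // x Ux.
  by rewrite deriveD//; [exact: dfi|exact: dgi].
Qed.

Lemma Cdir_sum V W (I : Type) (e : I -> V) k (U : set V) n (f : 'I_n -> V -> W) :
  open U -> (forall i, Cdir e k U (f i)) -> Cdir e k U (fun x => \sum_i f i x).
Proof.
move=> oU fU; have -> : (fun x => \sum_i f i x) = \sum_i f i.
  by apply/funext => x; rewrite fct_sumE.
apply: (@big_ind _ (fun g : V -> W => Cdir e k U g)) => //.
- exact: Cdir_cst.
- by move=> g h gU hU; exact: Cdir_add.
Qed.

Lemma is_derive_affine_functional V (l : V -> R) x v (dl : R) :
  (forall h : R, l (h *: v + x) = h * dl + l x) -> is_derive x v l dl.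
Proof.
move=> lv.
have cvd : h^-1 *: ((l \o shift x) (h *: v) - l x) @[h --> (0:R)^'] --> dl.
  apply: cvg_near_cst; near=> h; have h0 : h != 0 by near: h; exact: (nbhs_dnbhs_neq (0 : R)).
  by rewrite /= lv addrK /GRing.scale/= mulKf.
apply: DeriveDef; first by apply/cvg_ex; exists dl.
exact: cvg_lim.
Unshelve. all: by end_near. Qed.

Lemma is_derive_scale_mx V p q (l : V -> R) (g : V -> 'M[R]_(p, q)) x v dl dg :
  is_derive x v l dl -> is_derive x v g dg ->
  is_derive x v (fun y => l y *: g y) (dl *: g x + l x *: dg).
Proof.
move=> lx gx; apply: is_derive_mx => i j.
have -> : (fun s => (l s *: g s) i j) = l * (fun s => g s i j).
  by apply/funext => s; rewrite !mxE.
have gij := is_derive_coord i j gx.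
by apply: is_derive_eq; rewrite /GRing.scale/= !mxE addrC (mulrC (g x i j)).
Qed.

(** For a factor [l] with constant derivatives the product rule gives a constant multiple of [g]
    plus a term of the same shape, so induction on k closes without a general product theorem. *)
Lemma Cdir_scale_mx V (I : Type) (e : I -> V) k (U : set V) p q
    (l : V -> R) (dl : I -> R) (g : V -> 'M[R]_(p, q)) :
  open U -> continuous l ->
  (forall i (h : R) x, l (h *: e i + x) = h * dl i + l x) ->
  Cdir e k U g -> Cdir e k U (fun x => l x *: g x).
Proof.
move=> oU cl lP; elim: k g => [|k IH] g gU.
  split; last by [].
  by move=> x Ux; apply: (@cvgZ _ _ _ _ _ l g); [exact: cl|exact: Cdir_continuous gU Ux].
split.
  by move=> x Ux; apply: (@cvgZ _ _ _ _ _ l g); [exact: cl|exact: Cdir_continuous gU Ux].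
move=> i; have Dgi := Cdir_derive i gU.
  have dgi x : U x -> derivable g x (e i) by move=> Ux; exact: Cdir_derivable gU Ux.
  have D x : U x -> is_derive x (e i) (fun y => l y *: g y)
      (dl i *: g x + l x *: 'D_(e i) g x).
    move=> Ux; apply: is_derive_scale_mx; last exact/derivableP/dgi.
    by apply: is_derive_affine_functional => h; exact: lP.
  split => [x Ux|]; first by have Dx := D x Ux; exact: ex_derive.
  apply: (@Cdir_eq _ _ _ _ _ _ (fun x => dl i *: g x + l x *: 'D_(e i) g x)) => //.
    by move=> x Ux; have Dx := D x Ux; rewrite derive_val.
  apply: Cdir_add => //; last exact: IH.
  have gk : Cdir e k U g by exact: Cdir_le gU.
  exact: (@Cdir_linear _ _ _ _ _ _ _ ( *:%R (dl i)) g oU (@scaler_continuous _ _ _)).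
Qed.

End CdirCalculus.

(** * Dependence of solutions on the initial value *)

Section ODE.
Context {R : realType} (T : R).
Hypothesis T0 : 0 <= T.

Definition hdir m (i : 'I_m) : R * 'cV[R]_m := (0, unitvec i).

(** The partial differential of f in h at p, applied to v. *)
Definition dh m (f : R * 'cV[R]_m -> 'cV[R]_m) (p : R * 'cV[R]_m) (v : 'cV[R]_m) : 'cV[R]_m :=
  \sum_i v i 0 *: 'D_(hdir i) f p.

Lemma cV_unitvec_sum m (v : 'cV[R]_m) : \sum_i v i 0 *: unitvec i = v.
Proof.
apply/colP => j; rewrite summxE (bigD1 j)//= big1 => [|i /negbTE ij].
  by rewrite !mxE !eqxx mulr1 addr0.
by rewrite !mxE eq_sym ij mulr0.
Qed.

Lemma hdir_sum m (v : 'cV[R]_m) : \sum_i v i 0 *: hdir i = (0, v).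
Proof.
rewrite -[in RHS](cV_unitvec_sum v).
rewrite (big_morph (fun x : 'cV[R]_m => (0, x) : R * 'cV[R]_m) (id1 := 0) (op1 := +%R)) //; last first.
  by move=> x y; rewrite -[RHS]/(0 + 0, x + y) addr0.
by apply: eq_bigr => i _; rewrite -[LHS]/(v i 0 *: 0, v i 0 *: unitvec i) scaler0.
Qed.

Lemma pair_norm_lt (V : normedModType R) (s t : R) (y z : V) r :
  `|s - t| < r -> `|y - z| < r -> `|(s, y) - (t, z)| < r.
Proof. by move=> st yz; rewrite /Num.Def.normr/= gt_max st. Qed.

Lemma dhB m (f : R * 'cV[R]_m -> 'cV[R]_m) p u v : dh f p (u - v) = dh f p u - dh f p v.
Proof.
by rewrite /dh -sumrB; apply: eq_bigr => i _; rewrite !mxE scalerBl.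
Qed.

Lemma dh_norm m (f : R * 'cV[R]_m -> 'cV[R]_m) p v :
  `|dh f p v| <= (\sum_i `|'D_(hdir i) f p|) * `|v|.
Proof.
rewrite (le_trans (ler_norm_sum _ _ _))// mulr_suml; apply: ler_sum => i _.
by rewrite normrZ mulrC ler_wpM2l// mx_coord_le.
Qed.

(* Uniformity along the compact graph of [h0]. *)
Lemma tube m (h0 : R -> 'cV[R]_m) (Q : R -> 'cV[R]_m -> 'cV[R]_m -> Prop) :
  continuous h0 ->
  (forall t, 0 <= t <= T -> exists2 r, 0 < r & forall s y v,
    0 <= s <= T -> `|s - t| < r -> `|h0 s - h0 t| < r -> `|y - h0 t| < r -> `|v| < r -> Q s y v) ->
  exists2 r, 0 < r & forall t y v, 0 <= t <= T -> `|y - h0 t| < r -> `|v| < r -> Q t y v.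
Proof.
move=> ch0 loc.
pose P (r : R) (t : R) := 0 <= t <= T -> forall y v, `|y - h0 t| < r -> `|v| < r -> Q t y v.
have : \forall r \near (0 : R)^'+, `[0, T] `<=` P r.
  apply: (compact_near_coveringP _).1; first exact: segment_compact.
  move=> t; rewrite /= in_itv/= => tT; have [r r0 rP] := loc t tT.
  have r20 : 0 < r / 2 by rewrite divr_gt0.
  have near_t : \forall s \near t, `|s - t| < r /\ `|h0 s - h0 t| < r / 2.
    apply: filterI.
      by apply/nbhs_normP; exists r => // s /=; rewrite distrC.
    have /cvgrPdist_lt/(_ _ r20) := ch0 t.
    by apply: filterS => s; rewrite distrC.
  have near_r : \forall u \near (0 : R)^'+, u < r / 2 by exact: nbhs_right_lt.
  (* The halves leave room to move the centre of the ball from [h0 s] to [h0 t]. *)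
  exists ([set s | `|s - t| < r /\ `|h0 s - h0 t| < r / 2], [set u | u < r / 2]).
    by split.
  move=> [s u] [/= [st hst] ur] sT y v yu vu; apply: rP => //.
  - by rewrite (lt_le_trans hst)// ler_pdivrMr// ler_peMr ?(ltW r0)// ler1n.
  - rewrite -(subrKA (h0 s)) (le_lt_trans (ler_normD _ _))// (splitr r).
    by rewrite ltrD// (lt_trans yu).
  - by rewrite (lt_trans vu)// (lt_le_trans ur)// ler_pdivrMr// ler_peMr ?(ltW r0)// ler1n.
move=> nearP; have : \forall r \near (0 : R)^'+, 0 < r /\ `[0, T] `<=` P r.
  by apply: filterI; [exact: nbhs_right_gt|exact: nearP].
move=> /filter_ex[r [r0 rP]]; exists r => // t y v tT; apply: rP => //.
Qed.

(** A solution is kept as a continuous curve on the whole line that obeys the equation inside (0, T)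
    only: this is what [picard] produces and what [clip] makes of a maximal solution. *)
Definition sol m (Omega : set (R * 'cV[R]_m)) (f : R * 'cV[R]_m -> 'cV[R]_m)
    (a : 'cV[R]_m) (h : R -> 'cV[R]_m) : Prop :=
  [/\ continuous h, h 0 = a,
      forall t, 0 <= t <= T -> Omega (t, h t) &
      forall t, 0 < t < T -> is_derive t 1 h (f (t, h t))].

Definition variation m (f : R * 'cV[R]_m -> 'cV[R]_m) (h0 : R -> 'cV[R]_m)
    (v : 'cV[R]_m) (y : R -> 'cV[R]_m) : Prop :=
  [/\ continuous y, y 0 = v &
      forall t, 0 < t < T -> is_derive t 1 y (dh f (t, h0 t) (y t))].

Section Field.
Context m (Omega : set (R * 'cV[R]_m)) (f : R * 'cV[R]_m -> 'cV[R]_m).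
Hypotheses (oO : open Omega) (fC : Cdir (@hdir m) 1 Omega f).
Context (a0 : 'cV[R]_m) (h0 : R -> 'cV[R]_m).
Hypothesis sol0 : sol Omega f a0 h0.

Let ch0 : continuous h0. Proof. by case: sol0. Qed.
Let Oh0 t : 0 <= t <= T -> Omega (t, h0 t). Proof. by case: sol0 => _ _ + _; exact. Qed.

Lemma dh_near p0 eps : Omega p0 -> 0 < eps ->
  exists2 r, 0 < r & forall p, `|p - p0| < r -> Omega p /\
    forall u, `|dh f p u - dh f p0 u| <= eps * `|u|.
Proof.
move=> Op0 e0; pose eta := eps / (m%:R + 1).
have m0 : 0 < m%:R + 1 :> R by rewrite ltr_wpDl.
have eta0 : 0 < eta by rewrite divr_gt0.
have /choice[r rP] : forall i : 'I_m, exists r : R, 0 < r /\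
    forall p, `|p - p0| < r -> `|'D_(hdir i) f p - 'D_(hdir i) f p0| <= eta.
  move=> i; have := Cdir_continuous (Cdir_derive i fC) Op0.
  move=> /cvgrPdist_le/(_ _ eta0)/near_norm[r r0 rP].
  exists r; split; first exact: r0.
  by move=> p /rP h; rewrite distrC; exact: h.
have [r1 r10 rr1] := ord_min_pos (fun l => (rP l).1).
have [r2 r20 rr2] := near_norm (open_nbhs_nbhs (conj oO Op0)).
exists (Num.min r1 r2); first by rewrite lt_min r10.
move=> p; rewrite lt_min => /andP[pr1 /rr2 Op]; split => // u.
rewrite /dh -sumrB (le_trans (ler_norm_sum _ _ _))//.
apply: (@le_trans _ _ (\sum_(i < m) eta * `|u|)).
  apply: ler_sum => i _; rewrite -scalerBr normrZ mulrC ler_pM ?mx_coord_le//.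
  by apply: (rP i).2; exact: lt_le_trans (rr1 i).
rewrite sumr_const card_ord -[leLHS]mulr_natr mulrAC ler_wpM2r// /eta.
by rewrite mulrAC -mulrA ler_piMr ?(ltW e0)// ler_pdivrMr// mul1r lerDl.
Qed.

Lemma field_estimate p0 eps : Omega p0 -> 0 < eps ->
  exists2 r, 0 < r & forall t y v, `|(t, y) - p0| < r -> `|v| < r ->
    `|f (t, y + v) - f (t, y) - dh f (t, y) v| <= eps * `|v|.
Proof.
move=> Op0 e0; have [r r0 rP] := partial_estimate oO Op0 fC e0.
exists r => // t y v tyr vr; have := rP (t, y) v tyr vr.
by rewrite hdir_sum -[(t, y) + (0, v)]/(t + 0, y + v) addr0.
Qed.

Lemma tube_estimate eps : 0 < eps -> exists2 r, 0 < r &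
  forall t y v, 0 <= t <= T -> `|y - h0 t| < r -> `|v| < r ->
    [/\ Omega (t, y), `|f (t, y + v) - f (t, y) - dh f (t, y) v| <= eps * `|v| &
      forall u, `|dh f (t, y) u - dh f (t, h0 t) u| <= eps * `|u|].
Proof.
move=> e0; apply: tube => // t tT.
have e20 : 0 < eps / 2 by rewrite divr_gt0.
have [r1 r10 r1P] := dh_near (Oh0 tT) e20.
have [r2 r20 r2P] := field_estimate (Oh0 tT) e0.
exists (Num.min r1 r2); first by rewrite lt_min r10.
move=> s y v sT; rewrite !lt_min => /andP[s1 s2] /andP[h1 h2] /andP[y1 y2] /andP[v1 v2].
have [Osy D1] := r1P _ (pair_norm_lt s1 y1).
have [_ D2] := r1P _ (pair_norm_lt s1 h1).
split; [exact: Osy|exact: (r2P _ _ _ (pair_norm_lt s2 y2) v2)|].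
move=> u; rewrite -(subrKA (dh f (t, h0 t) u)) (le_trans (ler_normD _ _))//.
rewrite (splitr eps) mulrDl lerD//.
by rewrite distrC.
Qed.

(** The partial derivatives are bounded along the compact graph of [h0]. Beyond this bound the
    constant is increased by 1 for leaving the graph and by 1 for the Taylor remainder, both from
    [tube_estimate] with eps = 1. *)
Lemma tube_lipschitz : exists2 rL : R * R, 0 < rL.1 /\ 0 < rL.2 &
  forall t y, 0 <= t <= T -> `|y - h0 t| < rL.1 ->
    [/\ Omega (t, y), forall v, `|v| < rL.1 -> `|f (t, y + v) - f (t, y)| <= rL.2 * `|v| &
      forall u, `|dh f (t, y) u| <= rL.2 * `|u|].
Proof.
have [r r0 rP] := tube_estimate (ltr01 : 0 < 1 :> R).
have /choice[M MP] : forall i : 'I_m, exists M, forall t, 0 <= t <= T ->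
    `|'D_(hdir i) f (t, h0 t)| <= M.
  move=> i; have [|M M0 MP] := @continuous_bounded R _
    (fun t => 'D_(hdir i) f (clip T t, h0 (clip T t))) T T0.
    move=> t; apply: (@continuous_comp _ _ _ (fun t => (clip T t, h0 (clip T t)))
      (fun p => 'D_(hdir i) f p)).
      apply: continuous_pair; first exact: clip_continuous.
      by apply: continuous_comp; [exact: clip_continuous|exact: ch0].
    exact: Cdir_continuous (Cdir_derive i fC) (Oh0 (clip_itv t T0)).
  by exists M => t tT; have := MP t tT; rewrite clip_id.
have dh0 t u : 0 <= t <= T -> `|dh f (t, h0 t) u| <= (\sum_i `|M i|) * `|u|.
  move=> tT; rewrite (le_trans (dh_norm _ _ _))// ler_wpM2r//.
  by apply: ler_sum => i _; rewrite (le_trans (MP i t tT))// ler_norm.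
have S0 : 0 <= \sum_i `|M i| by apply: sumr_ge0.
have dhL t y u : 0 <= t <= T -> `|y - h0 t| < r ->
    `|dh f (t, y) u| <= (\sum_i `|M i| + 1) * `|u|.
  move=> tT yr; have [_ _ /(_ u) D] := rP t y 0 tT yr ltac:(by rewrite normr0).
  rewrite -[dh f (t, y) u](subrK (dh f (t, h0 t) u)) (le_trans (ler_normD _ _))//.
  by rewrite addrC mulrDl lerD// dh0.
exists (r, \sum_i `|M i| + 2) => /=; first by split => //; rewrite ltr_wpDl.
move=> t y tT yr; split.
- by have [] := rP t y 0 tT yr ltac:(by rewrite normr0).
- move=> v vr; have [_ E _] := rP t y v tT yr vr.
  rewrite -[f (t, y + v) - f (t, y)](subrK (dh f (t, y) v)) (le_trans (ler_normD _ _))//.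
  have := dhL t y v tT yr; move: E (normr_ge0 v); lra.
- move=> u; rewrite (le_trans (dhL t y u tT yr))// ler_wpM2r// lerD2l.
  by rewrite ler1n.
Qed.

(** The Lipschitz bound holds only while h stays in the tube. There Gronwall gives at most C |a -
    a0|, which is below the radius by the choice r / C, so [first_exit] keeps h in the tube up to
    time T. *)
Lemma stability : exists2 rC : R * R, 0 < rC.1 /\ 0 < rC.2 &
  forall a h, `|a - a0| < rC.1 -> sol Omega f a h ->
    forall t, 0 <= t <= T -> `|h t - h0 t| <= rC.2 * `|a - a0|.
Proof.
have [[r L] /= [r0 L0] rP] := tube_lipschitz.
have [C C0 CP] := gronwall m (ltW L0) T0.
exists (Num.min r (r / C), C) => /=; first by rewrite lt_min r0 divr_gt0.
move=> a h; rewrite lt_min => /andP[ar]; rewrite ltr_pdivlMr// mulrC => Car [ch h0a Oh hP].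
have [_ h00 _ h0P] := sol0.
have est t : 0 <= t <= T -> (forall s, 0 <= s < t -> `|h s - h0 s| < r) ->
    `|h t - h0 t| <= C * `|a - a0|.
  move=> /andP[t0 tT] close; rewrite -h0a -h00 -[X in C * X]addr0.
  apply: (CP (fun s => h s - h0 s) (fun s => f (s, h s) - f (s, h0 s)) 0 t) => //.
  - by rewrite t0.
  - by move=> s; apply: cvgB; [exact: ch|exact: ch0].
  - move=> s /andP[s0 st]; have sT : 0 < s < T by rewrite s0 (lt_le_trans st).
    by apply: is_deriveB; [exact: hP|exact: h0P].
  - move=> s /andP[s0 st].
    have sT : 0 <= s <= T by rewrite ltW//= ltW// (lt_le_trans st).
    have hr : `|h0 s - h0 s| < r by rewrite subrr normr0.
    have [_ E _] := rP s (h0 s) sT hr.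
    have := E (h s - h0 s) (close s ltac:(by rewrite ltW)).
    by rewrite addr0 [h0 s + _]addrC subrK.
have ex := @first_exit R (fun t => `|h t - h0 t|) r T _ T0 _ _.
have close t : 0 <= t <= T -> `|h t - h0 t| < r.
  apply: ex => [s||s sT cl].
  - apply: (@continuous_comp _ _ _ (fun s => h s - h0 s) (fun x => `|x|)); last exact: norm_continuous.
    by apply: cvgB; [exact: ch|exact: ch0].
  - by rewrite h0a h00.
  - exact: le_lt_trans (est s sT cl) Car.
move=> t tT; apply: est => // s /andP[s0 st]; apply: close.
by case/andP: tT => _ tT; rewrite s0 ltW// (lt_le_trans st).
Qed.

End Field.
End ODE.

Section Lipschitz.
Context {R : realDomainType}.
Implicit Types c x y : R.

Lemma max_lipschitz c x y : `|Num.max c x - Num.max c y| <= `|x - y|.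
Proof.
wlog xy : x y / y <= x => [hw|].
  by have [/hw//|/ltW/hw] := leP y x; rewrite distrC [leRHS]distrC.
rewrite (ger0_norm (_ : 0 <= x - y)) ?subr_ge0// ger0_norm.
  by have [?|?] := leP c x; have [?|?] := leP c y; lra.
by have [?|?] := leP c x; have [?|?] := leP c y; lra.
Qed.

Lemma min_lipschitz c x y : `|Num.min c x - Num.min c y| <= `|x - y|.
Proof.
wlog xy : x y / y <= x => [hw|].
  by have [/hw//|/ltW/hw] := leP y x; rewrite distrC [leRHS]distrC.
rewrite (ger0_norm (_ : 0 <= x - y)) ?subr_ge0// ger0_norm.
  by have [?|?] := leP c x; have [?|?] := leP c y; lra.
by have [?|?] := leP c x; have [?|?] := leP c y; lra.
Qed.

End Lipschitz.

(** * Solutions and first variations near a given trajectory *)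

Section Flow.
Context {R : realType} (T : R) (T0 : 0 <= T).
Context m (Omega : set (R * 'cV[R]_m)) (f : R * 'cV[R]_m -> 'cV[R]_m).
Hypotheses (oO : open Omega) (fC : Cdir (@hdir R m) 1 Omega f).
Context (a0 : 'cV[R]_m) (h0 : R -> 'cV[R]_m).
Hypothesis sol0 : sol T Omega f a0 h0.

Let ch0 : continuous h0. Proof. by case: sol0. Qed.
Let Oh0 t : 0 <= t <= T -> Omega (t, h0 t). Proof. by case: sol0 => _ _ + _; exact. Qed.

Definition clamp (r : R) (v : 'cV[R]_m) : 'cV[R]_m :=
  \col_i Num.max (- r) (Num.min r (v i 0)).

Lemma clamp_norm r v : 0 <= r -> `|clamp r v| <= r.
Proof.
move=> r0; apply: cV_norm_le => // i; rewrite mxE ler_norml le_max lexx/=.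
by rewrite ge_max ge_min lexx/= andbT lerNl (le_trans _ r0)// oppr_le0.
Qed.

Lemma clamp_id r v : `|v| <= r -> clamp r v = v.
Proof.
move=> vr; apply/colP => i; rewrite mxE.
have := le_trans (mx_coord_le v i 0) vr; rewrite ler_norml => /andP[? ?].
by rewrite min_r// max_r.
Qed.

Lemma clamp_lipschitz r u v : `|clamp r u - clamp r v| <= `|u - v|.
Proof.
apply: cV_norm_le => // i; rewrite (le_trans _ (mx_coord_le (u - v) i 0))// !mxE.
exact: le_trans (max_lipschitz _ _ _) (min_lipschitz _ _ _).
Qed.

Lemma clamp_continuous r : continuous (clamp r).
Proof.
move=> v; apply: continuous_mx => i j; under eq_cvg do rewrite mxE.
rewrite mxE; apply: (@continuous_max _ _ (cst (- r)) (fun v : 'cV[R]_m => Num.min r (v i 0))).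
  exact: cst_continuous.
apply: (@continuous_min _ _ (cst r) (fun v : 'cV[R]_m => v i 0)); first exact: cst_continuous.
exact: coord_continuous.
Qed.

(** Time is clipped to [0, T] and space is retracted onto a tube around [h0]; the field composed
    with this retraction is globally Lipschitz, so [picard] applies. By Gronwall its solution never
    leaves the tube, where the field is the original one. *)
Lemma sol_exists : exists2 r, 0 < r &
  forall a, `|a - a0| < r -> exists h, sol T Omega f a h.
Proof.
have [[r L] /= [r0 L0] rP] := tube_lipschitz T0 oO fC sol0.
have [C C0 CP] := gronwall m (ltW L0) T0.
have [_ h00 _ h0P] := sol0.
(* Two clamped vectors may differ by 2 q, and this difference must stay below r for
   [tube_lipschitz]. *)
pose q := r / 4; have q0 : 0 < q by rewrite divr_gt0.
have qr : q + q < r by rewrite /q; have := r0; lra.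
exists (q / C); first by rewrite divr_gt0.
move=> a; rewrite ltr_pdivlMr// mulrC => Ca.
pose A2 (p : R * 'cV[R]_m) : 'cV[R]_m :=
  h0 (clip T p.1) + clamp q (p.2 - h0 (clip T p.1)).
pose A (p : R * 'cV[R]_m) : R * 'cV[R]_m := (clip T p.1, A2 p).
have cA1 : continuous (fun p : R * 'cV[R]_m => clip T p.1).
  by move=> p; apply: (@continuous_comp _ _ _ fst (clip T)); [exact: cvg_fst|exact: clip_continuous].
have ch : continuous (fun p : R * 'cV[R]_m => h0 (clip T p.1)).
  by move=> p; apply: (@continuous_comp _ _ _ (fun p : R * 'cV[R]_m => clip T p.1) h0); [exact: cA1|exact: ch0].
have cA2 : continuous A2.
  move=> p; apply: cvgD; first exact: ch.
  apply: (@continuous_comp _ _ _ (fun p' : R * 'cV[R]_m => p'.2 - h0 (clip T p'.1)) (clamp q)).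
    by apply: cvgB; [exact: cvg_snd|exact: ch].
  exact: clamp_continuous.
have cA : continuous A by move=> p; exact: (continuous_pair (@cA1 p) (@cA2 p)).
have clq v : `|clamp q v| < r.
  by rewrite (le_lt_trans (clamp_norm _ (ltW q0)))//; have := q0; lra.
have OA p : Omega (A p).
  have [] // := rP (clip T p.1) (A2 p) (clip_itv _ T0).
  by rewrite /A2 addrAC subrr add0r.
pose g p := f (A p).
have cg : continuous g.
  move=> p; apply: (@continuous_comp _ _ _ A f); first exact: cA.
  exact: Cdir_continuous fC (OA p).
have gL t y z : `|g (t, y) - g (t, z)| <= L * `|y - z|.
  rewrite /g /A /A2 /=; set s := clip T t.
  set u := clamp q _; set v := clamp q _.
  have [_ E _] := rP s (h0 s + v) (clip_itv _ T0) ltac:(by rewrite addrAC subrr add0r; exact: clq).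
  have uv : `|u - v| < r.
    by rewrite (le_lt_trans (ler_normB _ _))// (le_lt_trans _ qr)// lerD// clamp_norm// ltW.
  have := E (u - v) uv; rewrite -addrA (addrC v) subrK => /le_trans; apply.
  rewrite ler_wpM2l ?(ltW L0)// (le_trans (clamp_lipschitz _ _ _))//.
  by rewrite opprB addrA subrK.
have [u [cu u0 uP]] := picard L0 T0 cg gL a.
have gh0 t : 0 <= t <= T -> g (t, h0 t) = f (t, h0 t).
  move=> tT; rewrite /g /A /A2 /= clip_id// subrr clamp_id ?normr0 ?(ltW q0)//.
  by rewrite addr0.
have close t : 0 <= t <= T -> `|u t - h0 t| < q.
  move=> /andP[t0 tT]; apply: le_lt_trans Ca; rewrite -u0 -h00 -[X in C * X]addr0.
  apply: (CP (fun s => u s - h0 s) (fun s => g (s, u s) - f (s, h0 s)) 0 t) => //.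
  - by rewrite t0.
  - by move=> s; apply: cvgB; [exact: cu|exact: ch0].
  - move=> s /andP[s0 st]; have sT : 0 < s < T by rewrite s0 (lt_le_trans st).
    by apply: is_deriveB; [exact: uP|exact: h0P].
  - move=> s /andP[s0 st].
    have sT : 0 <= s <= T by rewrite ltW//= ltW// (lt_le_trans st).
    by rewrite addr0 -gh0// gL.
have gu t : 0 <= t <= T -> A (t, u t) = (t, u t).
  move=> tT; rewrite /A /A2 /= clip_id// clamp_id ?(ltW (close t tT))//.
  by rewrite addrC subrK.
exists u; split.
- exact: cu.
- exact: u0.
- by move=> t tT; rewrite -gu.
- move=> t /andP[t0 tT]; have tT' : 0 <= t <= T by rewrite !ltW.
  by have := uP t ltac:(by rewrite t0); rewrite /g gu.
Qed.

Lemma variation_exists v : exists y, variation T f h0 v y.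
Proof.
have [[r L] /= [r0 L0] rP] := tube_lipschitz T0 oO fC sol0.
pose p t : R * 'cV[R]_m := (clip T t, h0 (clip T t)).
have cp : continuous p.
  move=> t; apply: continuous_pair; first exact: clip_continuous.
  by apply: continuous_comp; [exact: clip_continuous|exact: ch0].
pose g (z : R * 'cV[R]_m) : 'cV[R]_m := dh f (p z.1) z.2.
have cg : continuous g.
  move=> z; rewrite /g /dh; apply: continuous_sum_ord => i.
  apply: (@cvgZ _ _ _ _ _ (fun z : R * 'cV[R]_m => z.2 i 0)
    (fun z : R * 'cV[R]_m => 'D_(hdir i) f (p z.1))).
    apply: (@continuous_comp _ _ _ (fun z : R * 'cV[R]_m => z.2) (fun v : 'cV[R]_m => v i 0)).
      exact: cvg_snd.
    exact: coord_continuous.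
  apply: (@continuous_comp _ _ _ (fun z : R * 'cV[R]_m => p z.1) (fun q => 'D_(hdir i) f q)).
    by apply: (@continuous_comp _ _ _ fst p); [exact: cvg_fst|exact: cp].
  exact: Cdir_continuous (Cdir_derive i fC) (Oh0 (clip_itv z.1 T0)).
have gL t y z : `|g (t, y) - g (t, z)| <= L * `|y - z|.
  have [_ _ E] := rP (clip T t) (h0 (clip T t)) (clip_itv t T0) ltac:(by rewrite subrr normr0).
  by rewrite /g -dhB; exact: E.
have [y [cy y0 yP]] := picard L0 T0 cg gL v.
exists y; split; [exact: cy|exact: y0|].
move=> t /[dup] tT /andP[t0 tT'].
by have := yP t tT; rewrite /g /p /= clip_id// !ltW.
Qed.

(** The defect h - h0 - y starts at 0, and its derivative is at most L times its norm plus a Taylor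
    remainder eta |h - h0| <= eta C1 |w|; Gronwall concludes with eta = eps / (C C1). *)
Lemma variation_first_order eps : 0 < eps -> exists2 r, 0 < r &
  forall w h y, `|w| < r -> sol T Omega f (a0 + w) h -> variation T f h0 w y ->
    `|h T - h0 T - y T| <= eps * `|w|.
Proof.
move=> e0.
have [[r L] /= [r0 L0] rP] := tube_lipschitz T0 oO fC sol0.
have [C C0 CP] := gronwall m (ltW L0) T0.
have [[r1 C1] /= [r10 C10] SP] := stability T0 oO fC sol0.
pose eta := eps / (C * C1).
have eta0 : 0 < eta by rewrite divr_gt0// mulr_gt0.
have [r2 r20 EP] := tube_estimate oO fC sol0 eta0.
have [_ h00 _ h0P] := sol0.
exists (Num.min r1 (r2 / C1)); first by rewrite lt_min r10 divr_gt0.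
move=> w h y; rewrite lt_min ltr_pdivlMr// mulrC => /andP[wr1 wr2] solh [cy y0 yP].
have [ch h0a Oh hP] := solh.
have hh0 t : 0 <= t <= T -> `|h t - h0 t| <= C1 * `|w|.
  move=> tT; have := SP (a0 + w) h; rewrite addrAC subrr add0r.
  by move=> /(_ wr1 solh t tT).
have -> : eps * `|w| = C * (`|h 0 - h0 0 - y 0| + eta * (C1 * `|w|)).
  rewrite h0a h00 y0 (addrAC a0 w) subrr add0r subrr normr0 add0r /eta.
  by field; rewrite !gt_eqF.
apply: (CP (fun s => h s - h0 s - y s)
  (fun s => f (s, h s) - f (s, h0 s) - dh f (s, h0 s) (y s)) _ T).
- by apply: mulr_ge0; [exact: ltW|apply: mulr_ge0; [exact: ltW|exact: normr_ge0]].
- by rewrite T0 lexx.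
- by move=> s; apply: cvgB; [apply: cvgB; [exact: ch|exact: ch0]|exact: cy].
- by move=> s sT; apply: is_deriveB; [apply: is_deriveB; [exact: hP|exact: h0P]|exact: yP].
- move=> s /andP[s0 sT'].
  have sT : 0 <= s <= T by rewrite !ltW.
  have hr : `|h0 s - h0 s| < r2 by rewrite subrr normr0.
  have hr' : `|h0 s - h0 s| < r by rewrite subrr normr0.
  have hw := hh0 s sT.
  have [_ E _] := EP s (h0 s) (h s - h0 s) sT hr (le_lt_trans hw wr2).
  have [_ _ D] := rP s (h0 s) sT hr'.
  rewrite [h0 s + (h s - h0 s)]addrC subrK in E.
  have -> : f (s, h s) - f (s, h0 s) - dh f (s, h0 s) (y s) =
      dh f (s, h0 s) (h s - h0 s - y s) +
      (f (s, h s) - f (s, h0 s) - dh f (s, h0 s) (h s - h0 s)).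
    by rewrite (dhB f _ (h s - h0 s) (y s)) [RHS]addrC subrKA.
  apply: le_trans (ler_normD _ _) _; apply: lerD; first exact: D.
  by apply: le_trans E _; rewrite ler_wpM2l// ltW.
Qed.

(** The difference z - y solves the linearised equation along h up to the change of [dh] between h
    and [h0], which is at most eta times the bound M of y. *)
Lemma variation_continuous v y eps : variation T f h0 v y -> 0 < eps ->
  exists2 r, 0 < r & forall a h z, `|a - a0| < r -> sol T Omega f a h ->
    variation T f h v z -> `|z T - y T| <= eps.
Proof.
move=> [cy y0 yP] e0.
have [[r L] /= [r0 L0] rP] := tube_lipschitz T0 oO fC sol0.
have [C C0 CP] := gronwall m (ltW L0) T0.
have [[r1 C1] /= [r10 C10] SP] := stability T0 oO fC sol0.
have [M M0 MP] := continuous_bounded T0 cy.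
pose eta := eps / (C * M).
have eta0 : 0 < eta by rewrite divr_gt0// mulr_gt0.
have [r2 r20 EP] := tube_estimate oO fC sol0 eta0.
exists (Num.min r1 (Num.min (r / C1) (r2 / C1))); first by rewrite !lt_min r10 !divr_gt0.
move=> a h z; rewrite !lt_min !ltr_pdivlMr// ![_ * C1]mulrC => /and3P[ar1 ar ar2] solh [cz z0 zP].
have hh0 := SP a h ar1 solh.
have -> : eps = C * (`|z 0 - y 0| + eta * M).
  by rewrite z0 y0 subrr normr0 add0r /eta; field; rewrite !gt_eqF.
apply: (CP (fun s => z s - y s)
  (fun s => dh f (s, h s) (z s) - dh f (s, h0 s) (y s)) _ T).
- by rewrite mulr_ge0// ltW.
- by rewrite T0 lexx.
- by move=> s; apply: cvgB; [exact: cz|exact: cy].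
- by move=> s sT; apply: is_deriveB; [exact: zP|exact: yP].
- move=> s /andP[s0 sT'].
  have sT : 0 <= s <= T by rewrite !ltW.
  have [_ _ D] := rP s (h s) sT (le_lt_trans (hh0 s sT) ar).
  have [_ _ E] := EP s (h s) 0 sT (le_lt_trans (hh0 s sT) ar2) ltac:(by rewrite normr0).
  rewrite -(subrKA (dh f (s, h s) (y s))).
  apply: le_trans (ler_normD _ _) _; apply: lerD; first by rewrite -dhB; exact: D.
  by apply: le_trans (E _) _; rewrite ler_wpM2l ?(ltW eta0)// MP.
Qed.

Lemma variation_injective v y : variation T f h0 v y -> y T = 0 -> v = 0.
Proof.
move=> [cy y0 yP] yT.
have [[r L] /= [r0 L0] rP] := tube_lipschitz T0 oO fC sol0.
have [C C0 CP] := gronwall m (ltW L0) T0.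
have crev : continuous (fun s : R => T - s).
  by move=> s; apply: cvgB; [exact: cvg_cst|exact: cvg_id].
have := CP (fun s => y (T - s)) (fun s => - dh f (T - s, h0 (T - s)) (y (T - s))) 0 T (lexx 0).
rewrite T0 lexx subrr subr0 yT y0 normr0 addr0 mulr0 normr_le0 => h.
apply/eqP; apply: h; first by [].
- by move=> s; apply: (@continuous_comp _ _ _ (fun s : R => T - s) y); [exact: crev|exact: cy].
- move=> s /andP[s0 sT]; have Ts : 0 < T - s < T by apply/andP; split; lra.
  apply: is_derive_mx => i j.
  have d1 : is_derive s 1 (fun s : R => T - s) (-1).
    by rewrite -(sub0r 1); exact: (is_deriveB (is_derive_cst T s 1) (is_derive_id s 1)).
  have d2 := is_derive_coord i j (yP _ Ts).
  have := @is_derive1_comp _ (fun s => y s i j) (fun s => T - s) s _ _ d2 d1; rewrite mulrN1.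
  by rewrite mxE.
- move=> s /andP[s0 sT]; have Ts : 0 <= T - s <= T by apply/andP; split; lra.
  have [_ _ D] := rP (T - s) (h0 (T - s)) Ts ltac:(by rewrite subrr normr0).
  by rewrite normrN addr0; exact: D.
Qed.

End Flow.

Lemma continuous_dist (R : numFieldType) (V W : normedModType R) (f : V -> W) x :
  (forall eps, 0 < eps -> exists2 r, 0 < r &
    forall y, `|y - x| < r -> `|f y - f x| <= eps) -> {for x, continuous f}.
Proof.
move=> fx; apply/cvgrPdist_le => eps eps0; have [r r0 rP] := fx eps eps0.
by apply/nbhs_normP; exists r => // y /= xy; rewrite distrC; apply: rP; rewrite distrC.
Qed.

Lemma open_dist (R : numFieldType) (V : normedModType R) (U : set V) :
  (forall x, U x -> exists2 r, 0 < r & forall y, `|y - x| < r -> U y) -> open U.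
Proof.
move=> xU; rewrite openE => x Ux; have [r r0 rP] := xU x Ux.
by apply/nbhs_normP; exists r => // y /= xy; apply: rP; rewrite distrC.
Qed.

Section CdirMatrix.
Context {R : realType}.

Lemma Cdir_mx (V : normedModType R) (I : Type) (e : I -> V) k (U : set V) p q
    (f : V -> 'M[R]_(p, q)) :
  open U -> (forall i j, Cdir e k U (fun x => f x i j)) -> Cdir e k U f.
Proof.
move=> oU; elim: k f => [|k IH] f fU.
  split; last by [].
  by move=> x Ux; apply: continuous_mx => i j; exact: Cdir_continuous (fU i j) Ux.
split.
  by move=> x Ux; apply: continuous_mx => i j; exact: Cdir_continuous (fU i j) Ux.
move=> d.
have df x : U x -> derivable f x (e d).
  by move=> Ux; apply/derivable_mxP => i j; exact: Cdir_derivable (fU i j) Ux.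
split; first exact: df.
apply: IH => i j; apply: (Cdir_eq oU _ (Cdir_derive d (fU i j))) => x Ux.
by rewrite (derive_mx (df x Ux)) mxE.
Qed.

Lemma Cdir_subset (V W : normedModType R) (I : Type) (e : I -> V) k (U U' : set V)
    (f : V -> W) : U `<=` U' -> Cdir e k U' f -> Cdir e k U f.
Proof.
move=> UU'; elim: k f => [|k IH] f fU.
  by split; last by []; move=> x /UU' Ux; exact: Cdir_continuous fU Ux.
split; first by move=> x /UU' Ux; exact: Cdir_continuous fU Ux.
move=> i; split; first by move=> x /UU' Ux; exact: Cdir_derivable fU Ux.
exact: IH (Cdir_derive i fU).
Qed.

Lemma Cdir_coord (V : normedModType R) (I : Type) (e : I -> V) k (U : set V) p q
    (f : V -> 'M[R]_(p, q)) i j :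
  open U -> Cdir e k U f -> Cdir e k U (fun x => f x i j).
Proof.
move=> oU; elim: k f => [|k IH] f fU.
  split; last by [].
  by move=> x Ux; apply: continuous_coord; exact: Cdir_continuous fU Ux.
split.
  by move=> x Ux; apply: continuous_coord; exact: Cdir_continuous fU Ux.
move=> d.
have df x : U x -> derivable f x (e d).
  by move=> Ux; exact: Cdir_derivable fU Ux.
split; first by move=> x Ux; exact: ((derivable_mxP _ _ _).1 (df x Ux) i j).
apply: (Cdir_eq oU _ (IH _ (Cdir_derive d fU))) => x Ux.
by rewrite (derive_mx (df x Ux)) mxE.
Qed.

End CdirMatrix.

Section TangentField.
Context {R : realType} m (Omega : set (R * 'cV[R]_m)) (f : R * 'cV[R]_m -> 'cV[R]_m).

Definition base_point (p : R * 'cV[R]_(m + m)) : R * 'cV[R]_m := (p.1, usubmx p.2).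

(* A solution together with a first variation along it solves the ODE of the
   tangent field; this turns the smoothness of the endpoint into an induction
   on the order of differentiability. *)
Definition tangent_field (p : R * 'cV[R]_(m + m)) : 'cV[R]_(m + m) :=
  col_mx (f (base_point p)) (dh f (base_point p) (dsubmx p.2)).

Definition tangent_set : set (R * 'cV[R]_(m + m)) := [set p | Omega (base_point p)].

Lemma usubmx_continuous : continuous (@usubmx R m m 1).
Proof.
move=> v; apply: continuous_mx => i j; under eq_cvg do rewrite mxE.
by rewrite mxE; exact: coord_continuous.
Qed.

Lemma dsubmx_continuous : continuous (@dsubmx R m m 1).
Proof.
move=> v; apply: continuous_mx => i j; under eq_cvg do rewrite mxE.
by rewrite mxE; exact: coord_continuous.
Qed.

Lemma base_point_continuous : continuous base_point.
Proof.
move=> p; apply: (@continuous_pair _ _ _ fst (fun p : R * 'cV[R]_(m + m) => usubmx p.2)).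
  exact: cvg_fst.
by apply: (@continuous_comp _ _ _ snd (@usubmx R m m 1)); [exact: cvg_snd|exact: usubmx_continuous].
Qed.

Lemma tangent_set_open : open Omega -> open tangent_set.
Proof. by move=> oO; apply: open_comp => // p _; exact: base_point_continuous. Qed.

(** One order is lost because the lower half contains the first derivatives of f; these are composed
    with an affine map and multiplied by coordinates, as [Cdir_affine] and [Cdir_scale_mx]
    require. *)
Lemma Cdir_tangent_field k : open Omega -> Cdir (@hdir R m) k.+1 Omega f ->
  Cdir (@hdir R (m + m)) k tangent_set tangent_field.
Proof.
move=> oO fC; have oB := tangent_set_open oO.
have base l (g : R * 'cV[R]_m -> 'cV[R]_m) : Cdir (@hdir R m) l Omega g ->
    Cdir (@hdir R (m + m)) l tangent_set (g \o base_point).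
  apply: (@Cdir_affine _ _ _ _ _ _ _ _ _ _ _ (fun i => (0, usubmx (unitvec i)))).
  - move=> i h p; rewrite /base_point /hdir -[h *: (_, _) + p]/(h *: 0 + p.1, h *: unitvec i + p.2).
    rewrite -[RHS]/(h *: 0 + p.1, h *: usubmx (unitvec i) + usubmx p.2); congr (_, _).
    by apply/matrixP => a b; rewrite !mxE.
  - exact: base_point_continuous.
  - move=> i; case: (split_ordP i) => j ->; [right; exists j|left].
      congr (_, _); apply/matrixP => a b; rewrite !mxE.
      by rewrite eq_lshift.
    by congr (_, _); apply/matrixP => a b; rewrite !mxE eq_lrshift.
apply: Cdir_mx => // i j; case: (split_ordP i) => i' ->.
  have -> : (fun p => tangent_field p (lshift m i') j) =
      (fun p => (f \o base_point) p i' j).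
    by apply/funext => p; rewrite /tangent_field col_mxEu.
  by apply: Cdir_coord => //; apply: base; exact: Cdir_le fC.
have -> : (fun p => tangent_field p (rshift m i') j) =
    (fun p => (\sum_l p.2 (rshift m l) 0 *: ((fun q => 'D_(hdir l) f q) \o base_point) p) i' j).
  apply/funext => p; rewrite /tangent_field col_mxEd /dh.
  congr (fun_of_matrix _ i' j); apply: eq_bigr => l _.
  by rewrite mxE.
apply: Cdir_coord => //; apply: Cdir_sum => // l.
apply: (@Cdir_scale_mx _ _ _ _ _ _ _ _ (fun p : R * 'cV[R]_(m + m) => p.2 (rshift m l) 0)
  (fun d => unitvec d (rshift m l) 0)) => //.
- move=> p; apply: (@continuous_comp _ _ _ snd (fun v : 'cV[R]_(m + m) => v (rshift m l) 0)).
    exact: cvg_snd.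
  exact: coord_continuous.
- by move=> d h p; rewrite !mxE.
- by apply: base; exact: Cdir_derive.
Qed.

End TangentField.

(** * Smoothness of the time-T map *)

Section Endpoint.
Context {R : realType} (T : R).
Hypothesis T0 : 0 <= T.

Definition flow_dom m (Omega : set (R * 'cV[R]_m)) f : set 'cV[R]_m :=
  [set a | exists h, sol T Omega f a h].

(** A chosen solution, the constant curve being the default off [flow_dom]; [sol_unique] makes its
    values on [0, T] independent of the choice. *)
Definition flow m (Omega : set (R * 'cV[R]_m)) f (a : 'cV[R]_m) : R -> 'cV[R]_m :=
  xget (cst a) [set h | sol T Omega f a h].

Definition endpoint m (Omega : set (R * 'cV[R]_m)) f (a : 'cV[R]_m) : 'cV[R]_m :=
  flow Omega f a T.

Lemma flowP m (Omega : set (R * 'cV[R]_m)) f a :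
  flow_dom Omega f a -> sol T Omega f a (flow Omega f a).
Proof. by move=> [h solh]; apply: (@xgetPex _ _ [set h | sol T Omega f a h]); exists h. Qed.

Section Field.
Context m (Omega : set (R * 'cV[R]_m)) (f : R * 'cV[R]_m -> 'cV[R]_m).
Hypotheses (oO : open Omega) (fC : Cdir (@hdir R m) 1 Omega f).

Lemma sol_unique a h g : sol T Omega f a h -> sol T Omega f a g ->
  forall t, 0 <= t <= T -> h t = g t.
Proof.
move=> solh solg t tT.
have [[r C] /= [r0 C0] SP] := stability T0 oO fC solg.
have := SP a h; rewrite subrr normr0 mulr0 => /(_ r0 solh t tT).
by rewrite normr_le0 subr_eq0 => /eqP.
Qed.

Lemma endpointE a h : sol T Omega f a h -> endpoint Omega f a = h T.
Proof.
move=> solh; apply: (sol_unique (flowP _) solh); first by exists h.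
by rewrite T0 lexx.
Qed.

Lemma flow_dom_open : open (flow_dom Omega f).
Proof.
apply: open_dist => a [h solh].
have [r r0 rP] := sol_exists T0 oO fC solh; exists r; first exact: r0.
by move=> b ba; exact: rP.
Qed.

Lemma sol_tangent a v z :
  sol T (tangent_set Omega) (tangent_field f) (col_mx a v) z ->
  sol T Omega f a (fun t => usubmx (z t)) /\
  variation T f (fun t => usubmx (z t)) v (fun t => dsubmx (z t)).
Proof.
move=> [cz z0 Oz zP]; split; split.
- by move=> t; apply: continuous_comp; [exact: cz|exact: usubmx_continuous].
- by rewrite z0 col_mxKu.
- exact: Oz.
- move=> t tT; have dz := zP t tT; apply: is_derive_mx => i j.
  have -> : (fun s => usubmx (z s) i j) = (fun s => z s (lshift m i) j).
    by apply/funext => s; rewrite mxE.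
  by have := is_derive_coord (lshift m i) j dz; rewrite /tangent_field col_mxEu.
- by move=> t; apply: continuous_comp; [exact: cz|exact: dsubmx_continuous].
- by rewrite z0 col_mxKd.
- move=> t tT; have dz := zP t tT; apply: is_derive_mx => i j.
  have -> : (fun s => dsubmx (z s) i j) = (fun s => z s (rshift m i) j).
    by apply/funext => s; rewrite mxE.
  by have := is_derive_coord (rshift m i) j dz; rewrite /tangent_field col_mxEd.
Qed.

Lemma tangent_sol a v h y : sol T Omega f a h -> variation T f h v y ->
  sol T (tangent_set Omega) (tangent_field f) (col_mx a v)
    (fun t => col_mx (h t) (y t)).
Proof.
move=> [ch h0 Oh hP] [cy y0 yP]; split.
- move=> t; apply: continuous_mx => i j; case: (split_ordP i) => i' ->.
    under eq_cvg do rewrite col_mxEu.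
    by rewrite col_mxEu; exact/continuous_coord/ch.
  under eq_cvg do rewrite col_mxEd.
  by rewrite col_mxEd; exact/continuous_coord/cy.
- by rewrite h0 y0.
- by move=> t tT; rewrite /tangent_set /base_point /= col_mxKu; exact: Oh.
- move=> t tT; apply: is_derive_mx => i j; rewrite /tangent_field /base_point /= col_mxKu col_mxKd.
  case: (split_ordP i) => i' ->.
    rewrite col_mxEu; have -> : (fun s => col_mx (h s) (y s) (lshift m i') j) = (fun s => h s i' j).
      by apply/funext => s; rewrite col_mxEu.
    exact: is_derive_coord (hP t tT).
  rewrite col_mxEd; have -> : (fun s => col_mx (h s) (y s) (rshift m i') j) = (fun s => y s i' j).
    by apply/funext => s; rewrite col_mxEd.
  exact: is_derive_coord (yP t tT).
Qed.

Definition tangent_endpoint := endpoint (tangent_set Omega) (tangent_field f).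

Lemma tangent_dom a v : flow_dom Omega f a ->
  flow_dom (tangent_set Omega) (tangent_field f) (col_mx a v).
Proof.
move=> [h solh]; have [y vy] := variation_exists T0 oO fC solh v.
by exists (fun t => col_mx (h t) (y t)); exact: tangent_sol.
Qed.

Lemma variation_scale h v y s : variation T f h v y ->
  variation T f h (s *: v) (fun t => s *: y t).
Proof.
move=> [cy y0 yP]; split.
- by move=> t; apply: cvgZr; exact: cy.
- by rewrite y0.
- move=> t tT; have dy := yP t tT.
  have -> : dh f (t, h t) (s *: y t) = s *: dh f (t, h t) (y t).
    by rewrite /dh scaler_sumr; apply: eq_bigr => i _; rewrite mxE scalerA.
  exact: is_deriveZ.
Qed.

(** [variation_first_order] for the increment s v, divided by |s|. Writing the derivative through
    the endpoint of the tangent field, rather than through a variation, is what lets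
    [endpoint_smooth] iterate. *)
Lemma is_derive_endpoint a v : flow_dom Omega f a ->
  is_derive a v (endpoint Omega f) (dsubmx (tangent_endpoint (col_mx a v))).
Proof.
move=> Da; have [solh vary] := sol_tangent (flowP (tangent_dom v Da)).
rewrite /tangent_endpoint {1}/endpoint; move: solh vary.
set z := flow _ _ _ => solh vary; set y := fun t => dsubmx (z t).
set h0 := fun t => usubmx (z t).
rewrite -/(y T).
have cvd : s^-1 *: ((endpoint Omega f \o shift a) (s *: v) - endpoint Omega f a)
    @[s --> (0:R)^'] --> y T.
  apply/cvgrPdist_le => eps eps0.
  have v1 : 0 < `|v| + 1 by rewrite ltr_wpDl.
  have eta0 : 0 < eps / (`|v| + 1) by rewrite divr_gt0.
  have [r r0 rP] := variation_first_order T0 oO fC solh eta0.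
  have [r1 r10 r1P] := near_norm (open_nbhs_nbhs (conj flow_dom_open Da)).
  have : \forall s \near (0:R)^', s != 0 /\ `|s| < Num.min r r1 / (`|v| + 1).
    apply: filterI; first exact: (nbhs_dnbhs_neq (0 : R)).
    by apply: (@dnbhs0_lt R R); rewrite divr_gt0// lt_min r0.
  apply: filterS => s [s0]; rewrite ltr_pdivlMr// lt_min => /andP[sr sr1].
  have svle : `|s *: v| <= `|s| * (`|v| + 1) by rewrite normrZ ler_wpM2l// lerDl.
  have spos : 0 < `|s| by rewrite normr_gt0.
  have Das : flow_dom Omega f (a + s *: v).
    by apply: r1P; rewrite addrAC subrr add0r; exact: le_lt_trans sr1.
  have := rP (s *: v) _ _ (le_lt_trans svle sr) (flowP Das) (variation_scale s vary).
  rewrite -[flow _ _ _ T]/(endpoint Omega f (a + s *: v)) -(endpointE solh) /= => est.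
  have -> : y T - s^-1 *: (endpoint Omega f (s *: v + a) - endpoint Omega f a) =
      - (s^-1 *: (endpoint Omega f (a + s *: v) - endpoint Omega f a - s *: y T)).
    by rewrite [in RHS]scalerBr scalerA mulVf// scale1r opprB (addrC a).
  rewrite normrN normrZ normfV ler_pdivrMl// (le_trans est)//.
  rewrite normrZ mulrCA ler_wpM2l// mulrAC -mulrA ler_piMr ?(ltW eps0)//.
  by rewrite ler_pdivrMr// mul1r lerDl.
apply: DeriveDef; first by apply/cvg_ex; exists (y T).
exact: cvg_lim.
Qed.

Lemma endpoint_continuous a : flow_dom Omega f a -> {for a, continuous (endpoint Omega f)}.
Proof.
move=> Da; have solh := flowP Da.
have [[r C] /= [r0 C0] SP] := stability T0 oO fC solh.
have [d d0 dP] := near_norm (open_nbhs_nbhs (conj flow_dom_open Da)).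
apply: continuous_dist => eps eps0.
exists (Num.min d (Num.min r (eps / C))); first by rewrite !lt_min d0 r0 divr_gt0.
move=> b; rewrite !lt_min ltr_pdivlMr// [_ * C]mulrC => /and3P[/dP Db br bC].
apply: le_trans (ltW bC).
by apply: (SP b _ br (flowP Db)); rewrite T0 lexx.
Qed.

Lemma tangent_endpoint_continuous a v : flow_dom Omega f a ->
  {for a, continuous (fun b => dsubmx (tangent_endpoint (col_mx b v)))}.
Proof.
move=> Da; have [solh vary] := sol_tangent (flowP (tangent_dom v Da)).
have [d d0 dP] := near_norm (open_nbhs_nbhs (conj flow_dom_open Da)).
apply: continuous_dist => eps eps0.
have [r r0 rP] := variation_continuous T0 oO fC solh vary eps0.
exists (Num.min d r); first by rewrite lt_min d0.
move=> b; rewrite lt_min => /andP[/dP Db br].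
have [solb varb] := sol_tangent (flowP (tangent_dom v Db)).
exact: rP br solb varb.
Qed.

Lemma endpoint_derive_injective a v : flow_dom Omega f a ->
  'D_v (endpoint Omega f) a = 0 -> v = 0.
Proof.
move=> Da; have [solh vary] := sol_tangent (flowP (tangent_dom v Da)).
have De := is_derive_endpoint v Da; rewrite derive_val => vT.
by have := variation_injective T0 oO fC solh vary; move=> /(_ vT).
Qed.

End Field.

(** The induction runs over all dimensions, since the tangent field lives in dimension m + m. All
    vectors are taken as directions, so that the result can be composed with any affine map, such as
    the input layer, by [Cdir_affine]. *)
Lemma endpoint_smooth k m (Omega : set (R * 'cV[R]_m)) (f : R * 'cV[R]_m -> 'cV[R]_m) :
  open Omega -> Cdir (@hdir R m) k.+1 Omega f ->
  Cdir (@id 'cV[R]_m) k.+1 (flow_dom Omega f) (endpoint Omega f).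
Proof.
elim: k m Omega f => [|k IH] m Omega f oO fC.
  (* For a field that is only C^1 the tangent field is merely continuous, so the derivative is shown
     to be continuous by [tangent_endpoint_continuous]. *)
  split; first by move=> a Da; exact: endpoint_continuous.
  move=> v; split.
    by move=> a Da; have De := is_derive_endpoint oO fC v Da; exact: ex_derive.
  apply: (@Cdir_eq _ _ _ _ _ _ _ (fun a => dsubmx (tangent_endpoint Omega f (col_mx a v)))).
  - exact: flow_dom_open.
  - by move=> a Da; have De := is_derive_endpoint oO fC v Da; rewrite derive_val.
  - by split; [move=> a Da; exact: tangent_endpoint_continuous|].
have fC1 : Cdir (@hdir R m) 1 Omega f by exact: Cdir_le fC.
split; first by move=> a Da; exact: endpoint_continuous.
move=> v; split.
  by move=> a Da; have De := is_derive_endpoint oO fC1 v Da; exact: ex_derive.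
have oD : open (flow_dom Omega f) by exact: flow_dom_open.
apply: (@Cdir_eq _ _ _ _ _ _ _ (fun a => dsubmx (tangent_endpoint Omega f (col_mx a v)))).
- exact: oD.
- by move=> a Da; have De := is_derive_endpoint oO fC1 v Da; rewrite derive_val.
have oB := tangent_set_open oO.
have tC := IH _ _ _ oB (Cdir_tangent_field oO fC).
apply: Cdir_mx => // i j.
have -> : (fun a => dsubmx (tangent_endpoint Omega f (col_mx a v)) i j) =
    (fun a => (tangent_endpoint Omega f \o (fun a => col_mx a v)) a (rshift m i) j).
  by apply/funext => a; rewrite mxE.
apply: Cdir_coord; first exact: oD.
have : Cdir (@id 'cV[R]_m) k.+1
    ((fun a => col_mx a v) @^-1` (flow_dom (tangent_set Omega) (tangent_field f)))
    (tangent_endpoint Omega f \o (fun a => col_mx a v)).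
  apply: (@Cdir_affine _ _ _ _ _ _ id id _ _ _ (fun u : 'cV[R]_m => col_mx u 0)) tC.
  - by move=> u h a; rewrite scale_col_mx add_col_mx scaler0 add0r.
  - move=> a; apply: continuous_dist => eps eps0; exists eps => // b ba.
    apply: cV_norm_le => [|l]; first exact: ltW.
    rewrite opp_col_mx add_col_mx subrr; case: (split_ordP l) => l' ->.
      by rewrite col_mxEu (le_trans (mx_coord_le _ _ _))// ltW.
    by rewrite col_mxEd mxE normr0 ltW.
  - by move=> u; right; exists (col_mx u 0).
apply: Cdir_subset => a Da; exact: tangent_dom.
Qed.

End Endpoint.

(** * Differentiability of matrix-valued maps *)

Lemma near_of_dist (R : numFieldType) (V : normedModType R) (P : V -> Prop) x :
  (exists2 r, 0 < r & forall y, `|y - x| < r -> P y) -> nbhs x P.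
Proof.
by move=> [r r0 rP]; apply/nbhs_normP; exists r => // y /=; rewrite distrC => /rP.
Qed.

Section Differentiability.
Context {R : realType}.
Implicit Types V W : normedModType R.

Lemma differentiable_estimate V W (f : V -> W) p eps :
  differentiable f p -> 0 < eps -> exists2 r, 0 < r &
  forall q, `|q - p| < r -> `|f q - f p - 'd f p (q - p)| <= eps * `|q - p|.
Proof.
move=> df eps0; have /eqaddoP/(_ eps eps0) := diff_locally df.
move=> /near_norm[r r0 rP]; exists r => // q qp.
have := rP (q - p); rewrite subr0 => /(_ qp).
by rewrite -[X in `|X| <= _]/(f (q - p + p) - (f p + 'd f p (q - p))) subrK opprD addrA.
Qed.

Lemma differentiable_calm V W (f : V -> W) p : differentiable f p ->
  exists K, \forall q \near p, `|f q - f p| <= K * `|q - p|.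
Proof.
move=> df; have [r r0 rP] := differentiable_estimate df (ltr01 : 0 < 1 :> R).
have [K K0 KP] := linear_lipschitz (diff_continuous df).
exists (1 + K); apply/nbhs_normP; exists r => // q /=; rewrite distrC => qp.
rewrite -[f q - f p](subrK ('d f p (q - p))) (le_trans (ler_normD _ _))//.
by rewrite mulrDl lerD ?rP// KP.
Qed.

Lemma differentiable_sum_fin V (I : finType) (F : I -> V -> R) p :
  (forall i, differentiable (F i) p) -> differentiable (fun q => \sum_i F i q) p.
Proof.
move=> dF; have -> : (fun q => \sum_i F i q) = \sum_i F i.
  by apply/funext => q; rewrite fct_sumE.
apply: (@big_ind _ (fun g : V -> R => differentiable g p)) => //.
by move=> g h dg dh; exact: differentiableD.
Qed.

Lemma differentiable_prod_fin V (I : finType) (F : I -> V -> R) p :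
  (forall i, differentiable (F i) p) -> differentiable (fun q => \prod_i F i q) p.
Proof.
move=> dF; have -> : (fun q => \prod_i F i q) = \prod_i F i.
  by apply/funext => q; rewrite fct_prodE.
apply: (@big_ind _ (fun g : V -> R => differentiable g p)) => //.
by move=> g h dg dh; exact: differentiableM.
Qed.

Lemma differentiable_det V n (A : V -> 'M[R]_n) p :
  (forall i j, differentiable (fun q => A q i j) p) -> differentiable (fun q => \det (A q)) p.
Proof.
move=> dA; apply: differentiable_sum_fin => s.
apply: differentiableM; first exact: differentiable_cst.
by apply: differentiable_prod_fin => i; exact: dA.
Qed.

Lemma differentiable_mulmx V m n k (A : V -> 'M[R]_(m, n)) (B : V -> 'M[R]_(n, k)) p :
  (forall i j, differentiable (fun q => A q i j) p) ->
  (forall i j, differentiable (fun q => B q i j) p) ->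
  forall i j, differentiable (fun q => (A q *m B q) i j) p.
Proof.
move=> dA dB i j.
have -> : (fun q => (A q *m B q) i j) = (fun q => \sum_l A q i l * B q l j).
  by apply/funext => q; rewrite mxE.
by apply: differentiable_sum_fin => l; apply: differentiableM; [exact: dA|exact: dB].
Qed.

Lemma differentiable_adj V n (A : V -> 'M[R]_n) p :
  (forall i j, differentiable (fun q => A q i j) p) ->
  forall i j, differentiable (fun q => \adj (A q) i j) p.
Proof.
move=> dA i j.
have -> : (fun q => \adj (A q) i j) =
    (fun q => (-1) ^+ (j + i) * \det (row' j (col' i (A q)))).
  by apply/funext => q; rewrite mxE.
apply: differentiableM; first exact: differentiable_cst.
apply: differentiable_det => k l.
have -> : (fun q => row' j (col' i (A q)) k l) = (fun q => A q (lift j k) (lift i l)).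
  by apply/funext => q; rewrite !mxE.
exact: dA.
Qed.

Lemma C1_differentiable m n (f : 'cV[R]_m -> 'cV[R]_n) (U : set 'cV[R]_m) p :
  open U -> U p -> Cdir (@unitvec R m) 1 U f -> differentiable f p.
Proof.
move=> oU Up fC.
pose A : 'M[R]_(n, m) := \matrix_(i, j) 'D_(unitvec j) f p i 0.
pose L : {linear 'cV[R]_m -> 'cV[R]_n} := mulmx A.
have LE v : L v = \sum_i v i 0 *: 'D_(unitvec i) f p.
  apply/colP => i; rewrite summxE mxE; apply: eq_bigr => j _.
  by rewrite !mxE mulrC.
have cL : continuous L.
  move=> v; apply: continuous_dist => eps eps0.
  pose K := \sum_i `|'D_(unitvec i) f p| + 1.
  have K0 : 0 < K by rewrite ltr_wpDl// sumr_ge0.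
  exists (eps / K); first by rewrite divr_gt0.
  move=> u; rewrite ltr_pdivlMr// => uv; rewrite -linearB LE.
  rewrite (le_trans (ler_norm_sum _ _ _))// (le_trans _ (ltW uv))// mulrDr mulr1 ler_wpDr//.
  rewrite mulr_sumr; apply: ler_sum => i _; rewrite normrZ ler_wpM2r//.
  exact: mx_coord_le.
have est : f \o shift p = cst (f p) + L +o_ (0 : 'cV[R]_m) id.
  apply/eqaddoP => eps eps0.
  have [r r0 rP] := partial_estimate oU Up fC eps0.
  apply: near_of_dist; exists r => // v; rewrite subr0 => vr.
  have := rP p v; rewrite subrr normr0 => /(_ r0 vr).
  rewrite cV_unitvec_sum -LE.
  by rewrite -[X in _ -> `|X| <= _]/(f (v + p) - (f p + L v)) opprD addrA (addrC v).
have dE := diff_unique cL est.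
by apply/diff_locallyP; rewrite dE.
Qed.

Lemma differentiable_coord_of V m n (f : V -> 'M[R]_(m, n)) p i j :
  differentiable f p -> differentiable (fun q => f q i j) p.
Proof.
by move=> df; apply: (@differentiable_comp _ _ _ _ f (fun M : 'M[R]_(m, n) => M i j)) => //;
  exact: differentiable_coord.
Qed.

End Differentiability.

Section MatrixMaps.
Context {R : realType}.
Implicit Types V : normedModType R.

Lemma differentiable_mx V m n (f : V -> 'M[R]_(m, n)) p :
  (forall i j, differentiable (fun q => f q i j) p) -> differentiable f p.
Proof.
move=> df; have -> : f = \sum_i \sum_j (fun q => f q i j *: delta_mx i j).
  apply/funext => q; rewrite [LHS]matrix_sum_delta fct_sumE; apply: eq_bigr => i _.
  by rewrite fct_sumE.
by apply: differentiable_sum => i; apply: differentiable_sum => j; exact: differentiableZl.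
Qed.

Lemma differentiable_usubmx V m n k (f : V -> 'M[R]_(m + n, k)) p i j :
  (forall i j, differentiable (fun q => f q i j) p) ->
  differentiable (fun q => usubmx (f q) i j) p.
Proof.
move=> df; have -> : (fun q => usubmx (f q) i j) = (fun q => f q (lshift n i) j).
  by apply/funext => q; rewrite mxE.
exact: df.
Qed.

Lemma differentiable_dsubmx V m n k (f : V -> 'M[R]_(m + n, k)) p i j :
  (forall i j, differentiable (fun q => f q i j) p) ->
  differentiable (fun q => dsubmx (f q) i j) p.
Proof.
move=> df; have -> : (fun q => dsubmx (f q) i j) = (fun q => f q (rshift m i) j).
  by apply/funext => q; rewrite mxE.
exact: df.
Qed.

Lemma differentiable_col_mx V m n k (f : V -> 'M[R]_(m, k)) (g : V -> 'M[R]_(n, k)) p :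
  (forall i j, differentiable (fun q => f q i j) p) ->
  (forall i j, differentiable (fun q => g q i j) p) ->
  forall i j, differentiable (fun q => col_mx (f q) (g q) i j) p.
Proof.
move=> df dg i j; case: (split_ordP i) => i' ->.
  have -> : (fun q => col_mx (f q) (g q) (lshift n i') j) = (fun q => f q i' j).
    by apply/funext => q; rewrite col_mxEu.
  exact: df.
have -> : (fun q => col_mx (f q) (g q) (rshift m i') j) = (fun q => g q i' j).
  by apply/funext => q; rewrite col_mxEd.
exact: dg.
Qed.

Lemma differentiable_trmx V m n (f : V -> 'M[R]_(m, n)) p i j :
  (forall i j, differentiable (fun q => f q i j) p) ->
  differentiable (fun q => (f q)^T i j) p.
Proof.
move=> df; have -> : (fun q => (f q)^T i j) = (fun q => f q j i).
  by apply/funext => q; rewrite mxE.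
exact: df.
Qed.

Lemma differentiable_addmx V m n (f g : V -> 'M[R]_(m, n)) p i j :
  (forall i j, differentiable (fun q => f q i j) p) ->
  (forall i j, differentiable (fun q => g q i j) p) ->
  differentiable (fun q => (f q + g q) i j) p.
Proof.
move=> df dg; have -> : (fun q => (f q + g q) i j) = (fun q => f q i j) + (fun q => g q i j).
  by apply/funext => q; rewrite mxE.
by apply: differentiableD; [exact: df|exact: dg].
Qed.

Lemma differentiable_oppmx V m n (f : V -> 'M[R]_(m, n)) p i j :
  (forall i j, differentiable (fun q => f q i j) p) ->
  differentiable (fun q => (- f q) i j) p.
Proof.
move=> df; have -> : (fun q => (- f q) i j) = - (fun q => f q i j).
  by apply/funext => q; rewrite mxE.
by apply: differentiableN; exact: df.
Qed.

Lemma continuous_prod_ord (T : topologicalType) n (f : 'I_n -> T -> R) x :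
  (forall i, {for x, continuous (f i)}) -> {for x, continuous (fun y => \prod_i f i y)}.
Proof.
move=> cf; have -> : (fun y => \prod_i f i y) = \prod_i f i.
  by apply/funext => y; rewrite fct_prodE.
apply: (@big_ind _ (fun g : T -> R => {for x, continuous g})) => //.
- exact: cst_continuous.
- by move=> g h cg ch; exact: continuousM.
Qed.

Lemma continuous_det (T : topologicalType) n (A : T -> 'M[R]_n) x :
  (forall i j, {for x, continuous (fun y => A y i j)}) ->
  {for x, continuous (fun y => \det (A y))}.
Proof.
move=> cA; have -> : (fun y => \det (A y)) =
    \sum_(s : 'S_n) (fun y => (-1) ^+ s * \prod_i A y i (s i)).
  by apply/funext => y; rewrite fct_sumE.
apply: (@big_ind _ (fun g : T -> R => {for x, continuous g})).
- exact: cst_continuous.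
- by move=> g h cg ch; exact: continuousD.
- move=> s _; apply: (@continuousM _ _ (fun=> (-1) ^+ s) (fun y => \prod_i A y i (s i))).
    exact: cst_continuous.
  by apply: continuous_prod_ord => i; exact: cA.
Qed.

Lemma is_derive_sum_ord V n (F : 'I_n -> V -> R) x v (dF : 'I_n -> R) :
  (forall i, is_derive x v (F i) (dF i)) ->
  is_derive x v (fun y => \sum_i F i y) (\sum_i dF i).
Proof.
move=> FP; have -> : (fun y => \sum_i F i y) = \sum_i F i.
  by apply/funext => y; rewrite fct_sumE.
exact: is_derive_sum.
Qed.

End MatrixMaps.

(** * Coordinates on the parameter space *)

Section WeightCoordinates.
Context {R : realType} (n m : nat).
Local Notation N := (m * n + m + m + 1)%N.
Implicit Types z : 'cV[R]_N.

Definition par_W z : 'M[R]_(m, n) := vec_mx (usubmx (usubmx (usubmx z)))^T.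
Definition par_w z : 'cV[R]_m := dsubmx (usubmx (usubmx z)).
Definition par_b z : 'cV[R]_m := dsubmx (usubmx z).
(** Fills the block of the output weights: adding [inj_w v] to a parameter vector changes [par_w]
    only. *)
Definition inj_w (v : 'cV[R]_m) : 'cV[R]_N := col_mx (col_mx (col_mx 0 v) 0) 0.

Lemma usubmx_add_col k l (z : 'cV[R]_(k + l)) u v : usubmx (z + col_mx u v) = usubmx z + u.
Proof. by rewrite -{1}[z]vsubmxK add_col_mx col_mxKu. Qed.

Lemma dsubmx_add_col k l (z : 'cV[R]_(k + l)) u v : dsubmx (z + col_mx u v) = dsubmx z + v.
Proof. by rewrite -{1}[z]vsubmxK add_col_mx col_mxKd. Qed.

Lemma par_W_inj z v : par_W (z + inj_w v) = par_W z.
Proof. by rewrite /par_W /inj_w !usubmx_add_col addr0. Qed.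

Lemma par_w_inj z v : par_w (z + inj_w v) = par_w z + v.
Proof. by rewrite /par_w /inj_w !usubmx_add_col dsubmx_add_col. Qed.

Lemma par_b_inj z v : par_b (z + inj_w v) = par_b z.
Proof. by rewrite /par_b /inj_w usubmx_add_col dsubmx_add_col addr0. Qed.

Lemma inj_wD u v : inj_w (u + v) = inj_w u + inj_w v.
Proof. by rewrite /inj_w !add_col_mx !addr0. Qed.

Lemma inj_wZ (s : R) v : inj_w (s *: v) = s *: inj_w v.
Proof. by rewrite /inj_w !scale_col_mx !scaler0. Qed.

Section Differentiable.
Context (V : normedModType R) (f : V -> 'cV[R]_N) (p : V).
Hypothesis df : forall i j, differentiable (fun q => f q i j) p.

Lemma differentiable_par_W i j : differentiable (fun q => par_W (f q) i j) p.
Proof.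
have -> : (fun q => par_W (f q) i j) =
    (fun q => (usubmx (usubmx (usubmx (f q))))^T 0 (mxvec_index i j)).
  by apply/funext => q; rewrite /par_W mxE.
by apply: differentiable_trmx => ? ?; do 3!apply: differentiable_usubmx => ? ?.
Qed.

Lemma differentiable_par_w i j : differentiable (fun q => par_w (f q) i j) p.
Proof. by apply: differentiable_dsubmx => ? ?; do 2!apply: differentiable_usubmx => ? ?. Qed.

Lemma differentiable_par_b i j : differentiable (fun q => par_b (f q) i j) p.
Proof. by apply: differentiable_dsubmx => ? ?; apply: differentiable_usubmx => ? ?. Qed.

Lemma differentiable_inj_w (g : V -> 'cV[R]_m) i j :
  (forall i j, differentiable (fun q => g q i j) p) ->
  differentiable (fun q => inj_w (g q) i j) p.
Proof.
move=> dg; have c0 k : forall i j, differentiable (fun q : V => (0 : 'cV[R]_k) i j) p.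
  by move=> ? ?; exact: differentiable_cst.
by do 3!(apply: differentiable_col_mx => //; move=> {i j} i j).
Qed.

End Differentiable.
End WeightCoordinates.

(** * Charts of the critical set *)

(** In the expansion of g at c z the increment of g vanishes, so the linear term is as small as the
    remainder; [differentiable_calm] converts |c y - c z| into |y - z|. *)
Lemma differential_along_level (R : realType) (V W : normedModType R) (g : V -> R)
    (c : W -> V) z e :
  differentiable c z -> differentiable g (c z) ->
  (\forall y \near z, g (c y) = g (c z)) -> 0 < e ->
  \forall y \near z, `|'d g (c z) (c y - c z)| <= e * `|y - z|.
Proof.
move=> dc dg ng e0; have [K KP] := differentiable_calm dc.
have K1 : 0 < `|K| + 1 by rewrite ltr_pwDr.
have c0 : 0 < e / (`|K| + 1) by apply: divr_gt0.
have [r r0 rP] := differentiable_estimate dg c0.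
have nr : \forall y \near z, `|c y - c z| < r.
  by move: r r0 {rP}; apply/cvgrPdistC_lt; exact: differentiable_continuous.
apply: filterS3 ng nr KP => y gy /rP; rewrite gy subrr sub0r normrN => H yK.
apply: le_trans H _; apply: le_trans (ler_wpM2l (ltW c0) yK) _.
rewrite mulrA ler_wpM2r// -[leRHS](mulfVK (lt0r_neq0 K1)) ler_wpM2l ?(ltW c0)//.
by rewrite (le_trans (ler_norm K))// lerDl.
Qed.

Section CriticalSet.
Context {R : realType} (n m : nat).
Local Notation N := (m * n + m + m + 1)%N.
Context (D : set 'cV[R]_m) (J : 'cV[R]_m -> 'M[R]_m).
Hypothesis oD : open D.
Hypothesis dJ : forall a l p, D a -> differentiable (fun a => J a l p) a.
Hypothesis cJ : forall a l p r, D a ->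
  {for a, continuous (fun a => 'D_(unitvec r) (fun a => J a l p) a)}.

(* [q] stacks a point [x] on top of a parameter vector. *)
Implicit Types q : 'cV[R]_(n + N).

Definition arg q : 'cV[R]_m := par_W (dsubmx q) *m usubmx q + par_b (dsubmx q).

Definition grad_row q : 'rV[R]_n :=
  (par_w (dsubmx q))^T *m J (arg q) *m par_W (dsubmx q).

Definition hess_mx q : 'M[R]_n :=
  \matrix_(i, j) 'D_(unitvec (lshift N i)) (fun q => grad_row q 0 j) q.

Lemma differentiable_entry q i j : differentiable (fun q => q i j) q.
Proof. exact: differentiable_coord. Qed.

Lemma differentiable_dsub_entry q i j :
  differentiable (fun q => (dsubmx q : 'cV[R]_N) i j) q.
Proof. by apply: differentiable_dsubmx => ? ?; exact: differentiable_entry. Qed.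

Lemma differentiable_arg q : differentiable arg q.
Proof.
apply: differentiable_mx => i j; apply: differentiable_addmx => {i j} i j.
  apply: differentiable_mulmx => {i j} i j.
    by apply: differentiable_par_W => ? ?; exact: differentiable_dsub_entry.
  by apply: differentiable_usubmx => ? ?; exact: differentiable_entry.
by apply: differentiable_par_b => ? ?; exact: differentiable_dsub_entry.
Qed.

Lemma differentiable_J_arg q i j : D (arg q) -> differentiable (fun q => J (arg q) i j) q.
Proof.
move=> Dq; apply: (@differentiable_comp _ _ _ _ arg (fun a => J a i j)).
  exact: differentiable_arg.
exact: dJ.
Qed.

Lemma differentiable_grad q i j : D (arg q) -> differentiable (fun q => grad_row q i j) q.
Proof.
move=> Dq; apply: differentiable_mulmx => {i j} i j.
  apply: differentiable_mulmx => {i j} i j; last exact: differentiable_J_arg.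
  apply: differentiable_trmx => {i j} i j.
  by apply: differentiable_par_w => ? ?; exact: differentiable_dsub_entry.
by apply: differentiable_par_W => ? ?; exact: differentiable_dsub_entry.
Qed.

Lemma shift_usubmx q (h : R) i :
  usubmx (h *: unitvec (lshift N i) + q) = h *: unitvec i + usubmx q.
Proof. by apply/matrixP => a b; rewrite !mxE eq_lshift. Qed.

Lemma shift_dsubmx q (h : R) (i : 'I_n) :
  dsubmx (h *: unitvec (lshift N i) + q) = dsubmx q.
Proof. by apply/matrixP => a b; rewrite !mxE eq_rlshift mulr0 add0r. Qed.

(** The entries are polynomial in the weights and in the first derivatives of J, from which
    [hess_mx_continuous] follows. *)
Lemma hess_mxE q i j : D (arg q) -> hess_mx q i j =
  \sum_(p < m) \sum_(l < m) par_w (dsubmx q) l 0 * par_W (dsubmx q) p j *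
    \sum_(r < m) par_W (dsubmx q) r i * 'D_(unitvec r) (fun a => J a l p) (arg q).
Proof.
move=> Dq; rewrite mxE.
pose w := par_w (dsubmx q); pose W := par_W (dsubmx q).
have DJ (l p : 'I_m) : 'D_(unitvec (lshift N i)) (fun q => J (arg q) l p) q =
    \sum_(r < m) W r i * 'D_(unitvec r) (fun a => J a l p) (arg q).
  (* A move of x_i shifts [arg] along column i of W, so the derivative of J along this column is the
     one sought. *)
  have argq (h : R) : arg (h *: unitvec (lshift N i) + q) = h *: col i W + arg q.
    rewrite /arg shift_usubmx shift_dsubmx mulmxDr -scalemxAr addrA; congr (_ *: _ + _ + _).
    by rewrite colE.
  have [_] := derive_affine (fun a => J a l p) argq.
  rewrite -[_ \o arg]/(fun q => J (arg q) l p) => ->.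
  have dJa := dJ l p Dq; rewrite deriveE// -[in LHS](cV_unitvec_sum (col i W)) linear_sum.
  apply: eq_bigr => r _; rewrite linearZ /= mxE; congr (_ * _).
  by rewrite deriveE.
have dc (l p : 'I_m) : is_derive q (unitvec (lshift N i))
    (fun q => par_w (dsubmx q) l 0 * par_W (dsubmx q) p j) 0.
  by apply: is_derive_affine_functional => h; rewrite shift_dsubmx mulr0 add0r.
have dJq (l p : 'I_m) : is_derive q (unitvec (lshift N i)) (fun q => J (arg q) l p)
    (\sum_(r < m) W r i * 'D_(unitvec r) (fun a => J a l p) (arg q)).
  by rewrite -DJ; apply/derivableP/diff_derivable; exact: differentiable_J_arg.
have -> : (fun q => grad_row q 0 j) = (fun q => \sum_(p < m) \sum_(l < m)
    par_w (dsubmx q) l 0 * par_W (dsubmx q) p j * J (arg q) l p).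
  apply/funext => q'; rewrite mxE; apply: eq_bigr => p _.
  by rewrite mxE mulr_suml; apply: eq_bigr => l _; rewrite mxE mulrAC.
have dG : is_derive q (unitvec (lshift N i)) (fun q => \sum_(p < m) \sum_(l < m)
    par_w (dsubmx q) l 0 * par_W (dsubmx q) p j * J (arg q) l p)
  (\sum_(p < m) \sum_(l < m) par_w (dsubmx q) l 0 * par_W (dsubmx q) p j *
    \sum_(r < m) par_W (dsubmx q) r i * 'D_(unitvec r) (fun a => J a l p) (arg q)).
  apply: is_derive_sum_ord => p; apply: is_derive_sum_ord => l.
  have := is_deriveM (dc l p) (dJq l p).
  by rewrite scaler0 addr0.
by rewrite derive_val.
Qed.

Lemma arg_continuous : continuous arg.
Proof. by move=> q; apply: differentiable_continuous; exact: differentiable_arg. Qed.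

Lemma open_arg : open (arg @^-1` D).
Proof. by apply: open_comp => // q _; exact: arg_continuous. Qed.

Lemma hess_mx_continuous q i j : D (arg q) -> {for q, continuous (fun q => hess_mx q i j)}.
Proof.
move=> Dq.
have cpar_w l : {for q, continuous (fun q => par_w (dsubmx q) l 0)}.
  apply: differentiable_continuous; apply: differentiable_par_w => ? ?.
  exact: differentiable_dsub_entry.
have cpar_W k l : {for q, continuous (fun q => par_W (dsubmx q) k l)}.
  apply: differentiable_continuous; apply: differentiable_par_W => ? ?.
  exact: differentiable_dsub_entry.
have cE : {for q, continuous (fun q => \sum_(p < m) \sum_(l < m)
    par_w (dsubmx q) l 0 * par_W (dsubmx q) p j *
    \sum_(r < m) par_W (dsubmx q) r i * 'D_(unitvec r) (fun a => J a l p) (arg q))}.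
  apply: continuous_sum_ord => p; apply: continuous_sum_ord => l.
  apply: (@continuousM _ _ (fun q => par_w (dsubmx q) l 0 * par_W (dsubmx q) p j)
    (fun q => \sum_(r < m) par_W (dsubmx q) r i * 'D_(unitvec r) (fun a => J a l p) (arg q))).
    exact: continuousM.
  apply: continuous_sum_ord => r; apply: continuousM; first exact: cpar_W.
  apply: (@continuous_comp _ _ _ arg (fun a => 'D_(unitvec r) (fun a => J a l p) a)).
    exact: arg_continuous.
  exact: cJ.
apply: near_eq_continuous cE _.
have : nbhs q (arg @^-1` D) by apply: open_nbhs_nbhs; split; [exact: open_arg|].
by apply: filterS => q' Dq'; rewrite hess_mxE.
Qed.

Section Chart.
Context (S : 'I_n -> 'I_m).

(* The parameters [w_(S i)] are traded for the point [x]: [chart z] is the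
   parameter vector agreeing with [z] outside these slots, for which the point
   [chart_x z] stored in them is critical. *)
Definition sel : 'M[R]_(n, m) := rowsub S 1%:M.
Implicit Types z : 'cV[R]_N.
Definition chart_x z : 'cV[R]_n := sel *m par_w z.
Definition chart_P z : 'M[R]_(m, n) := J (arg (col_mx (chart_x z) z)) *m par_W z.
Definition chart_M z : 'M[R]_n := sel *m chart_P z.
(** With w0 the output weights erased at the slots [S], the entries u to be put there must satisfy
    M^T u + P^T w0 = 0. Cramer's formula is used because determinant and adjugate are polynomial in
    the entries, which gives differentiability. *)
Definition chart_u z : 'cV[R]_n :=
  - ((\det (chart_M z))^-1 *: (\adj (chart_M z))^T *m
     ((chart_P z)^T *m (par_w z - sel^T *m chart_x z))).
Definition chart z : 'cV[R]_N := z + inj_w n (sel^T *m (chart_u z - chart_x z)).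
Definition chart_dom : set 'cV[R]_N :=
  [set z | D (arg (col_mx (chart_x z) z)) /\ \det (chart_M z) != 0].
Definition chart_point z : 'cV[R]_(n + N) := col_mx (chart_x z) (chart z).
Definition chart_bad : set 'cV[R]_N :=
  [set z | chart_dom z /\ \det (hess_mx (chart_point z)) = 0].

(** Only the output weights are changed, and [arg] ignores them; hence [chart_P] and [chart_M],
    computed from z, are also those of the chart point. *)
Lemma arg_chart_point z : arg (chart_point z) = arg (col_mx (chart_x z) z).
Proof. by rewrite /arg /chart_point !col_mxKu !col_mxKd /chart par_W_inj par_b_inj. Qed.

Lemma grad_chart_point z : chart_dom z -> grad_row (chart_point z) = 0.
Proof.
move=> [_ M0]; rewrite /grad_row arg_chart_point.
rewrite /chart_point !col_mxKd /chart par_W_inj par_w_inj -mulmxA -/(chart_P z).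
have -> : par_w z + sel^T *m (chart_u z - chart_x z) =
    (par_w z - sel^T *m chart_x z) + sel^T *m chart_u z.
  by rewrite mulmxBr addrA addrAC.
set w0 := par_w z - _.
rewrite linearD /= mulmxDl trmx_mul trmxK -mulmxA -/(chart_M z).
rewrite /chart_u -/w0 linearN /= trmx_mul linearZ /= trmxK trmx_mul trmxK.
set c := w0^T *m _; rewrite mulNmx -(mulmxA c) -scalemxAl mul_adj_mx scale_scalar_mx mulVf//.
by rewrite mulmx1 subrr.
Qed.

Lemma differentiable_cst_entry (V : normedModType R) k l (A : 'M[R]_(k, l)) (p : V) i j :
  differentiable (fun q : V => A i j) p.
Proof. exact: differentiable_cst. Qed.

Lemma differentiable_chart_x z i j : differentiable (fun z => chart_x z i j) z.
Proof.
apply: differentiable_mulmx => {i j} i j; first exact: differentiable_cst_entry.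
by apply: differentiable_par_w => ? ?; exact: differentiable_coord.
Qed.

Lemma differentiable_chart_arg z : differentiable (fun z => arg (col_mx (chart_x z) z)) z.
Proof.
apply: (@differentiable_comp _ _ _ _ (fun z => col_mx (chart_x z) z) arg).
  apply: differentiable_mx; apply: differentiable_col_mx => i j.
    exact: differentiable_chart_x.
  exact: differentiable_coord.
exact: differentiable_arg.
Qed.

Lemma differentiable_chart_P z i j : D (arg (col_mx (chart_x z) z)) ->
  differentiable (fun z => chart_P z i j) z.
Proof.
move=> Dz; apply: differentiable_mulmx => {i j} i j.
  apply: (@differentiable_comp _ _ _ _ (fun z => arg (col_mx (chart_x z) z))
    (fun a => J a i j)); first exact: differentiable_chart_arg.
  exact: dJ.
by apply: differentiable_par_W => ? ?; exact: differentiable_coord.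
Qed.

Lemma differentiable_chart_M z i j : D (arg (col_mx (chart_x z) z)) ->
  differentiable (fun z => chart_M z i j) z.
Proof.
move=> Dz; apply: differentiable_mulmx => {i j} i j; first exact: differentiable_cst_entry.
exact: differentiable_chart_P.
Qed.

Lemma differentiable_chart z i j : chart_dom z -> differentiable (fun z => chart z i j) z.
Proof.
move=> [Dz M0]; apply: differentiable_addmx => {i j} i j; first exact: differentiable_coord.
apply: differentiable_inj_w => {i j} i j.
apply: differentiable_mulmx => {i j} i j; first exact: differentiable_cst_entry.
apply: differentiable_addmx => {i j} i j; last first.
  by apply: differentiable_oppmx => ? ?; exact: differentiable_chart_x.
apply: differentiable_oppmx => {i j} i j.
apply: differentiable_mulmx => {i j} i j.
  have -> : (fun z => ((\det (chart_M z))^-1 *: (\adj (chart_M z))^T) i j) =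
      (fun z => (\det (chart_M z))^-1 * \adj (chart_M z) j i).
    by apply/funext => z'; rewrite 2!mxE.
  apply: differentiableM.
    apply: differentiableV => //; apply: differentiable_det => ? ?.
    exact: differentiable_chart_M.
  by apply: differentiable_adj => ? ?; exact: differentiable_chart_M.
apply: differentiable_mulmx => {i j} i j.
  by apply: differentiable_trmx => ? ?; exact: differentiable_chart_P.
apply: differentiable_addmx => {i j} i j.
  by apply: differentiable_par_w => ? ?; exact: differentiable_coord.
apply: differentiable_oppmx => {i j} i j.
apply: differentiable_mulmx => {i j} i j; first exact: differentiable_cst_entry.
exact: differentiable_chart_x.
Qed.

Lemma differentiable_chart_point z : chart_dom z -> differentiable chart_point z.
Proof.
move=> Uz; apply: differentiable_mx; apply: differentiable_col_mx => i j.
  exact: differentiable_chart_x.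
exact: differentiable_chart.
Qed.

Lemma chart_dom_open : open chart_dom.
Proof.
rewrite openE => z [Dz M0].
have oA : open ((fun z => arg (col_mx (chart_x z) z)) @^-1` D).
  apply: open_comp => // y _; apply: differentiable_continuous.
  exact: differentiable_chart_arg.
have nD : nbhs z ((fun z => arg (col_mx (chart_x z) z)) @^-1` D).
  by apply: open_nbhs_nbhs; split.
have cM : {for z, continuous (fun z => \det (chart_M z))}.
  apply: differentiable_continuous; apply: differentiable_det => i j.
  exact: differentiable_chart_M.
have nM : \forall y \near z, \det (chart_M y) != 0 by exact: cvgr_neq0 cM M0.
suff : nbhs z chart_dom by [].
by apply: filterS2 nD nM => y.
Qed.

Lemma chart_bad_closed z : chart_dom z -> ~ chart_bad z ->
  \forall y \near z, ~ chart_bad y.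
Proof.
move=> Uz nAz.
have H0 : \det (hess_mx (chart_point z)) != 0 by apply/eqP => H0; exact: nAz.
have cH : {for z, continuous (fun z => \det (hess_mx (chart_point z)))}.
  apply: continuous_det => i j.
  apply: (@continuous_comp _ _ _ chart_point (fun q => hess_mx q i j)).
    by apply: differentiable_continuous; exact: differentiable_chart_point.
  by apply: hess_mx_continuous; rewrite arg_chart_point; case: Uz.
have : \forall y \near z, \det (hess_mx (chart_point y)) != 0 by exact: cvgr_neq0 cH H0.
by apply: filterS => y /eqP H [_].
Qed.

(** The gradient is linear in the output weights, and [arg] is constant along such a direction. *)
Lemma derive_grad_w q v j :
  'D_(col_mx 0 (inj_w n v)) (fun q => grad_row q 0 j) q =
  (v^T *m (J (arg q) *m par_W (dsubmx q))) 0 j.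
Proof.
have q_shift (h : R) : h *: col_mx (0 : 'cV[R]_n) (inj_w n v) + q =
    q + col_mx 0 (inj_w n (h *: v)).
  by rewrite addrC inj_wZ scale_col_mx scaler0.
have argh (h : R) : arg (q + col_mx 0 (inj_w n (h *: v))) = arg q.
  by rewrite /arg usubmx_add_col dsubmx_add_col addr0 par_W_inj par_b_inj.
have dl : is_derive q (col_mx 0 (inj_w n v)) (fun q => grad_row q 0 j)
    ((v^T *m (J (arg q) *m par_W (dsubmx q))) 0 j).
  apply: is_derive_affine_functional => h; rewrite q_shift /grad_row argh.
  rewrite dsubmx_add_col par_W_inj par_w_inj linearD linearZ /= !mulmxDl.
  by rewrite -!scalemxAl mulmxA mxE addrC [in LHS]mxE.
by rewrite derive_val.
Qed.

(* [l] is the differential of [q |-> grad_row q *m v^T] in the parameter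
   directions, [v] being in the kernel of the Hessian. *)
Lemma chart_bad_conormal z : chart_bad z -> exists K (l : 'rV[R]_N),
  [/\ l != 0, \forall y \near z, `|chart y - chart z| <= K * `|y - z| &
    forall e, 0 < e ->
      \forall y \near z, `|(l *m (chart y - chart z)) 0 0| <= e * `|y - z|].
Proof.
move=> [Uz detH]; pose q := chart_point z.
have Dq : D (arg q) by rewrite /q arg_chart_point; case: Uz.
(* [det0P] gives a row vector killed on the left, so the transpose is taken to contract the gradient
   index j. *)
have /det0P[v v0 vH] : \det (hess_mx q)^T == 0 by rewrite det_tr detH.
have Hv i : \sum_j hess_mx q i j * v 0 j = 0.
  have := congr1 (fun A : 'rV[R]_n => A 0 i) vH; rewrite [(v *m _) 0 i]mxE mxE => {2}<-.
  by apply: eq_bigr => j _; rewrite [(hess_mx q)^T j i]mxE mulrC.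
pose g (q : 'cV[R]_(n + N)) : R := \sum_j grad_row q 0 j * v 0 j.
have dg : differentiable g q.
  apply: differentiable_sum_fin => j; apply: differentiableM; last exact: differentiable_cst.
  exact: differentiable_grad.
have Dg u : 'd g q u = \sum_j 'D_u (fun q => grad_row q 0 j) q * v 0 j.
  rewrite -deriveE//.
  have dG j : is_derive q u (fun q => grad_row q 0 j * v 0 j)
      ('D_u (fun q => grad_row q 0 j) q * v 0 j).
    have dj : is_derive q u (fun q => grad_row q 0 j) ('D_u (fun q => grad_row q 0 j) q).
      by apply/derivableP/diff_derivable; exact: differentiable_grad.
    have := is_deriveM dj (is_derive_cst (v 0 j) q u).
    by rewrite scaler0 add0r (mulrC _ (v 0 j)).
  have dsum := is_derive_sum_ord dG.
  by rewrite derive_val.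
have g0 y : chart_dom y -> g (chart_point y) = 0.
  move=> Uy; rewrite /g big1// => j _; rewrite grad_chart_point//.
  by rewrite [X in X * _]mxE mul0r.
clearbody g.
(* Along x_i the differential of g is the sum over j of [hess_mx q i j * v 0 j], which is zero by
   [Hv]. *)
have gx xi : 'd g q (col_mx xi 0) = 0.
  have -> : col_mx xi 0 = \sum_i xi i 0 *: unitvec (lshift N i) :> 'cV[R]_(n + N).
    apply/colP => k; rewrite summxE; case: (split_ordP k) => k' ->.
      rewrite col_mxEu (bigD1 k')//= big1 => [|i /negbTE ik].
        by rewrite !mxE !eqxx mulr1 addr0.
      by rewrite !mxE eq_lshift eq_sym ik mulr0.
    by rewrite col_mxEd mxE big1// => i _; rewrite !mxE eq_rlshift mulr0.
  rewrite linear_sum big1// => i _; rewrite linearZ /= Dg.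
  have -> : \sum_j 'D_(unitvec (lshift N i)) (fun q => grad_row q 0 j) q * v 0 j = 0.
    by rewrite -[RHS](Hv i); apply: eq_bigr => j _; rewrite [hess_mx q i j]mxE.
  by rewrite scaler0.
pose l : 'rV[R]_N := \row_k 'd g q (col_mx 0 (delta_mx k 0)).
have lE (t : 'cV[R]_N) : (l *m t) 0 0 = 'd g q (col_mx 0 t).
  have -> : col_mx 0 t = \sum_k t k 0 *: col_mx 0 (delta_mx k 0) :> 'cV[R]_(n + N).
    pose L (u : 'cV[R]_N) : 'cV[R]_(n + N) := col_mx 0 u.
    have LD : {morph L : u w / u + w} by move=> u w; rewrite /L add_col_mx addr0.
    have L0 : L 0 = 0 by rewrite /L col_mx0.
    rewrite -[LHS]/(L t) [in LHS](matrix_sum_delta t) (big_morph L LD L0).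
    apply: eq_bigr => k _.
    by rewrite big_ord1 /L scale_col_mx scaler0.
  rewrite linear_sum [LHS]mxE; apply: eq_bigr => k _; rewrite linearZ [l 0 k]mxE.
  by rewrite mulrC.
(* On the output-weight directions l is given by P v^T. If it vanished, v^T would lie in the kernel
   of [chart_M], which is invertible on [chart_dom]. *)
have lne0 : l != 0.
  apply/eqP => l0; have Pv : chart_P z *m v^T = 0.
    apply/colP => p; have := lE (inj_w n (delta_mx p 0)).
    rewrite l0 mul0mx [in LHS]mxE Dg.
    under eq_bigr => j _ do rewrite derive_grad_w.
    have -> : J (arg q) *m par_W (dsubmx q) = chart_P z.
      by rewrite /q arg_chart_point /chart_point col_mxKd /chart par_W_inj.
    move=> H; rewrite [RHS]mxE H [LHS]mxE; apply: eq_bigr => j _.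
    by rewrite trmx_delta -rowE [row p _ 0 j]mxE [v^T j 0]mxE.
  have [_ /negP] := Uz; apply; rewrite -det_tr; apply/det0P; exists v => //.
  by apply: trmx_inj; rewrite trmx_mul trmxK -mulmxA Pv mulmx0 trmx0.
have [K KP] := differentiable_calm (differentiable_mx (fun i j => differentiable_chart i j Uz)).
exists K, l; split=> // e e0.
have nU : nbhs z chart_dom by apply: open_nbhs_nbhs; split; [exact: chart_dom_open|].
have ng : \forall y \near z, g (chart_point y) = g (chart_point z).
  by apply: filterS nU => y Uy; exact: etrans (g0 _ Uy) (esym (g0 _ Uz)).
apply: filterS (differential_along_level (differentiable_chart_point Uz) dg ng e0) => y.
rewrite -/q; suff -> : 'd g q (chart_point y - q) = (l *m (chart y - chart z)) 0 0 by [].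
(* The x-part of the increment is killed by [gx], so the small quantity of
   [differential_along_level] is l applied to the parameter part. *)
have -> : chart_point y - q = col_mx (chart_x y - chart_x z) 0 + col_mx 0 (chart y - chart z).
  by rewrite add_col_mx addr0 add0r /q /chart_point opp_col_mx add_col_mx.
by rewrite linearD gx add0r -lE.
Qed.

Lemma chart_bad_null : sigma_null (chart @` chart_bad).
Proof.
apply: (sard chart_dom_open); [by move=> z []|exact: chart_bad_closed|].
exact: chart_bad_conormal.
Qed.

End Chart.

(* The chart whose slots are [n] independent rows of [J *m par_W] covers the
   given parameter vector. *)
Lemma bad_parameter_chart x (t : 'cV[R]_N) : D (arg (col_mx x t)) ->
  J (arg (col_mx x t)) \in unitmx -> \rank (par_W t) = n ->
  grad_row (col_mx x t) = 0 -> \det (hess_mx (col_mx x t)) = 0 ->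
  exists S : {ffun 'I_n -> 'I_m}, (chart S @` chart_bad S) t.
Proof.
move=> Dx Ju rW g0 H0; pose P := J (arg (col_mx x t)) *m par_W t.
have fP : row_full P by rewrite /row_full /P (eqmxMfull _ _) ?rW// row_full_unit.
pose S := fullrankfun fP.
have Sinj : injective S by exact: fullrankfun_inj.
(* The preimage of t: its output weights at the slots [S] are overwritten by x. *)
exists S; pose z := t + inj_w n ((sel S)^T *m (x - sel S *m par_w t)).
have SS : sel S *m (sel S)^T = 1%:M.
  apply/matrixP => i j; rewrite !mxE (bigD1 (S i))//= big1 => [|p /negbTE pS].
    by rewrite !mxE eqxx mul1r addr0 (inj_eq Sinj) eq_sym.
  by rewrite !mxE eq_sym pS mul0r.
have zx : chart_x S z = x.
  by rewrite /chart_x par_w_inj mulmxDr mulmxA SS mul1mx addrC subrK.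
have zarg : arg (col_mx (chart_x S z) z) = arg (col_mx x t).
  by rewrite zx /arg !col_mxKu !col_mxKd /z par_W_inj par_b_inj.
have zP : chart_P S z = P by rewrite /chart_P zarg /z par_W_inj.
have zM : chart_M S z \in unitmx.
  by rewrite /chart_M zP /sel -rowsubE fullrowsub_unit.
(* Since P^T w = 0, erasing the slots of w leaves P^T w0 = - M^T ([sel S *m par_w t]), so Cramer's
   formula returns the erased entries. *)
have zu : chart_u S z = sel S *m par_w t.
  have Pw : P^T *m par_w t = 0.
    apply: trmx_inj; rewrite trmx_mul trmxK trmx0 -g0 /grad_row !col_mxKd.
    by rewrite mulmxA.
  have -> : chart_u S z = - ((\det (chart_M S z))^-1 *: (\adj (chart_M S z))^T *m
      (P^T *m (par_w t - (sel S)^T *m (sel S *m par_w t)))).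
    rewrite /chart_u zx zP; congr (- (_ *m (_ *m _))).
    by rewrite /z par_w_inj mulmxBr addrCA addrC addrK.
  rewrite mulmxBr Pw sub0r mulmxN opprK (mulmxA P^T) -trmx_mul -zP -/(chart_M S z).
  rewrite (mulmxA _ (_^T)) -scalemxAl -trmx_mul mul_mx_adj tr_scalar_mx scale_scalar_mx.
  by rewrite mulVf ?mul1mx// -unitfE -unitmxE.
have zt : chart S z = t.
  by rewrite /chart zu zx /z -addrA -inj_wD -mulmxDr addrA subrK subrr mulmx0
    /inj_w !col_mx0 addr0.
have zq : chart_point S z = col_mx x t by rewrite /chart_point zt zx.
exists z; last exact: zt.
split; last by rewrite zq.
by split; [rewrite zarg|rewrite -unitfE -unitmxE].
Qed.

End CriticalSet.

(** * Critical points of the neural ODE *)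

Lemma mulmx_continuous (R : realType) p q (M : 'M[R]_(p, q)) :
  continuous (mulmx M : 'cV[R]_q -> 'cV[R]_p).
Proof.
move=> v; apply: differentiable_continuous; apply: differentiable_mx.
apply: differentiable_mulmx => i j; [exact: differentiable_cst|exact: differentiable_coord].
Qed.

(** * The Jacobian of the time-T map *)

Section EndpointJacobian.
Context {R : realType} (T : R) (T0 : 0 <= T) (m : nat) (Omega : set (R * 'cV[R]_m))
  (f : R * 'cV[R]_m -> 'cV[R]_m).
Hypotheses (oO : open Omega) (fC : Cdir (@hdir R m) 2 Omega f).
Local Notation D := (flow_dom T Omega f).
Local Notation Psi := (endpoint T Omega f).

Definition endpoint_jac (a : 'cV[R]_m) : 'M[R]_m :=
  \matrix_(l, i) 'D_(unitvec i) Psi a l 0.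

Lemma endpoint_dom_open : open D.
Proof. by apply: flow_dom_open => //; exact: Cdir_le fC. Qed.

Lemma endpoint_C2 : Cdir (@unitvec R m) 2 D Psi.
Proof.
have smooth := endpoint_smooth T0 oO fC.
apply: (@Cdir_affine _ _ _ _ _ _ _ _ _ _ id (@unitvec R m)) smooth => //.
  by move=> ? ?; exact: cvg_id.
by move=> i; right; exists (unitvec i).
Qed.

Lemma endpoint_jac_coordE l p :
  (fun a => endpoint_jac a l p) = (fun a => 'D_(unitvec p) Psi a l 0).
Proof. by apply/funext => a; rewrite [LHS]mxE. Qed.

Lemma endpoint_jac_differentiable a l p : D a ->
  differentiable (fun a => endpoint_jac a l p) a.
Proof.
move=> Da; rewrite endpoint_jac_coordE; apply: differentiable_coord_of.
exact: C1_differentiable endpoint_dom_open Da (Cdir_derive p endpoint_C2).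
Qed.

Lemma endpoint_jac_derive_continuous a l p r : D a ->
  {for a, continuous (fun a => 'D_(unitvec r) (fun a => endpoint_jac a l p) a)}.
Proof.
move=> Da; rewrite endpoint_jac_coordE.
have C1 := Cdir_coord l 0 endpoint_dom_open (Cdir_derive p endpoint_C2).
exact: (Cdir_derive r C1).1.
Qed.

Lemma endpoint_jac_mul a v : D a -> is_derive a v Psi (endpoint_jac a *m v).
Proof.
move=> Da; have C1 : Cdir (@unitvec R m) 1 D Psi by exact: Cdir_le endpoint_C2.
have := derive_partials v endpoint_dom_open Da C1; rewrite cV_unitvec_sum.
congr is_derive; apply/colP => l; rewrite summxE [RHS]mxE; apply: eq_bigr => i _.
by rewrite [RHS]mulrC [LHS]mxE [in RHS]mxE.
Qed.

Lemma endpoint_jac_unit a : D a -> endpoint_jac a \in unitmx.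
Proof.
move=> Da; rewrite unitmxE unitfE -det_tr; apply/negP => /det0P[v v0 vJ].
have Jv : endpoint_jac a *m v^T = 0.
  by apply: trmx_inj; rewrite trmx_mul trmxK vJ trmx0.
have dv := endpoint_jac_mul v^T Da.
have fC1 : Cdir (@hdir R m) 1 Omega f by exact: Cdir_le fC.
have vT0 : v^T = 0.
  by apply: (endpoint_derive_injective T0 oO fC1 Da); rewrite derive_val.
by move/eqP: v0; apply; apply: trmx_inj; rewrite vT0 trmx0.
Qed.

End EndpointJacobian.

Section NeuralODE.
Context {R : realType} (T : R) (T0 : 0 < T) (n m k : nat)
  (Omegat : set R) (Omegah : set 'cV[R]_m) (f : R * 'cV[R]_m -> 'cV[R]_m)
  (X : set 'cV[R]_n).
Local Notation Omega := (Omegat `*` Omegah).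
Hypotheses (oX : open X) (oO : open Omega) (k2 : (2 <= k)%N) (fC : C0k k Omega f).
Local Notation D := (flow_dom T Omega f).
Local Notation Psi := (endpoint T Omega f).
Local Notation N := (m * n + m + m + 1)%N.
Implicit Types (W : 'M[R]_(m, n)) (Wt : 'M[R]_(1, m)) (b : 'cV[R]_m) (bt : R).

Let T0' : 0 <= T := ltW T0.
Let fC2 : Cdir (@hdir R m) 2 Omega f. Proof. exact: Cdir_le fC. Qed.
Let fC1 : Cdir (@hdir R m) 1 Omega f. Proof. exact: Cdir_le fC2. Qed.

(** Nothing is known of h outside [I]; [clip] confines it to [0, T] and leaves it unchanged there,
    which suffices for [sol]. *)
Lemma maximal_solution_sol a (I : set R) (h : R -> 'cV[R]_m) :
  is_maximal_solution Omega f a I h -> `[0, T] `<=` I -> sol T Omega f a (h \o clip T).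
Proof.
move=> [[oI _ I0 h0 hI] _] TI.
have cI t : I (clip T t) by apply: TI; rewrite /= in_itv /= clip_itv.
split.
- move=> t; apply: (@continuous_comp _ _ _ (clip T) h); first exact: clip_continuous.
  have [_ dh] := hI _ (cI t); apply: differentiable_continuous; apply/derivable1_diffP.
  exact: ex_derive.
- by rewrite /= clip_id// lexx.
- by move=> t tT; rewrite /= clip_id//; apply: (hI _ _).1; apply: TI; rewrite /= in_itv.
- move=> t tT; have /andP[t0 tT'] := tT.
  have ct : clip T t = t by rewrite clip_id// !ltW.
  have [_ dh] := hI _ (cI t); rewrite ct in dh; rewrite /= ct.
  apply: (@near_eq_is_derive _ _ _ h) => //.
  by apply: filterS (near_itv tT) => s /andP[s0 sT]; rewrite /= clip_id// !ltW.
Qed.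

(** By uniqueness the solution chosen at each x disappears, and Phi becomes an explicit function of
    x on [X]. *)
Lemma NODE_endpoint W Wt b bt Phi : NODE Omegat Omegah f T X (W, Wt, b, bt) Phi ->
  forall x, X x -> D (W *m x + b) /\ Phi x = (Wt *m Psi (W *m x + b)) 0 0 + bt.
Proof.
move=> NPhi x Xx; have [_ [I [h [maxh TI ->]]]] := NPhi x Xx.
have solh := maximal_solution_sol maxh TI.
split; first by exists (h \o clip T).
by rewrite (endpointE T0' oO fC1 solh) /= clip_id// lexx ltW.
Qed.

Lemma par_vecm W Wt b bt : let t := vecm (W, Wt, b, bt) in
  [/\ par_W t = W, par_w t = Wt^T & par_b t = b].
Proof.
by rewrite /par_W /par_w /par_b /=; split; rewrite !col_mxKu ?col_mxKd ?trmxK ?mxvecK.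
Qed.

Section Fixed.
Context W Wt b bt (Phi : 'cV[R]_n -> R).
Hypothesis PhiP :
  forall x, X x -> D (W *m x + b) /\ Phi x = (Wt *m Psi (W *m x + b)) 0 0 + bt.
Local Notation t := (vecm (W, Wt, b, bt)).
Local Notation grad q := (grad_row (endpoint_jac T Omega f) q).
Local Notation hess q := (hess_mx (endpoint_jac T Omega f) q).

Let layer (x : 'cV[R]_n) : 'cV[R]_m := W *m x + b.

Let layer_shift v (h : R) x : layer (h *: v + x) = h *: (W *m v) + layer x.
Proof. by rewrite /layer mulmxDr -scalemxAr addrA. Qed.

Let layer_continuous : continuous layer.
Proof.
move=> x; apply: (@continuousD _ _ _ (mulmx W) (cst b)); last exact: cst_continuous.
exact: (@mulmx_continuous _ _ _ W).
Qed.

Lemma arg_vecm x : arg (col_mx x t) = W *m x + b.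
Proof. by rewrite /arg col_mxKu col_mxKd; case: (par_vecm W Wt b bt) => -> _ ->. Qed.

Lemma derive_Phi j x : X x -> 'D_(unitvec j) Phi x = grad (col_mx x t) 0 j.
Proof.
move=> Xx; have [Dx _] := PhiP Xx.
have dPsi : is_derive x (unitvec j) (Psi \o layer)
    (endpoint_jac T Omega f (layer x) *m (W *m unitvec j)).
  have dP := endpoint_jac_mul T0' oO fC2 (W *m unitvec j) Dx.
  have [dA DA] := derive_affine Psi (fun h => layer_shift (unitvec j) h x).
  by apply: DeriveDef; [apply: dA; exact: ex_derive|rewrite DA derive_val].
have dF : is_derive x (unitvec j) (fun y => (Wt *m Psi (layer y)) 0 0 + bt)
    ((Wt *m (endpoint_jac T Omega f (layer x) *m (W *m unitvec j))) 0 0).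
  have dl := is_derive_linear (@mulmx_continuous _ _ _ Wt) dPsi.
  have := is_deriveD (is_derive_coord 0 0 dl) (is_derive_cst bt x (unitvec j)).
  by rewrite addr0.
(* Phi is prescribed on [X] only; openness of [X] makes the derivatives at x agree. *)
have -> : 'D_(unitvec j) Phi x = 'D_(unitvec j) (fun y => (Wt *m Psi (layer y)) 0 0 + bt) x.
  apply: near_eq_derive.
  by apply: filterS (open_nbhs_nbhs (conj oX Xx)) => y /PhiP[].
rewrite derive_val /grad_row arg_vecm col_mxKd.
case: (par_vecm W Wt b bt) => -> -> _.
by rewrite trmxK !mulmxA -colE mxE.
Qed.

Lemma gradient_Phi x : X x -> gradient Phi x = (grad (col_mx x t))^T.
Proof. by move=> Xx; apply/colP => j; rewrite [LHS]mxE derive_Phi// [RHS]mxE. Qed.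

(** Stacking x on top of the fixed parameter vector is affine and sends [unitvec i] to the
    corresponding unit vector, so differentiating the gradient in x is differentiating [grad_row] in
    the x-directions. *)
Lemma hessian_Phi x : X x -> hessian Phi x = hess (col_mx x t).
Proof.
move=> Xx; apply/matrixP => i j; rewrite [LHS]mxE [RHS]mxE.
pose stack (y : 'cV[R]_n) : 'cV[R]_(n + N) := col_mx y t.
have colx (h : R) : stack (h *: unitvec i + x) = h *: unitvec (lshift N i) + stack x.
  have -> : unitvec (lshift N i) = col_mx (unitvec i) 0 :> 'cV[R]_(n + N).
    apply/colP => p; case: (split_ordP p) => p' ->.
      by rewrite col_mxEu !mxE eq_lshift.
    by rewrite col_mxEd !mxE eq_rlshift.
  by rewrite /stack scale_col_mx scaler0 add_col_mx add0r.
rewrite -/(stack x); have [_ <-] := derive_affine (fun q => grad q 0 j) colx.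
apply: near_eq_derive.
by apply: filterS (open_nbhs_nbhs (conj oX Xx)) => y Xy; rewrite derive_Phi.
Qed.

Lemma Ck_Phi : Ck k X Phi.
Proof.
have [k' kE] : exists k', k = k'.+1 by case: (k) k2 => // k' _; exists k'.
have fCk : Cdir (@hdir R m) k'.+1 Omega f by rewrite -kE.
have oD : open D := endpoint_dom_open T0' oO fC2.
(* The input layer turns unit vectors into columns of W, which are arbitrary directions of R^m. *)
have PsiC : Cdir (@unitvec R n) k'.+1 (layer @^-1` D) (Psi \o layer).
  apply: (Cdir_affine (e := id) (B := fun i => W *m unitvec i) _ layer_continuous) => //.
  - by move=> i'; right; exists (W *m unitvec i').
  - exact: endpoint_smooth.
have XD : X `<=` layer @^-1` D by move=> x /PhiP[].
have PsiX := Cdir_subset XD PsiC.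
have C1 := Cdir_coord 0 0 oX (Cdir_linear oX (@mulmx_continuous _ _ _ Wt) PsiX).
have C2 := Cdir_add oX C1 (Cdir_cst (@unitvec R n) k'.+1 X bt).
by rewrite /Ck kE; apply: Cdir_eq oX _ C2 => x /PhiP[_ ->].
Qed.

End Fixed.

(** A finite union, fixed by the dynamics before any parameter vector or network is chosen. *)
Definition exceptional_set : set 'cV[R]_N :=
  \bigcup_(S : {ffun 'I_n -> 'I_m})
    (chart (endpoint_jac T Omega f) S @` chart_bad D (endpoint_jac T Omega f) S).

Lemma exceptional_set_null : lebesgue_null exceptional_set.
Proof.
apply: sigma_null_lebesgue; first by rewrite addn1.
apply: sigma_null_bigcup => S; apply: chart_bad_null.
- exact: endpoint_dom_open.
- by move=> *; exact: endpoint_jac_differentiable.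
- by move=> *; exact: endpoint_jac_derive_continuous.
Qed.

Lemma hessian_unit (th : params R n m) Phi x : ~ exceptional_set (vecm th) ->
  NODE_A Omegat Omegah f T X th Phi -> X x -> critical_point Phi x ->
  hessian Phi x \in unitmx.
Proof.
case: th => [[[W Wt] b] bt] Nth [/NODE_endpoint PhiP [_ rW _]] Xx crit.
have [Dx _] := PhiP x Xx.
rewrite (hessian_Phi PhiP Xx) unitmxE unitfE; apply/negP => /eqP det0; apply: Nth.
have argx := arg_vecm W Wt b bt x.
have [S HS] : exists S : {ffun 'I_n -> 'I_m}, (chart (endpoint_jac T Omega f) S @`
    chart_bad D (endpoint_jac T Omega f) S) (vecm (W, Wt, b, bt)).
  apply: (@bad_parameter_chart _ _ _ _ _ x) => //.
  - by rewrite argx.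
  - by rewrite argx; exact: endpoint_jac_unit.
  - by have [-> _ _] := par_vecm W Wt b bt.
  - by apply: trmx_inj; rewrite -(gradient_Phi PhiP Xx) trmx0.
by exists S.
Qed.

End NeuralODE.

Theorem theorem4p14 (R : realType) (k n m : nat)
    (X : set 'cV[R]_n) (Omegat : set R) (Omegah : set 'cV[R]_m)
    (f : R * 'cV[R]_m -> 'cV[R]_m) (T : R) :
  (2 <= k)%N -> open X -> (n < m)%N ->
  open (Omegat `*` Omegah) -> C0k k (Omegat `*` Omegah) f -> 0 < T ->
  exists2 N : set 'cV[R]_(m * n + m + m + 1),
    lebesgue_null N &
    forall th : params R n m, Vstar th -> ~ N (vecm th) ->
      forall Phi : 'cV[R]_n -> R,
        NODE_A Omegat Omegah f T X th Phi ->
        (classC1 k X Phi \/ classC2 k X Phi) /\ morse X Phi.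
Proof.
move=> k2 oX _ oO fC T0.
exists (@exceptional_set R T n m Omegat Omegah f); first exact: exceptional_set_null k2 fC.
move=> th _ Nth Phi NPhi.
have unitH x : X x -> critical_point Phi x -> hessian Phi x \in unitmx.
  exact: (hessian_unit T0 oX oO k2 fC Nth NPhi).
have CPhi : Ck k X Phi.
  case: th NPhi {Nth} => [[[W Wt] b] bt] [NPhi _].
  exact: (Ck_Phi T0 oX oO k2 fC (NODE_endpoint T0 oO k2 fC NPhi)).
split; last by split; [exact: Cdir_le CPhi|exact: unitH].
have [crit|nocrit] := EM (exists2 x, X x & critical_point Phi x).
  by right; split.
by left; split.
Qed.
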